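(* Let $w\in\mathbb{C}\{x,y\}$ with $w(0,0)\neq0$, and for $\Delta\in\mathbb{C}\{x,y\}$ with $\Delta(0,0)=0$ let $\varphi_{\Delta,w}(x,y)=(x+y(y-x)\Delta(x,y),\,y+y(y-x)w(x,y))$. Suppose that $\log\varphi_{0,w}$ is not convergent. Then there exists $\Delta\in\mathbb{C}\{x,y\}$ with $\Delta(0,0)=0$ such that $\varphi_{\Delta,w}$ has non-embeddable formal class.
   Context: A formal vector field on $(\mathbb{C}^2,0)$ is a derivation of $\mathbb{C}[[x,y]]$; it is nilpotent if it vanishes at $0$ and its linear part is nilpotent. A formal diffeomorphism is a pair of formal power series without constant term with invertible linear part; it is unipotent if $1$ is the only eigenvalue of its linear part. For a unipotent formal diffeomorphism $\varphi$, $\log\varphi$ is the unique formal nilpotent vector field $X$ with $g\circ\varphi=\sum_{j\ge0}X^j(g)/j!$ for all $g\in\mathbb{C}[[x,y]]$; it is convergent if its coefficients belong to $\mathbb{C}\{x,y\}$. The formal class of a unipotent germ $\varphi$ is embeddable if there is a formal diffeomorphism $\hat\sigma$ such that $\hat\sigma_*\log\varphi$ is a convergent germ of vector field, where $(\hat\sigma_*X)(g)=[X(g\circ\hat\sigma)]\circ\hat\sigma^{-1}$; otherwise it is non-embeddable. *)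

(* Defs.v *)
From HB Require Import structures.
From mathcomp Require Import all_boot all_order all_algebra.
From mathcomp Require Import all_classical all_reals all_analysis.
From mathcomp Require Import complex.

Set Implicit Arguments.
Unset Strict Implicit.
Unset Printing Implicit Defensive.

Import Order.TTheory GRing.Theory Num.Theory.

Local Open Scope classical_set_scope.
Local Open Scope ring_scope.

(* Elements of K[[x,y]]; [f i j] is the coefficient of x^i y^j. *)

Record fps2 (K : Type) := Fps2 { coef2 :> nat -> nat -> K }.

Lemma fps2P (K : Type) (f g : fps2 K) : (forall i j, f i j = g i j) -> f = g.
Proof.
case: f g => [f] [g] /= fg; congr Fps2.
by apply/funext => i; apply/funext => j; exact: fg.
Qed.

HB.instance Definition _ (K : Type) := gen_eqMixin (fps2 K).
HB.instance Definition _ (K : Type) := gen_choiceMixin (fps2 K).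

Section Ring.
Variable K : comNzRingType.
Implicit Types f g h : fps2 K.

Definition fps2_zero : fps2 K := Fps2 (fun _ _ => 0).
Definition fps2_one : fps2 K :=
  Fps2 (fun i j => ((i == 0%N) && (j == 0%N))%:R).
Definition fps2_opp f : fps2 K := Fps2 (fun i j => - f i j).
Definition fps2_add f g : fps2 K := Fps2 (fun i j => f i j + g i j).
Definition fps2_scale (a : K) f : fps2 K := Fps2 (fun i j => a * f i j).
Definition fps2_mul f g : fps2 K :=
  Fps2 (fun i j => \sum_(k < i.+1) \sum_(l < j.+1)
    f k l * g (i - k)%N (j - l)%N).

Lemma fps2_addA : associative fps2_add.
Proof. by move=> f g h; apply: fps2P => i j /=; rewrite addrA. Qed.
Lemma fps2_addC : commutative fps2_add.
Proof. by move=> f g; apply: fps2P => i j /=; rewrite addrC. Qed.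
Lemma fps2_add0 : left_id fps2_zero fps2_add.
Proof. by move=> f; apply: fps2P => i j /=; rewrite add0r. Qed.
Lemma fps2_addN : left_inverse fps2_zero fps2_opp fps2_add.
Proof. by move=> f; apply: fps2P => i j /=; rewrite addNr. Qed.

HB.instance Definition _ := GRing.isZmodule.Build (fps2 K)
  fps2_addA fps2_addC fps2_add0 fps2_addN.

Definition fps2_trunc n f : {poly {poly K}} :=
  \poly_(i < n) \poly_(j < n) f i j.

Lemma fps2_trunc_coef n f i j :
  (i < n)%N -> (j < n)%N -> (fps2_trunc n f)`_i`_j = f i j.
Proof. by move=> lin ljn; rewrite coef_poly lin coef_poly ljn. Qed.

Lemma fps2_mulE n f g i j (p q : {poly {poly K}}) :
  (i < n)%N -> (j < n)%N ->
  (forall k l, (k < n)%N -> (l < n)%N -> p`_k`_l = f k l) ->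
  (forall k l, (k < n)%N -> (l < n)%N -> q`_k`_l = g k l) ->
  fps2_mul f g i j = (p * q)`_i`_j.
Proof.
move=> lin ljn pf qg; rewrite coefM coef_sum /=; apply: eq_bigr => k _.
rewrite coefM; apply: eq_bigr => l _.
have lk : (k < n)%N := leq_ltn_trans (ltn_ord k : (k <= i)%N) lin.
have ll : (l < n)%N := leq_ltn_trans (ltn_ord l : (l <= j)%N) ljn.
rewrite pf// qg//.
  exact: leq_ltn_trans (leq_subr _ _) lin.
exact: leq_ltn_trans (leq_subr _ _) ljn.
Qed.

Lemma fps2_mulA : associative fps2_mul.
Proof.
move=> f g h; apply: fps2P => i j; set n := (i + j).+1.
have lin : (i < n)%N by rewrite ltnS leq_addr.
have ljn : (j < n)%N by rewrite ltnS leq_addl.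
have t := @fps2_trunc_coef n.
rewrite (@fps2_mulE n _ _ _ _ (fps2_trunc n f)
  (fps2_trunc n g * fps2_trunc n h))//; try exact: t.
  rewrite (@fps2_mulE n _ _ _ _ (fps2_trunc n f * fps2_trunc n g)
    (fps2_trunc n h))//; try exact: t.
    by rewrite mulrA.
  by move=> k l lk ll; rewrite -(@fps2_mulE n f g)//; exact: t.
by move=> k l lk ll; rewrite -(@fps2_mulE n g h)//; exact: t.
Qed.

Lemma fps2_mulC : commutative fps2_mul.
Proof.
move=> f g; apply: fps2P => i j; set n := (i + j).+1.
have lin : (i < n)%N by rewrite ltnS leq_addr.
have ljn : (j < n)%N by rewrite ltnS leq_addl.
have t := @fps2_trunc_coef n.
rewrite (@fps2_mulE n _ _ _ _ (fps2_trunc n f) (fps2_trunc n g))//;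
  try exact: t.
rewrite (@fps2_mulE n _ _ _ _ (fps2_trunc n g) (fps2_trunc n f))//;
  try exact: t.
by rewrite mulrC.
Qed.

Lemma fps2_mul1 : left_id fps2_one fps2_mul.
Proof.
move=> f; apply: fps2P => i j /=.
rewrite (bigD1 ord0)//= [X in _ + X]big1 ?addr0 => [|k]; last first.
  rewrite -val_eqE /= => /negPf k0.
  by rewrite big1// => l _; rewrite k0 mul0r.
rewrite (bigD1 ord0)//= [X in _ + X]big1 ?addr0 => [|l]; last first.
  by rewrite -val_eqE /= => /negPf ->; rewrite mul0r.
by rewrite mul1r !subn0.
Qed.

Lemma fps2_mulD : left_distributive fps2_mul fps2_add.
Proof.
move=> f g h; apply: fps2P => i j /=; rewrite -big_split; apply: eq_bigr => k _.
by rewrite -big_split; apply: eq_bigr => l _ /=; rewrite mulrDl.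
Qed.

Lemma fps2_oner_neq0 : fps2_one != 0.
Proof.
apply/eqP => /(congr1 (fun f : fps2 K => f 0%N 0%N)) /= /eqP.
by rewrite oner_eq0.
Qed.

HB.instance Definition _ := GRing.Zmodule_isComNzRing.Build (fps2 K)
  fps2_mulA fps2_mulC fps2_mul1 fps2_mulD fps2_oner_neq0.

Lemma fps2_scaleA a b f :
  fps2_scale a (fps2_scale b f) = fps2_scale (a * b) f.
Proof. by apply: fps2P => i j /=; rewrite mulrA. Qed.
Lemma fps2_scale1 : left_id 1 fps2_scale.
Proof. by move=> f; apply: fps2P => i j /=; rewrite mul1r. Qed.
Lemma fps2_scaleDr : right_distributive fps2_scale +%R.
Proof. by move=> a f g; apply: fps2P => i j /=; rewrite mulrDr. Qed.
Lemma fps2_scaleDl f : {morph fps2_scale^~ f : a b / a + b}.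
Proof. by move=> a b; apply: fps2P => i j /=; rewrite mulrDl. Qed.

HB.instance Definition _ := GRing.Zmodule_isLmodule.Build K (fps2 K)
  fps2_scaleA fps2_scale1 fps2_scaleDr fps2_scaleDl.

Lemma fps2_scaleAl (a : K) f g : a *: (f * g) = (a *: f) * g.
Proof.
apply: fps2P => i j /=; rewrite mulr_sumr; apply: eq_bigr => k _.
by rewrite mulr_sumr; apply: eq_bigr => l _; rewrite mulrA.
Qed.

HB.instance Definition _ := GRing.Lmodule_isLalgebra.Build K (fps2 K)
  fps2_scaleAl.
HB.instance Definition _ := GRing.Lalgebra_isComAlgebra.Build K (fps2 K).

Definition varx : fps2 K := Fps2 (fun i j => ((i == 1%N) && (j == 0%N))%:R).
Definition vary : fps2 K := Fps2 (fun i j => ((i == 0%N) && (j == 1%N))%:R).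

End Ring.

Arguments varx {K}.
Arguments vary {K}.

Section Formal.
Variable K : fieldType.
Implicit Types (f g : fps2 K) (phi sigma tau : fps2 K * fps2 K).
Implicit Types X : fps2 K -> fps2 K.

(* [g \o phi].  Only meaningful when [phi] has no constant term: then
   [phi.1 ^+ k * phi.2 ^+ l] has order at least [k + l], and the indices
   [k, l] left out do not contribute to the coefficient of x^i y^j. *)
Definition fps2_comp g phi : fps2 K :=
  Fps2 (fun i j => \sum_(k < (i + j).+1) \sum_(l < (i + j).+1)
    g k l * (phi.1 ^+ k * phi.2 ^+ l : fps2 K) i j).

Definition pair_comp sigma tau : fps2 K * fps2 K :=
  (fps2_comp sigma.1 tau, fps2_comp sigma.2 tau).

Definition no_constant_term phi : Prop :=
  phi.1 0%N 0%N = 0 /\ phi.2 0%N 0%N = 0.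

Definition linear_part phi : 'M[K]_2 :=
  \matrix_(r < 2, c < 2)
    (if r == 0 then phi.1 else phi.2) (c == 0 : nat) (c == 1 : nat).

Definition formal_diffeo phi : Prop :=
  no_constant_term phi /\ linear_part phi \in unitmx.

Definition unipotent phi : Prop :=
  formal_diffeo phi /\
  forall a : K, eigenvalue (linear_part phi) a <-> a = 1.

(* Inverse for composition; the default value plays no role, since a formal
   diffeomorphism has exactly one inverse. *)
Definition formal_inverse sigma : fps2 K * fps2 K :=
  xget (varx, vary) [set tau | [/\ formal_diffeo tau,
    pair_comp sigma tau = (varx, vary) & pair_comp tau sigma = (varx, vary)]].

(* The vector field [X] is a(x,y) d/dx + b(x,y) d/dy with
   [vf_coefs X = (a, b)]. *)
Definition formal_vector_field X : Prop :=
  linear X /\ forall f g, X (f * g) = X f * g + f * X g.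

Definition vf_coefs X : fps2 K * fps2 K := (X varx, X vary).

Definition nilpotent_vf X : Prop :=
  [/\ formal_vector_field X, no_constant_term (vf_coefs X) &
      exists n, linear_part (vf_coefs X) ^+ n = 0].

(* The series of general term [u] converges to [s] for the (x,y)-adic
   topology. *)
Definition fps2_series_to (u : nat -> fps2 K) (s : fps2 K) : Prop :=
  forall N, exists J0, forall J, (J0 <= J)%N ->
  forall i j, (i + j < N)%N -> (\sum_(k < J) u k) i j = s i j.

Definition is_log phi X : Prop :=
  nilpotent_vf X /\
  forall g, fps2_series_to (fun j => (j`!%:R)^-1 *: iter j X g)
                           (fps2_comp g phi).

(* When [K] has characteristic 0 and [phi] is unipotent, exactly one [X]
   satisfies [is_log phi X]; the default value is not used. *)
Definition flog phi : fps2 K -> fps2 K :=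
  xget (fun=> 0) [set X | is_log phi X].

Definition pushforward sigma X : fps2 K -> fps2 K :=
  fun g => fps2_comp (X (fps2_comp g sigma)) (formal_inverse sigma).

End Formal.

Section Convergent.
Variable R : realType.

(* [f] is in C{x,y}: it converges absolutely on a polydisc of radius [r]. *)
Definition convergent (f : fps2 R[i]) : Prop :=
  exists2 r : R, 0 < r &
    summable [set: nat * nat]
      (fun k => (ComplexField.Normc.normc (f k.1 k.2) * r ^+ (k.1 + k.2))%:E).

Definition convergent_vf (X : fps2 R[i] -> fps2 R[i]) : Prop :=
  convergent (vf_coefs X).1 /\ convergent (vf_coefs X).2.

Definition unipotent_germ (phi : fps2 R[i] * fps2 R[i]) : Prop :=
  [/\ unipotent phi, convergent phi.1 & convergent phi.2].

Definition embeddable_class (phi : fps2 R[i] * fps2 R[i]) : Prop :=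
  unipotent_germ phi /\
  exists2 sigma, formal_diffeo sigma &
    convergent_vf (pushforward sigma (flog phi)).

Definition non_embeddable_class (phi : fps2 R[i] * fps2 R[i]) : Prop :=
  unipotent_germ phi /\ ~ embeddable_class phi.

Definition phi_family (Delta w : fps2 R[i]) : fps2 R[i] * fps2 R[i] :=
  (varx + vary * (vary - varx) * Delta, vary + vary * (vary - varx) * w).

End Convergent.

(* Main.v *)
Require Import Defs.
From mathcomp Require Import all_boot all_order all_algebra.
From mathcomp Require Import all_classical all_reals all_analysis.
From mathcomp Require Import complex ring zify.

Set Implicit Arguments.
Unset Strict Implicit.
Unset Printing Implicit Defensive.

Import Order.TTheory GRing.Theory Num.Theory.
Local Open Scope ring_scope.

(* Every [phi = phi_{Delta,w}] fixes the curves [y = 0] and [y = x] pointwise and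
   has a unique formal first integral [f] with [f(x,0) = x].

   If [log phi] is formally conjugate to a convergent vector field, then [f(x,x)]
   converges.  Indeed, after a linear change of coordinates that field is
   [Q (C d/dx + d/dy)] with [Q] and [C] convergent, so it has a convergent first
   integral.  The conjugacy [sigma] may diverge, but its restrictions to the two
   fixed curves converge: [sigma] maps these curves into [Q = 0] and preserves the
   transverse cofactors of the fields, and the cofactors of [log phi] along the
   curves are the logarithms of those of [phi], hence convergent.

   Suppose that [phi_{Delta,w}] is embeddable for every [Delta].  Replace [Delta] by
   [z Delta] with [z] real.  The coefficient of [x^n] in [f_z(x,x)] is a polynomial of
   degree at most [n] in [z], and for each [z] these values grow at most
   geometrically in [n]; by Baire's theorem so do the coefficients of the
   polynomials, and the derivative of [f_z(x,x)] at [z = 0] converges.  Writing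
   [log phi_{0,w} = y (y - x) b d/dy] and [c = 1 / b], this derivative is, up to sign,
   the integral of [c Delta] in [y] from [0] to [x].  For
   [Delta = sum_(j >= 1) mu^j y^j] its coefficients are polynomials in [mu], and the
   same argument in [mu] bounds geometrically all the moments
   [sum_(k <= d) c_(d-k,k) / (k + m + 1)], [m >= 1].  Newton interpolation in [m]
   recovers [c_(d-k,k)] from them with geometric loss, so [c], then [b] and
   [log phi_{0,w}], converge. *)

(** * Formal power series and composition *)

(** Embeddability gives a radius of convergence for each single [z], with no control in [z], through
    a conjugacy that is only formal. Hence the argument retains one series in one variable,
    [f(x,x)], and gets uniformity from Baire. The degree bound in [z] comes from [Delta(0,0) = 0]:
    every factor [z] is accompanied by a monomial of positive degree. It is what keeps the loss of
    polynomial interpolation geometric.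

    The image of a fixed curve under the conjugacy is caught by two equations, [Q = 0] and the value
    of the cofactor of [Q]. As [Q] has a node at the origin, these equations degenerate there; one
    blow-up turns them into a local diffeomorphism, and convergence follows from the inverse
    function theorem.

    The algebra is done over commutative rings, so that it applies to coefficients polynomial in
    [z]. Convergence is a uniform bound on finite sums of norms over squares of indices: every
    estimate compares finite sums, and an unknown term can be absorbed before its convergence is
    known. *)

Lemma sum_ord_delta (V : pzRingType) n a (F : nat -> V) :
  \sum_(k < n) (k == a :> nat)%:R * F k = if (a < n)%N then F a else 0.
Proof.
case: ifP => [an|/negbT]; last rewrite -leqNgt => na.
  rewrite (bigD1 (Ordinal an))//= eqxx mul1r big1 ?addr0// => k.
  by rewrite -val_eqE /= => /negPf ->; rewrite mul0r.
rewrite big1// => k _; case: eqP => [ka|]; last by rewrite mul0r.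
by move: (ltn_ord k); rewrite ka ltnNge na.
Qed.

Section Order.
Variable A : comNzRingType.
Implicit Types f g h : fps2 A.

Lemma coef2D f g i j : (f + g) i j = f i j + g i j. Proof. by []. Qed.
Lemma coef2N f i j : (- f) i j = - f i j. Proof. by []. Qed.
Lemma coef2Z a f i j : (a *: f) i j = a * f i j. Proof. by []. Qed.
Lemma coef2M f g i j : (f * g) i j =
  \sum_(k < i.+1) \sum_(l < j.+1) f k l * g (i - k)%N (j - l)%N.
Proof. by []. Qed.

Lemma coef2_sum (I : Type) (r : seq I) (P : pred I) (F : I -> fps2 A) i j :
  (\sum_(k <- r | P k) F k) i j = \sum_(k <- r | P k) F k i j.
Proof.
exact: (big_morph (fun f : fps2 A => f i j)).
Qed.

Definition ordge n f := forall i j, (i + j < n)%N -> f i j = 0.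
Arguments ordge n%_N f.

Lemma ordge0 f : ordge 0 f. Proof. by []. Qed.
Lemma ordge_zero n : ordge n 0. Proof. by []. Qed.
Lemma ordgeD n f g : ordge n f -> ordge n g -> ordge n (f + g).
Proof. by move=> nf ng i j ij; rewrite coef2D nf// ng// addr0. Qed.
Lemma ordgeN n f : ordge n f -> ordge n (- f).
Proof. by move=> nf i j ij; rewrite coef2N nf// oppr0. Qed.
Lemma ordgeB n f g : ordge n f -> ordge n g -> ordge n (f - g).
Proof. by move=> nf ng; apply/ordgeD => //; exact: ordgeN. Qed.
Lemma ordgeZ n a f : ordge n f -> ordge n (a *: f).
Proof. by move=> nf i j ij; rewrite coef2Z nf// mulr0. Qed.
Lemma ordge_le m n f : (m <= n)%N -> ordge n f -> ordge m f.
Proof. by move=> mn nf i j ij; apply: nf; exact: leq_trans mn. Qed.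
Lemma ordge_sum n (I : Type) (r : seq I) (P : pred I) (F : I -> fps2 A) :
  (forall k, P k -> ordge n (F k)) -> ordge n (\sum_(k <- r | P k) F k).
Proof.
by move=> nF; apply: (big_ind (ordge n)) => // f g; exact: ordgeD.
Qed.

Lemma ordgeM m n f g : ordge m f -> ordge n g -> ordge (m + n) (f * g).
Proof.
move=> mf ng i j ij; rewrite coef2M big1// => k _; rewrite big1// => l _.
have [kl|kl] := ltnP (k + l) m; first by rewrite mf// mul0r.
rewrite ng ?mulr0//; have := ltn_ord k; have := ltn_ord l; lia.
Qed.
Lemma ordgeMl n f g : ordge n f -> ordge n (f * g).
Proof. by move=> nf; rewrite -[n]addn0; exact: ordgeM. Qed.
Lemma ordgeMr n f g : ordge n g -> ordge n (f * g).
Proof. by move=> ng; rewrite mulrC; exact: ordgeMl. Qed.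
Lemma ordgeX n f k : ordge n f -> ordge (n * k) (f ^+ k).
Proof.
move=> nf; elim: k => [|k IH]; first by rewrite muln0.
by rewrite mulnS exprS; exact: ordgeM.
Qed.
Lemma ordgeX1 f k : ordge 1 f -> ordge k (f ^+ k).
Proof. by move/(@ordgeX _ _ k); rewrite mul1n. Qed.

Lemma ordge_eq0 f : (forall n, ordge n f) -> f = 0.
Proof. by move=> H; apply: fps2P => i j; exact: (H (i + j).+1). Qed.
Lemma ordge1P f : f 0%N 0%N = 0 <-> ordge 1 f.
Proof.
split=> [f0 i j|]; last by move=> /(_ 0%N 0%N); exact.
by rewrite ltnS leqn0 addn_eq0 => /andP[/eqP-> /eqP->].
Qed.
Lemma ordge2P f :
  [/\ f 0%N 0%N = 0, f 1%N 0%N = 0 & f 0%N 1%N = 0] <-> ordge 2 f.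
Proof.
split=> [[f00 f10 f01] i j|H]; last by split; exact: H.
by case: i => [|[|i]]; case: j => [|[|j]] //=; lia.
Qed.
Lemma ordge_eq n f g i j : ordge n (f - g) -> (i + j < n)%N -> f i j = g i j.
Proof. by move=> /(_ i j) H /H /eqP; rewrite coef2D coef2N subr_eq0 => /eqP. Qed.
Lemma ordge_eqP f g : (forall n, ordge n (f - g)) -> f = g.
Proof. by move/ordge_eq0/eqP; rewrite subr_eq0 => /eqP. Qed.
Lemma ordge_trans n f g h : ordge n (f - g) -> ordge n (g - h) -> ordge n (f - h).
Proof. by move=> a b; rewrite -(subrK g f) -addrA; exact: ordgeD. Qed.
Lemma ordge_sym n f g : ordge n (f - g) -> ordge n (g - f).
Proof. by move=> a; rewrite -opprB; exact: ordgeN. Qed.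
Lemma ordge_congr n f g : ordge n (f - g) -> ordge n g -> ordge n f.
Proof. by move=> a b; rewrite -(subrK g f); exact: ordgeD. Qed.
Lemma ordgeBM m n a b f f' g g' : ordge m (f - f') -> ordge n (g - g') ->
  ordge a f -> ordge b g' ->
  ordge (minn (m + b) (a + n)) (f * g - f' * g').
Proof.
move=> ff gg fa gb.
have -> : f * g - f' * g' = f * (g - g') + (f - f') * g' by ring.
apply: ordgeD; first by apply: ordge_le (ordgeM fa gg); exact: geq_minr.
by apply: ordge_le (ordgeM ff gb); exact: geq_minl.
Qed.

Definition mono a b : fps2 A := Fps2 (fun i j => ((i == a) && (j == b))%:R).
Arguments mono (a b)%_N.

Lemma varxE : varx = mono 1 0. Proof. by []. Qed.
Lemma varyE : vary = mono 0 1. Proof. by []. Qed.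
Lemma mono00 : mono 0 0 = 1. Proof. by []. Qed.

Lemma coef2_monoM a b f i j : (mono a b * f) i j =
  if (a <= i)%N && (b <= j)%N then f (i - a)%N (j - b)%N else 0.
Proof.
rewrite coef2M.
transitivity (\sum_(k < i.+1) (k == a :> nat)%:R *
    (if (b <= j)%N then f (i - k)%N (j - b)%N else 0)).
  apply: eq_bigr => k _ /=; rewrite -ltnS.
  rewrite -(sum_ord_delta j.+1 b (fun l => f (i - k)%N (j - l)%N)) mulr_sumr.
  by apply: eq_bigr => l _; rewrite -mulnb natrM mulrA.
rewrite (sum_ord_delta i.+1 a (fun k => if (b <= j)%N then f (i - k)%N (j - b)%N else 0)).
by rewrite ltnS; case: (a <= i)%N => //; case: (b <= j)%N.
Qed.

Lemma monoM a b c d : mono a b * mono c d = mono (a + c) (b + d).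
Proof.
apply: fps2P => i j; rewrite coef2_monoM /=.
have -> : (i == a + c)%N && (j == b + d)%N =
    ((a <= i)%N && (b <= j)%N) && ((i - a == c)%N && (j - b == d)%N) by lia.
by case: ifP.
Qed.

Lemma monoE a b : mono a b = varx ^+ a * vary ^+ b.
Proof.
have -> : varx ^+ a = mono a 0.
  by elim: a => // a IH; rewrite exprS IH varxE monoM.
have -> : vary ^+ b = mono 0 b.
  by elim: b => // b IH; rewrite exprS IH varyE monoM.
by rewrite monoM addn0.
Qed.

Lemma ordge_mono a b : ordge (a + b) (mono a b).
Proof.
move=> i j ij; rewrite /=; case: eqP => [ia|//]; case: eqP => [jb|//].
by move: ij; rewrite ia jb ltnn.
Qed.
Lemma ordge_varx : ordge 1 varx. Proof. exact: (@ordge_mono 1%N 0%N). Qed.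
Lemma ordge_vary : ordge 1 vary. Proof. exact: (@ordge_mono 0%N 1%N). Qed.

Definition boxsum n f (F : nat -> nat -> fps2 A) :=
  \sum_(k < n) \sum_(l < n) f k l *: F k l.

Lemma boxsum_mono n f : ordge n (f - boxsum n f mono).
Proof.
move=> i j ij; rewrite coef2D coef2N coef2_sum.
under eq_bigr => k _.
  rewrite coef2_sum.
  under eq_bigr => l _ do
    rewrite coef2Z mulrC /= -mulnb natrM -mulrA [i == _]eq_sym [j == _]eq_sym.
  rewrite -mulr_sumr (sum_ord_delta n j) (_ : (j < n)%N); last by lia.
  over.
rewrite (sum_ord_delta n i (fun k => f k j)) (_ : (i < n)%N) ?subrr//; lia.
Qed.

(* Linear maps that are continuous for the (x,y)-adic topology. *)
Definition clin (L : fps2 A -> fps2 A) := linear L /\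
  exists s, forall n f, ordge (n + s) f -> ordge n (L f).

Lemma linear0' (L : fps2 A -> fps2 A) : linear L -> L 0 = 0.
Proof. by move=> lL; have := lL (-1) 0 0; rewrite scaler0 addr0 scaleN1r addNr. Qed.
Lemma linearD' (L : fps2 A -> fps2 A) : linear L -> {morph L : f g / f + g}.
Proof. by move=> lL f g; have := lL 1 f g; rewrite !scale1r. Qed.
Lemma linearZ' (L : fps2 A -> fps2 A) : linear L ->
  forall a, {morph L : f / a *: f}.
Proof. by move=> lL a f; have := lL a f 0; rewrite !(addr0, linear0' lL). Qed.
Lemma linearN' (L : fps2 A -> fps2 A) : linear L -> {morph L : f / - f}.
Proof. by move=> lL f; rewrite -scaleN1r (linearZ' lL) scaleN1r. Qed.
Lemma linearB' (L : fps2 A -> fps2 A) : linear L -> {morph L : f g / f - g}.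
Proof. by move=> lL f g; rewrite (linearD' lL) (linearN' lL). Qed.

Lemma clin_sum L : clin L -> forall (I : Type) (r : seq I) (P : pred I) F,
  L (\sum_(k <- r | P k) F k) = \sum_(k <- r | P k) L (F k).
Proof.
move=> [lL _] I r P F.
exact: (big_morph L (linearD' lL) (linear0' lL)).
Qed.

Lemma clin_boxsum L : clin L -> forall n f F,
  L (boxsum n f F) = boxsum n f (fun k l => L (F k l)).
Proof.
move=> cL n f F; rewrite /boxsum (clin_sum cL); apply: eq_bigr => k _.
rewrite (clin_sum cL); apply: eq_bigr => l _.
by rewrite (linearZ' (proj1 cL)).
Qed.

(** The truncations of a series are finite combinations of monomials and converge to it, so a
    continuous linear map is determined by its values on monomials. *)
Lemma clin_ext L M : clin L -> clin M ->
  (forall a b, L (mono a b) = M (mono a b)) -> L =1 M.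
Proof.
move=> cL cM LM f; apply: ordge_eqP => n.
have [lL [s sL]] := cL; have [lM [t tM]] := cM.
set B := boxsum (n + (s + t)) f mono.
have fB : ordge (n + (s + t)) (f - B) by exact: boxsum_mono.
have LB : ordge n (L f - L B).
  by rewrite -(linearB' lL); apply: sL; apply: ordge_le fB; lia.
have MB : ordge n (M f - M B).
  by rewrite -(linearB' lM); apply: tM; apply: ordge_le fB; lia.
apply: (ordge_trans LB).
suff -> : L B = M B by exact: ordge_sym.
rewrite /B !clin_boxsum// /boxsum; apply: eq_bigr => k _.
by apply: eq_bigr => l _; rewrite LM.
Qed.

Lemma clin_id : clin id.
Proof. by split=> //; exists 0%N => n f; rewrite addn0. Qed.
Lemma clin_mulr g : clin (fun f => f * g).
Proof.
split; first by move=> a f h; rewrite mulrDl -scalerAl.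
by exists 0%N => n f; rewrite addn0; exact: ordgeMl.
Qed.
Lemma clin_comp L M : clin L -> clin M -> clin (fun f => L (M f)).
Proof.
move=> [lL [s sL]] [lM [t tM]]; split; first by move=> a f g; rewrite lM lL.
by exists (s + t)%N => n f; rewrite addnA => /tM /sL.
Qed.
Lemma clin_mull L g : clin L -> clin (fun f => L (g * f)).
Proof.
move=> cL; apply: (@clin_comp L (fun f => g * f)) => //.
rewrite (_ : (fun f => g * f) = (fun f => f * g)); first exact: clin_mulr.
by apply/funext => f; rewrite mulrC.
Qed.
Lemma clin_add L M : clin L -> clin M -> clin (fun f => L f + M f).
Proof.
move=> [lL [s sL]] [lM [t tM]]; split.
  by move=> a f g; rewrite lM lL scalerDr addrACA.
exists (s + t)%N => n f nf; apply: ordgeD.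
  by apply: sL; apply: ordge_le nf; lia.
by apply: tM; apply: ordge_le nf; lia.
Qed.

End Order.
Arguments ordge {A} n%_N f.
Arguments mono {A} (a b)%_N.
Arguments ordge_varx {A}.
Arguments ordge_vary {A}.

(** * Substitution of pairs of series *)

Section Comp.
Variable A : comNzRingType.
Implicit Types (f g h : fps2 A) (phi sigma tau : fps2 A * fps2 A).

Definition nct phi := ordge 1 phi.1 /\ ordge 1 phi.2.

(** The formula of [fps2_comp], over any commutative ring: the parameter [z] will be the variable of
    the coefficient ring [{poly K}], which is not a field. *)
Definition fcomp g phi : fps2 A :=
  Fps2 (fun i j => \sum_(k < (i + j).+1) \sum_(l < (i + j).+1)
    g k l * (phi.1 ^+ k * phi.2 ^+ l : fps2 A) i j).

Lemma ordge_powers phi k l : nct phi -> ordge (k + l) (phi.1 ^+ k * phi.2 ^+ l).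
Proof. by move=> [p1 p2]; apply: ordgeM; exact: ordgeX1. Qed.

Lemma fcomp_boxsum n g phi : nct phi ->
  ordge n (fcomp g phi - boxsum n g (fun k l => phi.1 ^+ k * phi.2 ^+ l)).
Proof.
move=> pn i j ij; rewrite coef2D coef2N /boxsum coef2_sum /=; apply/eqP.
rewrite subr_eq0; apply/eqP.
have sub (F : nat -> A) : (forall k, (i + j < k)%N -> F k = 0) ->
    \sum_(k < (i + j).+1) F k = \sum_(k < n) F k.
  move=> F0; rewrite (big_ord_widen n F ij) [RHS](bigID (fun k : 'I_n => k < (i + j).+1)%N)/=.
  by rewrite [X in _ + X]big1 ?addr0// => k; rewrite -leqNgt; exact: F0.
rewrite (sub (fun k => \sum_(l < (i + j).+1)
    g k l * (phi.1 ^+ k * phi.2 ^+ l : fps2 A) i j)); last first.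
  move=> k ijk; rewrite big1// => l _.
  by rewrite (ordge_powers pn) ?mulr0//; lia.
apply: eq_bigr => k _; rewrite coef2_sum.
rewrite (sub (fun l => g k l * (phi.1 ^+ k * phi.2 ^+ l : fps2 A) i j))//.
by move=> l ijl; rewrite (ordge_powers pn) ?mulr0//; lia.
Qed.

Lemma fcomp_linear phi : linear (fcomp^~ phi).
Proof.
move=> a f g; apply: fps2P => i j; rewrite coef2D coef2Z /= mulr_sumr -big_split.
apply: eq_bigr => k _; rewrite /= mulr_sumr -big_split; apply: eq_bigr => l _ /=.
by rewrite mulrDl mulrA.
Qed.

Lemma fcomp_ordge n g phi : nct phi -> ordge n g -> ordge n (fcomp g phi).
Proof.
move=> pn gn; apply: (ordge_congr (@fcomp_boxsum n g _ pn)).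
apply: ordge_sum => k _; apply: ordge_sum => l _.
have [kl|kl] := ltnP (k + l) n; first by rewrite gn// scale0r.
by apply: ordgeZ; apply: (ordge_le kl); exact: ordge_powers.
Qed.

Lemma fcomp_clin phi : nct phi -> clin (fcomp^~ phi).
Proof.
move=> pn; split; first exact: fcomp_linear.
by exists 0%N => n f; rewrite addn0; exact: fcomp_ordge.
Qed.

Lemma fcomp_mono a b phi : nct phi ->
  fcomp (mono a b) phi = phi.1 ^+ a * phi.2 ^+ b.
Proof.
move=> pn; apply: ordge_eqP => n; set N := (n + (a + b).+1)%N.
apply: (@ordge_le _ _ N); first by rewrite /N; lia.
have := @fcomp_boxsum N (mono a b) _ pn.
suff -> : boxsum N (mono a b) (fun k l => phi.1 ^+ k * phi.2 ^+ l) =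
    phi.1 ^+ a * phi.2 ^+ b by [].
have aN : (a < N)%N by rewrite /N; lia.
have bN : (b < N)%N by rewrite /N; lia.
rewrite /boxsum (bigD1 (Ordinal aN))//= [X in _ + X]big1 ?addr0 => [|k]; last first.
  rewrite -val_eqE /= => /negPf ka; rewrite big1// => l _.
  by rewrite ka scale0r.
rewrite (bigD1 (Ordinal bN))//= !eqxx scale1r [X in _ + X]big1 ?addr0// => l.
by rewrite -val_eqE /= => /negPf lb; rewrite lb scale0r.
Qed.

End Comp.
Arguments fcomp {A} g phi.

Section CompRing.
Variable A : comNzRingType.
Implicit Types (f g h : fps2 A) (phi sigma tau : fps2 A * fps2 A).

Lemma clin_ext2 (B1 B2 : fps2 A -> fps2 A -> fps2 A) :
  (forall g, clin (B1^~ g)) -> (forall f, clin (B1 f)) ->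
  (forall g, clin (B2^~ g)) -> (forall f, clin (B2 f)) ->
  (forall a b c d, B1 (mono a b) (mono c d) = B2 (mono a b) (mono c d)) ->
  B1 =2 B2.
Proof.
move=> l1 r1 l2 r2 B12 f g; move: f; apply: clin_ext => // a b.
by move: g; apply: clin_ext.
Qed.

Section Fixed.
Variable phi : fps2 A * fps2 A.
Hypothesis pn : nct phi.

Lemma fcompD : {morph fcomp^~ phi : f g / f + g}.
Proof. exact: (linearD' (@fcomp_linear _ phi)). Qed.
Lemma fcompB : {morph fcomp^~ phi : f g / f - g}.
Proof. exact: (linearB' (@fcomp_linear _ phi)). Qed.
Lemma fcompN : {morph fcomp^~ phi : f / - f}.
Proof. exact: (linearN' (@fcomp_linear _ phi)). Qed.
Lemma fcompZ a : {morph fcomp^~ phi : f / a *: f}.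
Proof. exact: (linearZ' (@fcomp_linear _ phi)). Qed.
Lemma fcomp1 : fcomp 1 phi = 1.
Proof. by rewrite -[1 in LHS]mono00 fcomp_mono// !expr0 mul1r. Qed.
Lemma fcomp_varx : fcomp varx phi = phi.1.
Proof. by rewrite varxE fcomp_mono// expr1 expr0 mulr1. Qed.
Lemma fcomp_vary : fcomp vary phi = phi.2.
Proof. by rewrite varyE fcomp_mono// expr1 expr0 mul1r. Qed.

Lemma fcompM : {morph fcomp^~ phi : f g / f * g}.
Proof.
have cp := fcomp_clin pn.
apply: (@clin_ext2 (fun f g => fcomp (f * g) phi)
  (fun f g => fcomp f phi * fcomp g phi)) => [g|f|g|f|a b c d].
- exact: (clin_comp cp (clin_mulr g)).
- exact: (clin_mull f cp).
- exact: (clin_comp (clin_mulr (fcomp g phi)) cp).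
- apply: (clin_comp (L := fun g => fcomp f phi * g)) => //.
  exact: (clin_mull _ (clin_id A)).
- by rewrite monoM !fcomp_mono// !exprD mulrACA.
Qed.

(** Continuous algebra endomorphisms are substitutions. Associativity of substitution and the fact
    that the exponential of a derivation is a substitution both reduce to this. *)
Lemma fcomp_unique (E : fps2 A -> fps2 A) : clin E ->
  {morph E : f g / f * g} -> E 1 = 1 -> E varx = phi.1 -> E vary = phi.2 ->
  forall g, E g = fcomp g phi.
Proof.
move=> cE EM E1 Ex Ey; apply: clin_ext => //; first exact: fcomp_clin.
move=> a b; have EX n f : E (f ^+ n) = E f ^+ n.
  by elim: n => // n IH; rewrite !exprS EM IH.
by rewrite monoE EM !EX Ex Ey -monoE fcomp_mono.
Qed.

End Fixed.

Definition pcomp sigma tau := (fcomp sigma.1 tau, fcomp sigma.2 tau).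

Lemma nct_pcomp sigma tau : nct sigma -> nct tau -> nct (pcomp sigma tau).
Proof. by move=> [s1 s2] t; split; exact: fcomp_ordge. Qed.

Lemma fcompA g sigma tau : nct sigma -> nct tau ->
  fcomp (fcomp g sigma) tau = fcomp g (pcomp sigma tau).
Proof.
move=> sn tn; apply: (@fcomp_unique _ _ (fun g => fcomp (fcomp g sigma) tau)).
- exact: nct_pcomp.
- exact: (clin_comp (fcomp_clin tn) (fcomp_clin sn)).
- by move=> f h; rewrite !fcompM.
- by rewrite !fcomp1.
- by rewrite fcomp_varx.
- by rewrite fcomp_vary.
Qed.

Lemma nct_id : nct (varx, vary : fps2 A).
Proof. by split; [exact: ordge_varx|exact: ordge_vary]. Qed.

Lemma fcomp_id g : fcomp g (varx, vary) = g.
Proof.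
apply/esym; apply: (@fcomp_unique (varx, vary) _ id) => //; first exact: nct_id.
exact: clin_id.
Qed.

Lemma fcomp_const g phi : fcomp g phi 0%N 0%N = g 0%N 0%N.
Proof. by rewrite /= addn0 !big_ord1 !expr0 mulr1 /= mulr1. Qed.

Lemma fcomp_linear_part g phi : nct phi -> ordge 2 (fcomp g phi -
  (g 0%N 0%N *: 1 + g 1%N 0%N *: phi.1 + g 0%N 1%N *: phi.2)).
Proof.
move=> pn; set l := g 0%N 0%N *: 1 + g 1%N 0%N *: varx + g 0%N 1%N *: vary.
have -> : g 0%N 0%N *: 1 + g 1%N 0%N *: phi.1 + g 0%N 1%N *: phi.2 = fcomp l phi.
  by rewrite !fcompD !fcompZ fcomp1// fcomp_varx// fcomp_vary.
rewrite -fcompB; apply: fcomp_ordge => //; apply/ordge2P.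
by split; rewrite coef2D coef2N !coef2D !coef2Z /= !(mulr0, mulr1, addr0, add0r) subrr.
Qed.

Lemma fcomp_coef10 g phi : nct phi -> fcomp g phi 1%N 0%N =
  g 1%N 0%N * phi.1 1%N 0%N + g 0%N 1%N * phi.2 1%N 0%N.
Proof.
move=> pn; rewrite (ordge_eq (fcomp_linear_part g pn))//.
by rewrite !coef2D !coef2Z /= mulr0 add0r.
Qed.

(** In a product of [s] factors of order 1, exchanging one factor at a time produces a difference of
    order [n] next to [s - 1] factors of order 1. For [s = 2] the agreement improves by one order,
    as fixed point arguments require. *)
Lemma fcomp_contract n s h phi sigma : (0 < n)%N -> nct phi -> nct sigma ->
  ordge n (phi.1 - sigma.1) -> ordge n (phi.2 - sigma.2) -> ordge s h ->
  ordge (n + s - 1) (fcomp h phi - fcomp h sigma).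
Proof.
move=> n0 pn sn n1 n2 sh.
pose P m f f' := [/\ ordge m f, ordge m f' & ordge (n + m - 1) (f - f')].
have PM m p f f' g g' : P m f f' -> P p g g' -> P (m + p)%N (f * g) (f' * g').
  move=> [a b c] [d e k]; split; [exact: ordgeM|exact: ordgeM|].
  by apply: ordge_le (ordgeBM c k a e); lia.
have P1 : P 0%N 1 1 by split => //; rewrite subrr; exact: ordge_zero.
have PX f f' k : P 1%N f f' -> P k (f ^+ k) (f' ^+ k).
  by move=> Pf; elim: k => // k IH; rewrite !exprS -add1n; exact: PM.
have Pm k l : P (k + l)%N (phi.1 ^+ k * phi.2 ^+ l) (sigma.1 ^+ k * sigma.2 ^+ l).
  by apply: PM; apply: PX; split; rewrite ?addnK//; case: pn; case: sn.
set N := (n + s - 1)%N.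
apply: (ordge_trans (@fcomp_boxsum _ N h _ pn)).
apply: (ordge_trans _ (ordge_sym (@fcomp_boxsum _ N h _ sn))).
rewrite /boxsum -sumrB; apply: ordge_sum => k _; rewrite -sumrB.
apply: ordge_sum => l _; rewrite -scalerBr.
have [kl|kl] := ltnP (k + l) s; first by rewrite sh// scale0r; exact: ordge_zero.
by apply: ordgeZ; case: (Pm k l) => _ _; apply: ordge_le; rewrite leq_sub2r// leq_add2l.
Qed.

End CompRing.

(** * Partial derivatives and derivations *)

Section Operators.
Variable A : comNzRingType.
Implicit Types (f g h : fps2 A) (phi sigma tau : fps2 A * fps2 A).

Definition dx f : fps2 A := Fps2 (fun i j => i.+1%:R * f i.+1 j).
Definition dy f : fps2 A := Fps2 (fun i j => j.+1%:R * f i j.+1).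
Definition shx f : fps2 A := Fps2 (fun i j => f i.+1 j).
Definition shy f : fps2 A := Fps2 (fun i j => f i j.+1).

Lemma clin_dx : clin dx.
Proof.
split; last by exists 1%N => n f nf i j ij /=; rewrite nf ?mulr0//; lia.
by move=> a f g; apply: fps2P => i j; rewrite coef2D coef2Z /= mulrDr mulrCA.
Qed.
Lemma clin_dy : clin dy.
Proof.
split; last by exists 1%N => n f nf i j ij /=; rewrite nf ?mulr0//; lia.
by move=> a f g; apply: fps2P => i j; rewrite coef2D coef2Z /= mulrDr mulrCA.
Qed.

Lemma dx_ordge n f : ordge n.+1 f -> ordge n (dx f).
Proof. by move=> nf i j ij /=; rewrite nf ?mulr0//; lia. Qed.
Lemma dy_ordge n f : ordge n.+1 f -> ordge n (dy f).
Proof. by move=> nf i j ij /=; rewrite nf ?mulr0//; lia. Qed.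

Lemma dx_mono a b : dx (mono a b) = a%:R *: mono a.-1 b.
Proof.
apply: fps2P => i j; rewrite coef2Z /=; case: a => [|a] /=; first by rewrite mulr0 mul0r.
by rewrite eqSS; case: eqP => [->//|_]; rewrite !mulr0.
Qed.
Lemma dy_mono a b : dy (mono a b) = b%:R *: mono a b.-1.
Proof.
apply: fps2P => i j; rewrite coef2Z /=; case: b => [|b] /=.
  by rewrite andbF mulr0 mul0r.
by rewrite eqSS; case: eqP => _; case: eqP => [->//|_]; rewrite !mulr0.
Qed.

Lemma leibniz_ext (D : fps2 A -> fps2 A) : clin D ->
  (forall a b c d, D (mono a b * mono c d) =
     D (mono a b) * mono c d + mono a b * D (mono c d)) ->
  forall f g, D (f * g) = D f * g + f * D g.
Proof.
move=> cD Dm; apply: (@clin_ext2 _ (fun f g => D (f * g))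
  (fun f g => D f * g + f * D g)) => // [g|f|g|f].
- exact: (clin_comp cD (clin_mulr g)).
- exact: (clin_mull f cD).
- apply: clin_add; last exact: clin_mulr.
  exact: (clin_comp (clin_mulr g) cD).
- apply: clin_add; first exact: (clin_mull _ (clin_id A)).
  by apply: (clin_comp (L := fun g => f * g)) => //; exact: (clin_mull _ (clin_id A)).
Qed.

Lemma dxM f g : dx (f * g) = dx f * g + f * dx g.
Proof.
move: f g; apply: leibniz_ext => [|a b c d]; first exact: clin_dx.
rewrite monoM !dx_mono -scalerAl -scalerAr !monoM natrD scalerDl.
congr (_ + _).
  by case: a => [|a]; rewrite ?scale0r//= addSn.
by case: c => [|c]; rewrite ?scale0r//= addnS.
Qed.
Lemma dyM f g : dy (f * g) = dy f * g + f * dy g.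
Proof.
move: f g; apply: leibniz_ext => [|a b c d]; first exact: clin_dy.
rewrite monoM !dy_mono -scalerAl -scalerAr !monoM natrD scalerDl.
congr (_ + _).
  by case: b => [|b]; rewrite ?scale0r//= addSn.
by case: d => [|d]; rewrite ?scale0r//= addnS.
Qed.
Lemma dx_varx : dx varx = 1.
Proof. by rewrite varxE dx_mono scale1r. Qed.
Lemma dx_vary : dx vary = 0.
Proof. by rewrite varyE dx_mono scale0r. Qed.
Lemma dy_varx : dy varx = 0.
Proof. by rewrite varxE dy_mono scale0r. Qed.
Lemma dy_vary : dy vary = 1.
Proof. by rewrite varyE dy_mono scale1r. Qed.

Definition vfield a b f := a * dx f + b * dy f.

Definition derivation (X : fps2 A -> fps2 A) :=
  clin X /\ forall f g, X (f * g) = X f * g + f * X g.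

Lemma vfield_derivation a b : derivation (vfield a b).
Proof.
split=> [|f g]; last by rewrite /vfield dxM dyM; ring.
by apply: clin_add; apply: (clin_comp (L := fun g => _ * g));
  rewrite ?clin_dx ?clin_dy//; first [exact: clin_dx|exact: clin_dy|exact: (clin_mull _ (clin_id A))].
Qed.

Lemma vfield_varx a b : vfield a b varx = a.
Proof. by rewrite /vfield dx_varx dy_varx mulr1 mulr0 addr0. Qed.
Lemma vfield_vary a b : vfield a b vary = b.
Proof. by rewrite /vfield dx_vary dy_vary mulr1 mulr0 add0r. Qed.

Lemma derivation1 X : derivation X -> X 1 = 0.
Proof.
by move=> [_ XM]; have /eqP := XM 1 1; rewrite !mul1r mulr1 -subr_eq subrr eq_sym => /eqP.
Qed.

Lemma derivationX X : derivation X -> forall f n, X (f ^+ n) = n%:R * f ^+ n.-1 * X f.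
Proof.
move=> dX f; elim=> [|n IH]; first by rewrite expr0 (derivation1 dX) !mul0r.
rewrite exprS dX.2 IH /= -natr1; case: n {IH} => [|n] /=; first by rewrite expr0; ring.
by rewrite exprS; ring.
Qed.

Lemma derivation_comp X sigma : derivation X -> nct sigma -> forall g,
  X (fcomp g sigma) =
  fcomp (dx g) sigma * X sigma.1 + fcomp (dy g) sigma * X sigma.2.
Proof.
move=> dX sn; have [cX XM] := dX; apply: clin_ext => [||a b].
- exact: (clin_comp cX (fcomp_clin sn)).
- apply: clin_add.
    exact: (clin_comp (clin_mulr _) (clin_comp (fcomp_clin sn) clin_dx)).
  exact: (clin_comp (clin_mulr _) (clin_comp (fcomp_clin sn) clin_dy)).
- rewrite fcomp_mono// XM !(derivationX dX) dx_mono dy_mono !fcompZ// !fcomp_mono//.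
  by rewrite !scaler_nat !mulr_natl; ring.
Qed.

Lemma derivation_vfield X : derivation X -> X =1 vfield (X varx) (X vary).
Proof.
move=> dX f; have := derivation_comp dX (nct_id A) f.
by rewrite !fcomp_id /vfield => -> /=; rewrite [dx f * _]mulrC [dy f * _]mulrC.
Qed.

Lemma coef_varxM f i j :
  (varx * f) i j = if (0 < i)%N then f i.-1 j else 0.
Proof. by rewrite varxE coef2_monoM leq0n andbT subn0 subn1. Qed.
Lemma coef_varyM f i j :
  (vary * f) i j = if (0 < j)%N then f i j.-1 else 0.
Proof. by rewrite varyE coef2_monoM leq0n /= subn0 subn1. Qed.

(* A derivation lowers the order by at most one, hence is continuous. *)
Lemma derivation_clin (X : fps2 A -> fps2 A) : linear X ->
  (forall f g, X (f * g) = X f * g + f * X g) -> derivation X.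
Proof.
move=> lX XM; split=> //; split=> //; exists 1%N.
elim=> [//|n IH] f; rewrite addn1 => nf.
pose g : fps2 A := Fps2 (fun i j => if i == 0%N then f 0%N j.+1 else 0).
have -> : f = varx * shx f + vary * g.
  apply: fps2P => i j; rewrite coef2D coef_varxM coef_varyM /=.
  case: i => [|i] /=; last by case: j => [|j] /=; rewrite addr0.
  by case: j => [|j] /=; rewrite add0r// nf.
have ng : ordge (n + 1) g.
  by move=> i j ij /=; case: eqP => // i0; rewrite nf//; lia.
have ns : ordge (n + 1) (shx f) by move=> i j ij /=; rewrite nf//; lia.
rewrite (linearD' lX) !XM; rewrite addn1 in ng ns.
apply: ordgeD; apply: ordgeD; try exact: ordgeMr.
- by rewrite -add1n; apply: ordgeM; [exact: ordge_varx|apply: IH; rewrite addn1].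
- by rewrite -add1n; apply: ordgeM; [exact: ordge_vary|apply: IH; rewrite addn1].
Qed.

End Operators.
Arguments dx {A} f.
Arguments dy {A} f.
Arguments shx {A} f.
Arguments shy {A} f.
Arguments vfield {A} a b f.

(** * Restriction to the fixed curves and division by their equations *)

Section Restriction.
Variable A : comNzRingType.
Implicit Types (f g h u v : fps2 A) (phi sigma tau : fps2 A * fps2 A).

(** One-variable series are encoded as series in [x] alone; substituting [u] into such a [v] is
    written [fcomp v (u, 0)]. *)
Definition xonly f := forall i j, f i j.+1 = 0.

Lemma fcomp_xonly v phi psi : xonly v -> phi.1 = psi.1 -> fcomp v phi = fcomp v psi.
Proof.
move=> xv e; apply: fps2P => i j /=; apply: eq_bigr => k _; apply: eq_bigr => l _.
by case: l => [[|l] /= _]; rewrite ?expr0 ?e// xv !mul0r.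
Qed.

Lemma xonly_id v phi : xonly v -> phi.1 = varx -> fcomp v phi = v.
Proof. by move=> xv e; rewrite -[RHS]fcomp_id; exact: fcomp_xonly. Qed.

(* The curves [y = 0] and [y = x]; every member of the family fixes them
   pointwise. *)
Definition onx : fps2 A * fps2 A := (varx, 0).
Definition ond : fps2 A * fps2 A := (varx, varx).

Lemma nct_onx : nct onx.
Proof. by split; [exact: ordge_varx|exact: ordge_zero]. Qed.
Lemma nct_ond : nct ond.
Proof. by split; exact: ordge_varx. Qed.

Definition diag_antidiag f : fps2 A :=
  Fps2 (fun i j => if j == 0%N then \sum_(a < i.+1) f (i - a)%N a else 0).
Definition res0 f : fps2 A := Fps2 (fun i j => if j == 0%N then f i 0%N else 0).

(* The quotient of [f(x,y) - f(x,x)] by [y - x]. *)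
Definition divyx f : fps2 A :=
  Fps2 (fun i j => \sum_(a < i.+1) f (i - a)%N (j + a).+1).

Lemma divyxE f : f = diag_antidiag f + (vary - varx) * divyx f.
Proof.
apply: fps2P => i j; rewrite mulrBl coef2D coef2D coef2N coef_varyM coef_varxM /=.
case: j => [|j] /=.
  rewrite add0r big_ord_recl subn0 /=; case: i => [|i] /=.
    by rewrite big_ord0 addr0 subr0.
  under [X in _ - X]eq_bigr do rewrite add0n.
  by rewrite addrK.
rewrite add0r big_ord_recl subn0 addn0 /=; case: i => [|i] /=.
  by rewrite big_ord0 addr0 subr0.
under [X in _ + X - _]eq_bigr do rewrite /= addnS subSS.
by rewrite addrK.
Qed.

Lemma shyE f : f = res0 f + vary * shy f.
Proof.
apply: fps2P => i j; rewrite coef2D coef_varyM /=.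
by case: j => [|j] /=; rewrite ?addr0 ?add0r.
Qed.

Lemma xonly_res0 f : xonly (res0 f). Proof. by []. Qed.
Lemma xonly_diag f : xonly (diag_antidiag f). Proof. by []. Qed.

Lemma fcomp_onx f : fcomp f onx = res0 f.
Proof.
have n := nct_onx.
rewrite [f in LHS]shyE fcompD fcompM// fcomp_vary//= mul0r addr0.
exact: xonly_id.
Qed.
Lemma fcomp_ond f : fcomp f ond = diag_antidiag f.
Proof.
have n := nct_ond.
rewrite [f in LHS]divyxE fcompD fcompM// fcompB fcomp_vary// fcomp_varx//= subrr.
by rewrite mul0r addr0; exact: xonly_id.
Qed.

Lemma vary_inj f : vary * f = 0 -> f = 0.
Proof.
move=> f0; apply: fps2P => i j.
by have := congr1 (fun g : fps2 A => g i j.+1) f0; rewrite coef_varyM.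
Qed.
Lemma varx_inj f : varx * f = 0 -> f = 0.
Proof.
move=> f0; apply: fps2P => i j.
by have := congr1 (fun g : fps2 A => g i.+1 j) f0; rewrite coef_varxM.
Qed.
Lemma yx_inj f : (vary - varx) * f = 0 -> f = 0.
Proof.
rewrite mulrBl => /eqP; rewrite subr_eq0 => /eqP e; apply: fps2P => i.
elim: i => [|i IH] j.
  have := congr1 (fun g : fps2 A => g 0%N j.+1) e.
  by rewrite coef_varyM coef_varxM.
have := congr1 (fun g : fps2 A => g i.+1 j.+1) e.
by rewrite coef_varyM coef_varxM /= => ->; rewrite IH.
Qed.

Definition yyx : fps2 A := vary * (vary - varx).

Lemma yyx_inj f : yyx * f = 0 -> f = 0.
Proof. by rewrite /yyx -mulrA => /vary_inj/yx_inj. Qed.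
Lemma yyx_injl f g : yyx * f = yyx * g -> f = g.
Proof.
move=> e; apply/eqP; rewrite -subr_eq0; apply/eqP/yyx_inj.
by rewrite mulrBr e subrr.
Qed.

Definition divyyx f := shy (divyx f).

(** Vanishing on [y = x] gives a factor [y - x]; restricting the quotient [g] to [y = 0] gives
    [- x g(x,0) = 0], hence a further factor [y]. *)
Lemma divyyxE f : fcomp f onx = 0 -> fcomp f ond = 0 -> f = yyx * divyyx f.
Proof.
move=> f0 f1; have fE : f = (vary - varx) * divyx f.
  by rewrite [LHS]divyxE -fcomp_ond f1 add0r.
rewrite /yyx /divyyx [LHS]fE; suff g0 : divyx f = vary * shy (divyx f).
  by rewrite [in LHS]g0 mulrA [_ * vary]mulrC.
rewrite [LHS]shyE -fcomp_onx; suff -> : fcomp (divyx f) onx = 0 by rewrite add0r.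
apply: varx_inj; apply/eqP; rewrite -oppr_eq0 -mulNr; apply/eqP.
rewrite -[RHS]f0 [in RHS]fE fcompM ?fcompB ?fcomp_vary ?fcomp_varx//=; try exact: nct_onx.
by rewrite sub0r.
Qed.

Lemma divyyxK g : divyyx (yyx * g) = g.
Proof.
apply: yyx_injl; rewrite -divyyxE//.
  rewrite /yyx !fcompM ?fcomp_vary//; try exact: nct_onx.
  by rewrite !mul0r.
rewrite /yyx !fcompM ?fcompB ?fcomp_vary ?fcomp_varx//; try exact: nct_ond.
by rewrite /= subrr mulr0 mul0r.
Qed.

Lemma ordge_yyx : ordge 2 yyx.
Proof.
apply: (@ordgeM _ 1 1); first exact: ordge_vary.
by apply: ordgeB; [exact: ordge_vary|exact: ordge_varx].
Qed.

Lemma divyx_ordge n f : ordge n.+1 f -> ordge n (divyx f).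
Proof.
by move=> nf i j ij /=; rewrite big1// => a _; rewrite nf//; have := ltn_ord a; lia.
Qed.
Lemma shy_ordge n f : ordge n.+1 f -> ordge n (shy f).
Proof. by move=> nf i j ij /=; rewrite nf//; lia. Qed.
Lemma divyyx_ordge n f : ordge n.+2 f -> ordge n (divyyx f).
Proof. by move/divyx_ordge/shy_ordge. Qed.

Lemma divyyxB f g : divyyx (f - g) = divyyx f - divyyx g.
Proof.
apply: fps2P => i j; by rewrite coef2D coef2N /= -sumrB; apply: eq_bigr.
Qed.

End Restriction.
Arguments onx {A}.
Arguments ond {A}.
Arguments yyx {A}.
Arguments res0 {A} f.
Arguments divyx {A} f.
Arguments divyyx {A} f.

(** * Adic fixed points and series of operators *)

Section Fix.
Variable A : comNzRingType.
Implicit Types (f g h : fps2 A) (phi psi : fps2 A * fps2 A).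

Definition eqmod n phi psi := ordge n (phi.1 - psi.1) /\ ordge n (phi.2 - psi.2).

Lemma eqmod_trans n phi psi chi :
  eqmod n phi psi -> eqmod n psi chi -> eqmod n phi chi.
Proof. by move=> [a b] [c d]; split; [exact: ordge_trans a c|exact: ordge_trans b d]. Qed.

(** Banach's fixed point theorem for the (x,y)-adic topology. The closed property [P] delimits the
    domain on which [F] contracts and passes to the fixed point; bounds on the degree in a parameter
    are propagated in this way. *)
Lemma fps2_fix (P : fps2 A * fps2 A -> Prop) (F : fps2 A * fps2 A -> fps2 A * fps2 A) :
  P (0, 0) -> (forall phi, P phi -> P (F phi)) ->
  (forall phi, (forall n, exists2 psi, P psi & eqmod n phi psi) -> P phi) ->
  (forall n phi psi, P phi -> P psi -> eqmod n phi psi ->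
     eqmod n.+1 (F phi) (F psi)) ->
  exists2 phi, P phi & F phi = phi.
Proof.
move=> P0 PF Pcl FC; pose u n := iter n F (0, 0).
have Pu n : P (u n) by elim: n => // n; exact: PF.
have uS n : eqmod n (u n) (u n.+1).
  elim: n => [|n IH]; first by split; exact: ordge0.
  exact: FC (Pu n) (Pu n.+1) IH.
have uD n m : eqmod n (u n) (u (n + m)%N).
  elim: m => [|m IH]; first by rewrite addn0; split; rewrite subrr; exact: ordge_zero.
  apply: (eqmod_trans IH); rewrite addnS; case: (uS (n + m)%N) => a b.
  by split; [apply: ordge_le a|apply: ordge_le b]; rewrite leq_addr.
(* The coefficients of degree [d] are stationary from the iterate [d + 1] on. *)
pose L : fps2 A * fps2 A := (Fps2 (fun i j => (u (i + j).+1).1 i j),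
                             Fps2 (fun i j => (u (i + j).+1).2 i j)).
have Lu n : eqmod n L (u n).
  split=> i j ij; rewrite coef2D coef2N /=; apply/eqP; rewrite subr_eq0; apply/eqP.
    have [a _] := uD (i + j).+1 (n - (i + j).+1)%N; rewrite subnKC// in a.
    exact: ordge_eq a _.
  have [_ a] := uD (i + j).+1 (n - (i + j).+1)%N; rewrite subnKC// in a.
  exact: ordge_eq a _.
have PL : P L by apply: Pcl => n; exists (u n).
have sym n phi psi : eqmod n phi psi -> eqmod n psi phi.
  by move=> [a b]; split; exact: ordge_sym.
have LF n : eqmod n (F L) L.
  apply: (@eqmod_trans _ _ (u n.+1)).
    by have [a b] := FC n L (u n) PL (Pu n) (Lu n); split; [apply: ordge_le a|apply: ordge_le b].
  apply: sym; have [a b] := Lu n.+1.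
  by split; [apply: ordge_le a|apply: ordge_le b].
exists L => //; rewrite [LHS]surjective_pairing [RHS]surjective_pairing.
by congr pair; apply: ordge_eqP => n; case: (LF n).
Qed.

Lemma fps2_fix1 (P : fps2 A -> Prop) (F : fps2 A -> fps2 A) :
  P 0 -> (forall f, P f -> P (F f)) ->
  (forall f, (forall n, exists2 g, P g & ordge n (f - g)) -> P f) ->
  (forall n f g, P f -> P g -> ordge n (f - g) -> ordge n.+1 (F f - F g)) ->
  exists2 f, P f & F f = f.
Proof.
move=> P0 PF Pcl FC.
have [||||[f z] /= Pf [e]] := @fps2_fix (fun p => P p.1) (fun p => (F p.1, 0)).
- by [].
- by move=> phi; exact: PF.
- by move=> phi H; apply: Pcl => n; have [psi Ppsi [a _]] := H n; exists psi.1.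
- move=> n phi psi P1 P2 [a _]; split; last by rewrite subrr; exact: ordge_zero.
  exact: FC.
- by exists f.
Qed.

Lemma ordge_closed s f :
  (forall n, exists2 g, ordge s g & ordge n (f - g)) -> ordge s f.
Proof. by move=> H; have [g sg fg] := H s; exact: ordge_congr fg sg. Qed.

(* Only meaningful when [u k] has order at least [k]. *)
Definition fsum (u : nat -> fps2 A) : fps2 A :=
  Fps2 (fun i j => \sum_(k < (i + j).+1) u k i j).

Lemma fsum_partial u : (forall k, ordge k (u k)) -> forall n m, (n <= m)%N ->
  ordge n (fsum u - \sum_(k < m) u k).
Proof.
move=> ou n m nm i j ij; rewrite coef2D coef2N coef2_sum /=.
apply/eqP; rewrite subr_eq0; apply/eqP.
have ijm : ((i + j).+1 <= m)%N by lia.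
rewrite (big_ord_widen m (fun k => u k i j) ijm) [RHS](bigID (fun k : 'I_m => k < (i + j).+1)%N)/=.
by rewrite [X in _ = _ + X]big1 ?addr0// => k; rewrite -leqNgt => H; rewrite ou.
Qed.

Lemma fsum_eq u s : (forall k, ordge k (u k)) ->
  (forall n, ordge n (s - \sum_(k < n) u k)) -> s = fsum u.
Proof.
move=> ou H; apply: ordge_eqP => n; apply: ordge_trans (H n) _.
by apply: ordge_sym; exact: fsum_partial.
Qed.

Lemma eq_fsum u v : u =1 v -> fsum u = fsum v.
Proof. by move=> uv; apply: fps2P => i j /=; apply: eq_bigr => k _; rewrite uv. Qed.

Lemma fsum_ordge u m : (forall k, ordge m (u k)) -> ordge m (fsum u).
Proof. by move=> mu i j ij /=; rewrite big1// => k _; rewrite mu. Qed.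

Lemma fsum_map L u : linear L -> (forall n f, ordge n f -> ordge n (L f)) ->
  (forall k, ordge k (u k)) -> L (fsum u) = fsum (fun k => L (u k)).
Proof.
move=> lL oL ou; apply: fsum_eq => [k|n]; first exact: oL.
have cL : clin L by split=> //; exists 0%N => m f; rewrite addn0; exact: oL.
by rewrite -(clin_sum cL) -(linearB' lL); apply: oL; exact: fsum_partial.
Qed.

Lemma fsum_recl u : (forall k, ordge k (u k)) ->
  fsum u = u 0%N + fsum (fun k => u k.+1).
Proof.
move=> ou; apply: ordge_eqP => n.
apply: (ordge_trans (fsum_partial ou (leqnSn n))); rewrite big_ord_recl.
rewrite [X in X - _]addrC addrKA; apply: ordge_sym; apply: fsum_partial => // k.
by apply: ordge_le (ou k.+1).
Qed.

Section OpSeries.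
Variable X : fps2 A -> fps2 A.
Hypotheses (lX : linear X) (raiseX : forall n f, ordge n f -> ordge n.+1 (X f)).

Definition opser (a : nat -> A) g := fsum (fun k => a k *: iter k X g).

Lemma iter_ordge n k f : ordge n f -> ordge (n + k) (iter k X f).
Proof.
by move=> nf; elim: k => [|k IH]; rewrite ?addn0// addnS; exact: raiseX.
Qed.
Lemma iter_linear k : linear (iter k X).
Proof. by elim: k => // k IH a f g; rewrite /= IH lX. Qed.
Lemma opser_term a g k : ordge k (a k *: iter k X g).
Proof. by apply: ordgeZ; exact: (@iter_ordge 0). Qed.

Lemma opser_ordge a n g : ordge n g -> ordge n (opser a g).
Proof.
move=> ng; apply: fsum_ordge => k; apply: ordgeZ.
by apply: (ordge_le _ (@iter_ordge n k g ng)); rewrite leq_addr.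
Qed.

Lemma opser_linear a : linear (opser a).
Proof.
move=> c f g; apply: fps2P => i j; rewrite coef2D coef2Z /= mulr_sumr -big_split.
by apply: eq_bigr => k _; rewrite iter_linear /= mulrDr mulrCA.
Qed.

Lemma opserS a g : opser a g = a 0%N *: g + opser (fun k => a k.+1) (X g).
Proof.
rewrite /opser fsum_recl; last exact: opser_term.
by congr (_ + _); apply: eq_fsum => k; rewrite iterSr.
Qed.

Lemma opser_comm a g : X (opser a g) = opser a (X g).
Proof.
rewrite /opser fsum_map//.
- by apply: eq_fsum => k; rewrite (linearZ' lX) -iterSr.
- by move=> n f nf; apply: ordge_le (raiseX nf).
- exact: opser_term.
Qed.

End OpSeries.
End Fix.
Arguments opser {A} X a g.

(** * Exponential and logarithm of formal vector fields *)

Section Cauchy.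
Variable A : comNzRingType.
Implicit Types (u v : nat -> fps2 A).

Lemma fsum_mul u v : (forall k, ordge k (u k)) -> (forall k, ordge k (v k)) ->
  fsum u * fsum v = fsum (fun n => \sum_(k < n.+1) u k * v (n - k)%N).
Proof.
move=> ou ov; apply: fsum_eq => [k|N].
  apply: ordge_sum => l _; apply: ordge_le (ordgeM (ou l) (ov (k - l)%N)).
  by rewrite subnKC// -ltnS.
(* Partial sums are values at 1 of polynomials whose coefficients are series, so the Cauchy product
   is a product of polynomials; its coefficients of index at least [N] have order at least [N]. *)
pose p : {poly fps2 A} := \poly_(k < N) u k.
pose q : {poly fps2 A} := \poly_(k < N) v k.
have pE : p.[1] = \sum_(k < N) u k.
  by rewrite horner_poly; apply: eq_bigr => k _; rewrite expr1n mulr1.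
have qE : q.[1] = \sum_(k < N) v k.
  by rewrite horner_poly; apply: eq_bigr => k _; rewrite expr1n mulr1.
have pq : ordge N (fsum u * fsum v - p.[1] * q.[1]).
  have := ordgeBM (fsum_partial ou (leqnn N)) (fsum_partial ov (leqnn N))
    (ordge0 (fsum u)) (ordge0 (\sum_(k < N) v k)).
  by rewrite addn0 add0n minnn pE qE.
apply: (ordge_trans pq); rewrite -hornerM.
have spq : (size (p * q)%R <= N + N)%N.
  apply: leq_trans (size_polyMleq _ _) _.
  apply: leq_trans (leq_pred _) _; apply: leq_add; exact: size_poly.
rewrite (horner_coef_wide _ spq) big_split_ord /= addrC.
have term n : (p * q)`_n = \sum_(k < n.+1)
    (if (k < N)%N && (n - k < N)%N then u k * v (n - k)%N else 0).
  rewrite coefM; apply: eq_bigr => k _; rewrite !coef_poly.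
  by case: ifP => _; case: ifP => _; rewrite ?mul0r ?mulr0.
have -> : \sum_(i < N) (p * q)`_i * 1 ^+ i =
    \sum_(n < N) \sum_(k < n.+1) u k * v (n - k)%N.
  apply: eq_bigr => n _; rewrite expr1n mulr1 term; apply: eq_bigr => k _.
  have kN : (k < N)%N by apply: leq_ltn_trans (ltn_ord n); rewrite -ltnS.
  by rewrite kN (leq_ltn_trans (leq_subr _ _) (ltn_ord n)).
rewrite addrK; apply: ordge_sum => n _; rewrite expr1n mulr1 term.
apply: ordge_sum => k _; case: ifP => _; last exact: ordge_zero.
apply: ordge_le (ordgeM (ou k) (ov _)); rewrite subnKC; first exact: leq_addr.
by rewrite -ltnS.
Qed.

End Cauchy.

Section Exp.
Variable K : numFieldType.
Implicit Types (f g h : fps2 K) (phi psi sigma tau : fps2 K * fps2 K).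
Implicit Types X : fps2 K -> fps2 K.

Definition invfact k : K := (k`!%:R)^-1.

Lemma invfact0 : invfact 0 = 1. Proof. by rewrite /invfact fact0 invr1. Qed.
Lemma invfact1 : invfact 1 = 1. Proof. by rewrite /invfact invr1. Qed.
Lemma invfactS k : k.+1%:R * invfact k.+1 = invfact k.
Proof.
by rewrite /invfact factS natrM invfM mulrA divff ?mul1r.
Qed.

Definition raising X := forall n f, ordge n f -> ordge n.+1 (X f).

Lemma vfield_raising a b : ordge 2 a -> ordge 2 b -> raising (vfield a b).
Proof.
move=> oa ob [|n] f nf; apply: ordgeD.
- by apply: (@ordge_le _ _ 2) => //; exact: ordgeMl.
- by apply: (@ordge_le _ _ 2) => //; exact: ordgeMl.
- by rewrite -[n.+2]add2n; apply: ordgeM => //; exact: dx_ordge.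
- by rewrite -[n.+2]add2n; apply: ordgeM => //; exact: dy_ordge.
Qed.

Section ExpRing.
Variable X : fps2 K -> fps2 K.
Hypotheses (dX : derivation X) (rX : raising X).

Let lX : linear X := proj1 (proj1 dX).
Definition expterm k f := invfact k *: iter k X f.
Local Notation U := expterm.

(** Induction after multiplication by [n + 1], which is split as [k + (n + 1 - k)] on the term of
    index [k]. *)
Lemma exp_leibniz n f g : U n (f * g) = \sum_(k < n.+1) U k f * U (n - k) g.
Proof.
have XU k h : X (U k h) = k.+1%:R *: U k.+1 h.
  by rewrite /expterm (linearZ' lX) scalerA invfactS.
have nz m : m.+1%:R != 0 :> K by rewrite pnatr_eq0.
elim: n => [|n IH].
  by rewrite big_ord1 subn0 /expterm invfact0 !scale1r.
apply: (scalerI (nz n)); rewrite -XU IH (clin_sum dX.1).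
under eq_bigr => k _ do rewrite dX.2 !XU -scalerAl -[X in _ + X]scalerAr.
rewrite big_split /= scaler_sumr.
transitivity (\sum_(k < n.+2) k%:R *: (U k f * U (n.+1 - k) g) +
              \sum_(k < n.+2) (n.+1 - k)%N%:R *: (U k f * U (n.+1 - k) g)).
  congr (_ + _); first by rewrite [RHS]big_ord_recl scale0r add0r.
  rewrite [RHS]big_ord_recr /= subnn scale0r addr0; apply: eq_bigr => k _.
  by rewrite subSn// -ltnS.
rewrite -big_split; apply: eq_bigr => k _ /=; rewrite -scalerDl -natrD.
by rewrite subnKC// -ltnS.
Qed.

Definition expvf f := opser X invfact f.

(** The Leibniz rule and the Cauchy product make the exponential of a derivation multiplicative, so
    it is the substitution of a time-one map. *)
Lemma expvfE f : expvf f = fcomp f (expvf varx, expvf vary).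
Proof.
have oU k h : ordge k (U k h) by exact: opser_term.
have e_ord n h : ordge n h -> ordge n (expvf h) by exact: opser_ordge.
apply: fcomp_unique => //=.
- by split; apply: e_ord; [exact: ordge_varx|exact: ordge_vary].
- split; first exact: opser_linear.
  by exists 0%N => n h; rewrite addn0; exact: e_ord.
- move=> {}f g; rewrite /expvf /opser (fsum_mul (fun k => oU k f) (fun k => oU k g)).
  apply: eq_fsum => n.
  exact: exp_leibniz.
- rewrite /expvf opserS// invfact0 scale1r derivation1//.
  by rewrite (linear0' (opser_linear lX _)) addr0.
Qed.

Definition exprem f := opser X (fun k => invfact k.+2) (X (X f)).

Lemma expvf_rem f : expvf f = f + X f + exprem f.
Proof. by rewrite /expvf 2!(opserS rX) invfact0 invfact1 !scale1r addrA. Qed.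

Lemma exprem_ordge n f : ordge n f -> ordge n.+2 (exprem f).
Proof. by move=> nf; apply: opser_ordge => //; do 2!apply: rX. Qed.

End ExpRing.

(** The coefficients [c] of the logarithm solve [c = phi - id - r(c)], where [r(c)] collects the
    terms of the exponential series that apply the field at least twice. Each application raises the
    order by one, so changing [c] in order [n] changes [r(c)] only in order [n + 1]. *)
Lemma log_exists phi : ordge 2 (phi.1 - varx) -> ordge 2 (phi.2 - vary) ->
  exists a b, [/\ ordge 2 a, ordge 2 b,
    expvf (vfield a b) varx = phi.1 & expvf (vfield a b) vary = phi.2].
Proof.
move=> p1 p2.
pose V (c : fps2 K * fps2 K) := vfield c.1 c.2.
pose F c := (phi.1 - varx - exprem (V c) varx, phi.2 - vary - exprem (V c) vary).
pose P (c : fps2 K * fps2 K) : Prop := ordge 2 c.1 /\ ordge 2 c.2.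
have lin c : linear (V c) by case: (vfield_derivation c.1 c.2) => -[].
have rai c : P c -> raising (V c) by move=> [? ?]; exact: vfield_raising.
have remD n c d g : P c -> P d -> eqmod n c d -> ordge 1 g ->
    ordge n.+1 (exprem (V c) g - exprem (V d) g).
  move=> Pc Pd [cd1 cd2] og.
  have Vcd m h : ordge m.+1 h -> ordge (n + m) (V c h - V d h).
    move=> mh; rewrite /V /vfield opprD addrACA -!mulrBl.
    by apply: ordgeD; apply: ordgeM => //; [exact: dx_ordge|exact: dy_ordge].
  have D j : ordge (n + j) (iter j.+1 (V c) g - iter j.+1 (V d) g).
    elim: j => [|j IH]; first by apply: Vcd.
    rewrite 2!iterS; apply: (@ordge_trans _ _ _ (V d (iter j.+1 (V c) g))).
      apply: Vcd; rewrite -addn1 addnC; exact: iter_ordge (rai _ Pc) _ _ _ og.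
    by rewrite -(linearB' (lin d)) addnS; exact: rai.
  have -> : exprem (V c) g - exprem (V d) g =
      fsum (fun k => invfact k.+2 *: (iter k.+2 (V c) g - iter k.+2 (V d) g)).
    apply: fps2P => i j; rewrite coef2D coef2N /= -sumrB; apply: eq_bigr => k _.
    by rewrite -mulrBr -!iterSr.
  apply: fsum_ordge => k; apply: ordgeZ; apply: ordge_le (D k.+1).
  by rewrite addnS ltnS leq_addr.
have [|c [c1 c2]|c H|n c d Pc Pd cd|[a b] [Pa Pb] [e1 e2]] := @fps2_fix _ P F.
- by split; exact: ordge_zero.
- have Pc : P c by split.
  split; apply: ordgeB => //; apply: (@ordge_le _ _ 3) => //.
    by apply: exprem_ordge; [exact: rai|exact: ordge_varx].
  by apply: exprem_ordge; [exact: rai|exact: ordge_vary].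
- split; apply: ordge_closed => n; have [d [d1 d2] [cd1 cd2]] := H n.
    by exists d.1.
  by exists d.2.
- split; rewrite /F /= opprD addrACA subrr add0r opprK addrC; apply: remD => //.
  + by case: cd => *; split; exact: ordge_sym.
  + exact: ordge_varx.
  + by case: cd => *; split; exact: ordge_sym.
  + exact: ordge_vary.
- have rab := rai (a, b) (conj Pa Pb).
  exists a, b; split => //; rewrite (expvf_rem rab).
    rewrite [V (a, b) varx]vfield_varx /=.
    by move: (exprem _ _) e1 => r <-; ring.
  rewrite [V (a, b) vary]vfield_vary /=.
  by move: (exprem _ _) e2 => r <-; ring.
Qed.

End Exp.

(** * Invariants, fixed curves and cofactors of a time-one map *)

Section Invariance.
Variable K : numFieldType.
Implicit Types (f g h : fps2 K) (phi psi sigma tau rho : fps2 K * fps2 K).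

Definition expser : fps2 K := Fps2 (fun i j => if j == 0%N then invfact K i else 0).

Lemma fcomp_expser f g : ordge 1 f -> ordge 1 g ->
  fcomp expser (f, g) = fsum (fun k => invfact K k *: f ^+ k).
Proof.
move=> of1 og; apply: fsum_eq => [k|n]; first by apply: ordgeZ; exact: ordgeX1.
have fgn : nct (f, g) by [].
apply: ordge_trans (@fcomp_boxsum _ n expser _ fgn) _.
suff -> : boxsum n expser (fun k l => (f, g).1 ^+ k * (f, g).2 ^+ l) =
    \sum_(k < n) invfact K k *: f ^+ k by rewrite subrr; exact: ordge_zero.
apply: eq_bigr => k _; case: n k => [[]//|n] k.
by rewrite big_ord_recl big1 ?addr0 /= ?mulr1// => l _; rewrite scale0r.
Qed.

Section Flow.
Variables (X : fps2 K -> fps2 K) (phi : fps2 K * fps2 K).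
Hypotheses (dX : derivation X) (rX : raising X).
Hypothesis expX : forall g, fcomp g phi = expvf X g.

Let lX : linear X := proj1 (proj1 dX).

(** Factors [X] out of [exp X - 1]. The other factor is the identity up to terms of higher order,
    which lets invariance under [phi] be compared with annihilation by [X]. *)
Lemma flow_exprem g : fcomp g phi - g = X (g + opser X (fun k => invfact K k.+2) (X g)).
Proof.
rewrite expX (expvf_rem rX) (linearD' lX) /exprem (opser_comm lX rX).
by rewrite -[g + _ + _]addrA addrAC subrr add0r.
Qed.

Lemma flow_fixed g : X g = 0 -> fcomp g phi = g.
Proof.
by move=> Xg; rewrite expX /expvf (opserS rX) invfact0 scale1r Xg
  (linear0' (opser_linear lX _)) addr0.
Qed.

Lemma fixed_flow g : fcomp g phi = g -> X g = 0.
Proof.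
move=> fg; apply: ordge_eq0; elim=> [//|n IH].
have := flow_exprem g; rewrite fg subrr (linearD' lX) => /esym/eqP.
rewrite addr_eq0 => /eqP ->; apply: ordgeN; rewrite (opser_comm lX rX).
by apply: (opser_ordge rX); exact: rX.
Qed.

(** When [phi] fixes the curve pointwise, [flow_exprem] equates [X g] along it, up to sign, with [X]
    of a series of larger order; iterating, [X g] vanishes there to every order. *)
Lemma flow_restrict rho : nct rho ->
  (forall g, fcomp (fcomp g phi) rho = fcomp g rho) ->
  forall g, fcomp (X g) rho = 0.
Proof.
move=> rn rphi.
suff H n : forall m g, ordge m g -> ordge (m + n) (fcomp (X g) rho).
  by move=> g; apply: ordge_eq0 => n; exact: (H n 0%N).
elim: n => [|n IH] m g mg.
  by rewrite addn0; apply: fcomp_ordge => //; apply: ordge_le (rX mg).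
have /eqP := congr1 (fcomp^~ rho) (flow_exprem g).
rewrite fcompB rphi subrr (linearD' lX) fcompD eq_sym addr_eq0 => /eqP ->.
apply: ordgeN; rewrite addnS -addSn; apply: IH.
by apply: (opser_ordge rX); exact: rX.
Qed.

(* If [l] divides [X l], then along a curve of fixed points the cofactor of
   the time-one map is the exponential of that of [X]. *)
Lemma flow_cofactor rho l b m : nct rho -> (forall g, fcomp (X g) rho = 0) ->
  (forall f, l * f = 0 -> f = 0) -> ordge 1 b ->
  X l = l * b -> fcomp l phi = l * m ->
  fcomp m rho = fcomp expser (fcomp b rho, 0).
Proof.
move=> rn rX0 linj ob Xl lm.
(* [B k] is the quotient of [X^k l] by [l]. As [X] vanishes along [rho], it restricts there to the
   power [b^k], and the exponential series of [b] appears. *)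
pose fix B k := if k is k'.+1 then B k' * b + X (B k') else 1.
have oB k : ordge k (B k).
  elim: k => [//|k IH] /=; apply: ordgeD; last exact: rX.
  by rewrite -addn1; exact: ordgeM.
have XB k : iter k X l = l * B k.
  elim: k => [|k IH]; first by rewrite mulr1.
  by rewrite /= IH dX.2 Xl -mulrA -mulrDr [b * _]mulrC.
have rB k : fcomp (B k) rho = fcomp b rho ^+ k.
  elim: k => [|k IH]; first by rewrite fcomp1.
  by rewrite /= fcompD fcompM// rX0 addr0 IH exprSr.
have oiB k : ordge k (invfact K k *: B k) by exact: ordgeZ.
have mE : m = fsum (fun k => invfact K k *: B k).
  apply/eqP; rewrite -subr_eq0; apply/eqP/linj; rewrite mulrBr -lm expX.
  rewrite (_ : l * fsum _ = fsum (fun k => l * (invfact K k *: B k))).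
    rewrite /expvf /opser (eq_fsum (v := fun k => l * (invfact K k *: B k))) ?subrr//.
    by move=> k; rewrite XB scalerAr.
  apply: (@fsum_map _ (fun f => l * f)) => //; last by move=> *; exact: ordgeMr.
  by move=> a f g; rewrite mulrDr scalerAr.
rewrite fcomp_expser; [|exact: fcomp_ordge|exact: ordge_zero].
rewrite mE (@fsum_map _ (fcomp^~ rho))//; first last.
- by move=> *; exact: fcomp_ordge.
- exact: fcomp_linear.
by apply: eq_fsum => k; rewrite fcompZ rB.
Qed.

End Flow.
End Invariance.
Arguments expser {K}.

(** * Logarithms of maps tangent to the identity *)

Section Logarithm.
Variable K : numFieldType.
Implicit Types (f g h : fps2 K) (phi psi sigma tau : fps2 K * fps2 K).
Implicit Types X : fps2 K -> fps2 K.

Lemma fps2_compE g phi : fps2_comp g phi = fcomp g phi. Proof. by []. Qed.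

Lemma nctP phi : no_constant_term phi <-> nct phi.
Proof. by split=> [[a b]|[a b]]; split; apply/ordge1P. Qed.

Definition tangent_id phi := ordge 2 (phi.1 - varx) /\ ordge 2 (phi.2 - vary).

Lemma tangent_id_nct phi : tangent_id phi -> nct phi.
Proof.
move=> [a b]; split.
  by rewrite -(subrK varx phi.1); apply: ordgeD (ordge_varx); exact: ordge_le a.
by rewrite -(subrK vary phi.2); apply: ordgeD (ordge_vary); exact: ordge_le b.
Qed.

Lemma vf_linear_part (a b : fps2 K) : ordge 2 a -> ordge 2 b -> linear_part (a, b) = 0.
Proof.
move=> oa ob; apply/matrixP => r c; rewrite !mxE /=.
have H d : ordge 2 d -> d (c == 0 : nat) (c == 1 : nat) = 0.
  by move=> od; apply: od; case: c => [[|[|]]].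
by case: ifP => _; exact: H.
Qed.

Lemma exp_is_log phi X : derivation X -> raising X ->
  ordge 2 (X varx) -> ordge 2 (X vary) ->
  (forall g, fcomp g phi = expvf X g) -> is_log phi X.
Proof.
move=> dX rX ox oy eX; split.
  split; first by split; [exact: dX.1.1|exact: dX.2].
    by apply/nctP; split; [apply: ordge_le ox|apply: ordge_le oy].
  by exists 1%N; rewrite expr1 vf_linear_part.
move=> g N; exists N => J NJ i j ij; rewrite fps2_compE eX; apply/esym.
by apply: ordge_eq ij; apply: fsum_partial => // k; exact: opser_term.
Qed.

Lemma flog_is_log phi : tangent_id phi -> is_log phi (flog phi).
Proof.
move=> [t1 t2]; have tn := tangent_id_nct (conj t1 t2).
have [a [b [oa ob e1 e2]]] := log_exists t1 t2.
have dX := vfield_derivation a b; have rX := vfield_raising oa ob.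
apply: xgetPex; exists (vfield a b); apply: exp_is_log => //.
- by rewrite vfield_varx.
- by rewrite vfield_vary.
- by move=> g; rewrite (expvfE dX rX) e1 e2 -surjective_pairing.
Qed.

Lemma nilpotent_exp1 n (N : 'M[K]_2) J0 : N ^+ n = 0 ->
  (forall J, (J0 <= J)%N -> \sum_(k < J) invfact K k *: N ^+ k = 1) -> N = 0.
Proof.
move=> Nn H; have ex : exists n, N ^+ n == 0 by exists n; rewrite Nn.
case: (ex_minnP ex) => p /eqP Np pmin; case: p Np pmin => [|[|p]] Np pmin.
- by move/eqP: Np; rewrite expr0 oner_eq0.
- by rewrite -Np expr1.
have N0 k : (p.+2 <= k)%N -> N ^+ k = 0.
  by move=> pk; rewrite -(subnK pk) exprD Np mulr0.
(* Here [p + 2] is the nilpotency index: multiplied by [N^p], the exponential keeps only its terms 0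
   and 1, and the equation leaves [N^(p+1) = 0]. *)
have := congr1 (fun M => M * N ^+ p) (H (J0 + 2)%N (leq_addr _ _)).
rewrite mulr_suml mul1r addn2 2!big_ord_recl big1 => [|k _]; last first.
  by rewrite -scalerAl -exprD N0 ?scaler0//= /bump /=; lia.
rewrite addr0 lift0 /= invfact0 invfact1 !scale1r expr0 mul1r expr1 -exprS.
move/eqP; rewrite -subr_eq0 addrAC subrr add0r => /pmin.
by rewrite ltnn.
Qed.

(** [is_log] only provides a nilpotent linear part [N]. On linear terms the exponential of [X] acts
    as that of [N], and [phi] acts as the identity, so [N] vanishes and the coefficients of [X]
    start in degree 2. *)
Lemma log_raising phi X : tangent_id phi -> is_log phi X ->
  [/\ derivation X, raising X & forall g, fcomp g phi = expvf X g].
Proof.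
move=> tphi [[[lX XM] /nctP [oa ob] [n Nn]] serX].
have dX := derivation_clin lX XM.
set a := X varx in oa Nn; set b := X vary in ob Nn.
set N := linear_part (a, b) in Nn.
have vX := derivation_vfield dX.
pose v (r : 'I_2) : fps2 K := if r == 0 then varx else vary.
pose co f (c : 'I_2) := f (c == 0 : nat) (c == 1 : nat).
have sum2 (F : 'I_2 -> K) : \sum_(s < 2) F s = F 0 + F 1.
  by rewrite !big_ord_recl big_ord0 addr0; congr (_ + F _); exact: val_inj.
have c2 (c : 'I_2) : c = 0 \/ c = 1.
  by case: c => [[|[|]]]// h; [left|right]; exact: val_inj.
have coX f c : ordge 1 f -> co (X f) c = \sum_s co f s * N s c.
  move=> of1; rewrite sum2 !mxE /= vX /vfield -/a -/b.
  have of0 : f 0%N 0%N = 0 by exact: of1.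
  have lin d e : ordge 1 d -> (d * e) (c == 0 : nat) (c == 1 : nat) =
     d (c == 0 : nat) (c == 1 : nat) * e 0%N 0%N.
    move=> od; case: (c2 c) => ->; rewrite coef2M /= !big_ord_recl !big_ord0 /=;
    by rewrite !addr0 (od 0%N 0%N)// mul0r add0r.
  rewrite /co coef2D !lin//= !mul1r /=; congr (_ + _); rewrite mulrC//.
have oX f : ordge 1 f -> ordge 1 (X f).
  move=> of1; rewrite vX; apply: ordgeD; exact: ordgeMl.
have ov r : ordge 1 (v r).
  by rewrite /v; case: ifP => _; [exact: ordge_varx|exact: ordge_vary].
have oiX k r : ordge 1 (iter k X (v r)) by elim: k => //= k; exact: oX.
have coiX k r c : co (iter k X (v r)) c = (N ^+ k) r c.
  elim: k c => [|k IH] c.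
    by rewrite expr0 mxE /co /v; case: (c2 c) => ->; case: (c2 r) => ->.
  rewrite /= coX// exprSr mxE; apply: eq_bigr => s _; by rewrite IH.
have N0 : N = 0.
  have [J0 HJ0] := serX varx 2%N; have [J1 HJ1] := serX vary 2%N.
  apply: (nilpotent_exp1 Nn (J0 := maxn J0 J1)) => J; rewrite geq_max => /andP[H0 H1].
  apply/matrixP => r c.
  have cc : ((c == 0%R) + (c == 1%R) < 2)%N by case: (c2 c) => ->.
  have : co (\sum_(k < J) invfact K k *: iter k X (v r)) c = co (fcomp (v r) phi) c.
    by case: (c2 r) => -> /=; [apply: HJ0|apply: HJ1].
  rewrite /co coef2_sum summxE => e.
  transitivity (co (fcomp (v r) phi) c).
    rewrite /co -e; apply: eq_bigr => k _; rewrite mxE coef2Z.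
    by congr (_ * _); rewrite -coiX.
  have tn := tangent_id_nct tphi; case: tphi => t1 t2.
  have -> : fcomp (v r) phi = if r == 0 then phi.1 else phi.2.
    by rewrite /v; case: ifP => _; rewrite ?fcomp_varx ?fcomp_vary.
  rewrite mxE /co; case: (c2 r) => -> /=.
    by rewrite (ordge_eq t1)//; case: (c2 c) => ->.
  by rewrite (ordge_eq t2)//; case: (c2 c) => ->.
have oa2 : ordge 2 a.
  apply/ordge2P; split; first exact: oa.
    by have /matrixP/(_ 0 0) := N0; rewrite !mxE.
  by have /matrixP/(_ 0 1) := N0; rewrite !mxE.
have ob2 : ordge 2 b.
  apply/ordge2P; split; first exact: ob.
    by have /matrixP/(_ 1 0) := N0; rewrite !mxE.
  by have /matrixP/(_ 1 1) := N0; rewrite !mxE.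
have rX : raising X by move=> m f mf; rewrite vX; exact: vfield_raising.
split=> // g; apply: fsum_eq => [k|m]; first exact: opser_term.
have [J HJ] := serX g m.
apply: (@ordge_trans _ _ _ (\sum_(k < J + m) invfact K k *: iter k X g)).
  move=> i j ij; rewrite coef2D coef2N.
  by rewrite -[fcomp g phi]fps2_compE -(HJ (J + m)%N _ i j ij) ?leq_addr// subrr.
rewrite addnC big_split_ord /= addrAC subrr add0r; apply: ordge_sum => k _.
by apply: (@ordge_le _ _ (m + k)); [exact: leq_addr|exact: opser_term].
Qed.

End Logarithm.

(** * The family and its first integrals *)

Section Gain.
Variable A : comNzRingType.
Implicit Types (f g h : fps2 A).

Lemma clin_gain (L : fps2 A -> fps2 A) d : clin L ->
  (forall a b, ordge (a + b + d) (L (mono a b))) ->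
  forall n h, ordge n h -> ordge (n + d) (L h).
Proof.
move=> cL Lm n h nh; have [lL [s sL]] := cL.
set N := (n + d + s)%N.
have hB : ordge (n + d) (L h - L (boxsum N h mono)).
  by rewrite -(linearB' lL); apply: sL; exact: boxsum_mono.
apply: (ordge_congr hB); rewrite (clin_boxsum cL).
apply: ordge_sum => k _; apply: ordge_sum => l _.
have [kl|kl] := ltnP (k + l) n; first by rewrite nh// scale0r; exact: ordge_zero.
by apply: ordgeZ; apply: ordge_le (Lm k l); rewrite leq_add2r.
Qed.

End Gain.

Section Family.
Variable A : comNzRingType.
Implicit Types (f g h : fps2 A).

Definition family (D w : fps2 A) := (varx + yyx * D, vary + yyx * w).

Lemma fcomp_yyx_onx : fcomp yyx onx = 0 :> fps2 A.
Proof. by rewrite /yyx fcompM ?fcomp_vary ?mul0r//; exact: nct_onx. Qed.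
Lemma fcomp_yyx_ond : fcomp yyx ond = 0 :> fps2 A.
Proof.
have n := nct_ond A.
by rewrite /yyx fcompM// fcompB fcomp_vary// fcomp_varx//= subrr mulr0.
Qed.

Section Fixed.
Variables D w : fps2 A.
Let phi := family D w.

Lemma family_tangent1 : ordge 2 (phi.1 - varx).
Proof. by rewrite /= addrAC subrr add0r; apply: ordgeMl; exact: ordge_yyx. Qed.
Lemma family_tangent2 : ordge 2 (phi.2 - vary).
Proof. by rewrite /= addrAC subrr add0r; apply: ordgeMl; exact: ordge_yyx. Qed.

Lemma family_nct : nct phi.
Proof.
split; apply: ordgeD; rewrite ?ordge_varx ?ordge_vary//;
  try exact: ordge_varx; try exact: ordge_vary;
  apply: ordgeMl; apply: ordge_le (ordge_yyx A); exact: isT.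
Qed.

Lemma family_onx g : fcomp (fcomp g phi) onx = fcomp g onx.
Proof.
have n := nct_onx A; rewrite fcompA//; last exact: family_nct.
congr (fcomp g _); rewrite /pcomp /= !fcompD (fcompM n yyx D) (fcompM n yyx w) fcomp_yyx_onx !mul0r !addr0.
by rewrite fcomp_varx// fcomp_vary.
Qed.
Lemma family_ond g : fcomp (fcomp g phi) ond = fcomp g ond.
Proof.
have n := nct_ond A; rewrite fcompA//; last exact: family_nct.
congr (fcomp g _); rewrite /pcomp /= !fcompD (fcompM n yyx D) (fcompM n yyx w) fcomp_yyx_ond !mul0r !addr0.
by rewrite fcomp_varx// fcomp_vary.
Qed.

Definition variation g := fcomp g phi - g.

Lemma variationE g : variation g = yyx * divyyx (variation g).
Proof.
by apply: divyyxE; rewrite /variation fcompB ?family_onx ?family_ond subrr.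
Qed.

Lemma variation_clin : clin variation.
Proof.
have := clin_add (fcomp_clin family_nct) (clin_comp (L := fun f => f * -1) (clin_mulr _) (clin_id A)).
by rewrite (_ : (fun _ => _ + _) = variation)//; apply/funext => f; rewrite mulrN1.
Qed.

Lemma variationM f g : variation (f * g) =
  variation f * g + f * variation g + variation f * variation g.
Proof. by rewrite /variation fcompM; [ring|exact: family_nct]. Qed.
Lemma variation1 : variation 1 = 0.
Proof. by rewrite /variation fcomp1 ?subrr//; exact: family_nct. Qed.
Lemma variation_varx : variation varx = yyx * D.
Proof. by rewrite /variation (fcomp_varx family_nct) /= [X in X - _]addrC addrK. Qed.
Lemma variation_vary : variation vary = yyx * w.
Proof. by rewrite /variation (fcomp_vary family_nct) /= [X in X - _]addrC addrK. Qed.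

Definition variation2 g := variation g - (w 0%N 0%N *: yyx) * dy g.

Lemma variation2_clin : clin variation2.
Proof.
have c : clin (fun g => (w 0%N 0%N *: yyx) * dy g * -1).
  apply: (clin_comp (clin_mulr (-1))).
  apply: (clin_comp (L := fun g => (w 0%N 0%N *: yyx) * g)); last exact: clin_dy.
  exact: (clin_mull _ (clin_id A)).
have -> : variation2 = fun g => variation g + (w 0%N 0%N *: yyx) * dy g * -1.
  by apply/funext => g; rewrite mulrN1.
exact: clin_add variation_clin c.
Qed.

Hypothesis D00 : D 0%N 0%N = 0.

(* To leading order [variation] is [w(0,0) y (y - x) d/dy]. *)
Lemma variation2_ordge n h : ordge n h -> ordge (n + 2) (variation2 h).
Proof.
apply: clin_gain => [|a b]; first exact: variation2_clin.
(* These bounds are stable under products because [variation2] obeys the Leibniz rule up to a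
   product of two variations, whose order is high enough. It remains to treat [x] and [y]. *)
pose Q m f := [/\ ordge m f, ordge m.+1 (variation f) & ordge m.+2 (variation2 f)].
have QM m p f g : Q m f -> Q p g -> Q (m + p)%N (f * g).
  move=> [f0 f1 f2] [g0 g1 g2]; split; first exact: ordgeM.
    rewrite variationM -addSn; apply: ordgeD.
      apply: ordgeD; first by apply: ordgeM.
      by rewrite addSnnS; exact: ordgeM.
    by apply: ordge_le (ordgeM f1 g1); lia.
  have -> : variation2 (f * g) =
      variation2 f * g + f * variation2 g + variation f * variation g.
    by rewrite /variation2 variationM dyM; ring.
  apply: ordgeD.
    apply: ordgeD; first by rewrite -2!addSn; exact: ordgeM.
    by rewrite -2!addnS; exact: ordgeM.
  by apply: ordge_le (ordgeM f1 g1); lia.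
have Q1 : Q 0%N 1.
  rewrite /Q /variation2 variation1 -mono00 dy_mono scale0r mulr0 subr0.
  by split=> //; exact: ordge_zero.
have Qx : Q 1%N varx.
  rewrite /Q /variation2 variation_varx dy_varx mulr0 subr0.
  split; [exact: ordge_varx|by apply: ordgeMl; exact: ordge_yyx|].
  by rewrite -[3%N]/(2 + 1)%N; apply: ordgeM; [exact: ordge_yyx|exact/ordge1P].
have Qy : Q 1%N vary.
  rewrite /Q /variation2 variation_vary dy_vary mulr1.
  split; [exact: ordge_vary|by apply: ordgeMl; exact: ordge_yyx|].
  have -> : yyx * w - w 0%N 0%N *: yyx = yyx * (w - w 0%N 0%N *: 1).
    by rewrite mulrBr -scalerAr mulr1.
  rewrite -[3%N]/(2 + 1)%N; apply: ordgeM; [exact: ordge_yyx|apply/ordge1P].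
  by rewrite coef2D coef2N coef2Z mulr1 subrr.
have QX m f k : Q m f -> Q (m * k)%N (f ^+ k).
  by move=> Qf; elim: k => [|k IH]; rewrite ?muln0// exprS mulnS; exact: QM.
have [_ _] := QM _ _ _ _ (QX _ _ a Qx) (QX _ _ b Qy).
by rewrite -monoE !mul1n addn2.
Qed.

End Fixed.
End Family.

(** * Existence and uniqueness of normalised invariants *)

Section Integral.
Variable A : comUnitRingType.
Implicit Types (f g h : fps2 A).

Definition integ f : fps2 A :=
  Fps2 (fun i j => if j is j'.+1 then j%:R^-1 * f i j' else 0).

Hypothesis nat_unit : forall n, (n.+1%:R : A) \is a GRing.unit.

Lemma dy_integ f : dy (integ f) = f.
Proof. by apply: fps2P => i j /=; rewrite mulrA divrr ?mul1r. Qed.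
Lemma integ_dy f : integ (dy f) = f - res0 f.
Proof.
apply: fps2P => i [|j]; rewrite coef2D coef2N /= ?subrr//.
by rewrite mulrA mulVr ?mul1r ?subr0.
Qed.
Lemma integ_ordge n f : ordge n f -> ordge n.+1 (integ f).
Proof. by move=> nf i [//|j] ij /=; rewrite nf ?mulr0//; lia. Qed.
Lemma integB f g : integ (f - g) = integ f - integ g.
Proof.
by apply: fps2P => i [|j]; rewrite coef2D coef2N /= ?subr0// -mulrBr.
Qed.
Lemma res0_integ f : res0 (integ f) = 0.
Proof. by apply: fps2P => i j /=; case: ifP. Qed.

Lemma integ0 : integ 0 = 0.
Proof. by apply: fps2P => i [|j] //=; rewrite mulr0. Qed.
Lemma divyyxZ a f : divyyx (a *: f) = a *: divyyx f.
Proof. by apply: fps2P => i j; rewrite coef2Z /= mulr_sumr. Qed.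
Lemma divyyx0 : divyyx 0 = 0 :> fps2 A.
Proof. by rewrite -(scale0r (0 : fps2 A)) divyyxZ !scale0r. Qed.

Section Invariant.
Variables D w : fps2 A.
Hypotheses (D00 : D 0%N 0%N = 0) (w00 : w 0%N 0%N \is a GRing.unit).

(** Dividing [variation g = 0] by [w(0,0) y (y - x)] and integrating in [y] turns invariance into
    [g = g(x,0) - step g]. The gain of 2 in [variation2] pays for the division, and the integration
    leaves a net gain of one order. *)
Let step g := integ ((w 0%N 0%N)^-1 *: divyyx (variation2 D w g)).

Lemma step_ordge n f g : ordge n (f - g) -> ordge n.+1 (step f - step g).
Proof.
move=> fg; have [lV _] := variation2_clin D w.
rewrite /step -integB; apply: integ_ordge; rewrite -scalerBr; apply: ordgeZ.
rewrite -divyyxB -(linearB' lV); apply: divyyx_ordge.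
by rewrite -addn2; exact: variation2_ordge.
Qed.

Lemma stepE g : step g = integ ((w 0%N 0%N)^-1 *: divyyx (variation D w g)) - (g - res0 g).
Proof.
rewrite /step /variation2 divyyxB -scalerAl divyyxZ divyyxK scalerBr integB scalerA.
by rewrite mulVr// scale1r integ_dy.
Qed.

(** The invariant is the fixed point of [f -> x - step f]. The property [P] will later bound degrees
    in [z]. *)
Lemma invariant_exists (P : fps2 A -> Prop) : P 0 ->
  (forall f, (forall n, exists2 g, P g & ordge n (f - g)) -> P f) ->
  (forall f, P f -> P (varx - integ ((w 0%N 0%N)^-1 *: divyyx (variation2 D w f)))) ->
  exists2 f, P f & fcomp f (family D w) = f /\ fcomp f onx = varx.
Proof.
move=> P0 Pcl Pstep.
have [||f Pf fE] := @fps2_fix1 _ P (fun f => varx - step f) P0 _ Pcl.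
- exact: Pstep.
- move=> n f g _ _ fg; rewrite opprD addrACA subrr add0r opprK addrC.
  by apply: step_ordge; exact: ordge_sym.
exists f => //.
have rf : res0 f = varx.
  rewrite -fE -!fcomp_onx fcompB fcomp_varx//; last exact: nct_onx.
  by rewrite fcomp_onx /step res0_integ subr0.
split; last by rewrite fcomp_onx.
have := fE; rewrite stepE rf => e.
have i0 : integ ((w 0%N 0%N)^-1 *: divyyx (variation D w f)) = 0.
  move: (integ _) e => I e; have -> : I = f - (varx - (I - (f - varx))) by ring.
  by rewrite e subrr.
have := congr1 dy i0; rewrite dy_integ (linear0' (clin_dy A).1) => d0.
have dv : divyyx (variation D w f) = 0.
  by rewrite -[LHS]scale1r -(divrr w00) -scalerA d0 scaler0.
by apply/eqP; rewrite -subr_eq0 -/(variation D w f) variationE dv mulr0.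
Qed.

Lemma invariant_unique g : fcomp g (family D w) = g -> fcomp g onx = 0 -> g = 0.
Proof.
move=> gphi g0; have gE : g = - step g.
  by rewrite stepE /variation gphi subrr -fcomp_onx g0 subr0 divyyx0 scaler0
    integ0 sub0r opprK.
have s0 : step 0 = 0.
  have [lV _] := variation2_clin D w.
  by rewrite /step (linear0' lV) divyyx0 scaler0 integ0.
apply: ordge_eq0; elim=> [//|n IH]; rewrite gE; apply: ordgeN.
by rewrite -[step g]subr0 -s0; apply: step_ordge; rewrite subr0.
Qed.

End Invariant.
End Integral.
Arguments integ {A} f.

(** * Polynomial dependence of the invariant on the parameter *)

Section Map.
Variables (A B : comNzRingType) (r : {rmorphism A -> B}).
Implicit Types (f g : fps2 A) (phi : fps2 A * fps2 A).

Definition map2 f : fps2 B := Fps2 (fun i j => r (f i j)).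

Lemma map2D f g : map2 (f + g) = map2 f + map2 g.
Proof. by apply: fps2P => i j; rewrite coef2D /= rmorphD. Qed.
Lemma map2B f g : map2 (f - g) = map2 f - map2 g.
Proof. by apply: fps2P => i j; rewrite coef2D coef2N /= rmorphB. Qed.
Lemma map2M f g : map2 (f * g) = map2 f * map2 g.
Proof.
apply: fps2P => i j; rewrite coef2M /= rmorph_sum; apply: eq_bigr => k _.
by rewrite rmorph_sum; apply: eq_bigr => l _; rewrite rmorphM.
Qed.
Lemma map2_mono a b : map2 (mono a b) = mono a b.
Proof. by apply: fps2P => i j; rewrite /= rmorph_nat. Qed.
Lemma map2_varx : map2 varx = varx. Proof. exact: map2_mono. Qed.
Lemma map2_vary : map2 vary = vary. Proof. exact: map2_mono. Qed.
Lemma map2_0 : map2 0 = 0.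
Proof. by apply: fps2P => i j; rewrite /= rmorph0. Qed.
Lemma map2X f n : map2 (f ^+ n) = map2 f ^+ n.
Proof.
elim: n => [|n IH]; first by rewrite !expr0 -!mono00 map2_mono.
by rewrite !exprS map2M IH.
Qed.
Lemma map2_fcomp g phi : map2 (fcomp g phi) = fcomp (map2 g) (map2 phi.1, map2 phi.2).
Proof.
apply: fps2P => i j /=; rewrite rmorph_sum; apply: eq_bigr => k _.
rewrite rmorph_sum; apply: eq_bigr => l _.
rewrite rmorphM; congr (_ * _).
have := congr1 (fun h : fps2 B => h i j) (map2M (phi.1 ^+ k) (phi.2 ^+ l)).
by rewrite !map2X.
Qed.
Lemma map2_yyx : map2 yyx = yyx.
Proof. by rewrite /yyx map2M map2B map2_varx map2_vary. Qed.
Lemma map2_family D w g :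
  map2 (fcomp g (family D w)) = fcomp (map2 g) (family (map2 D) (map2 w)).
Proof. by rewrite map2_fcomp /= !map2D (map2M yyx D) (map2M yyx w) map2_yyx map2_varx map2_vary. Qed.
Lemma map2_onx g : map2 (fcomp g onx) = fcomp (map2 g) onx.
Proof. by rewrite map2_fcomp /= map2_varx map2_0. Qed.

End Map.

Section Tame.
Variable K : numFieldType.
Implicit Types (f g h : fps2 {poly K}).

(* The coefficients of degree [n] are polynomials of degree at most [n - d]
   in the parameter; by truncation those with [n < d] vanish. *)
Definition tame d f := forall i j, (size (f i j) <= (i + j).+1 - d)%N.
Arguments tame d%_N f.

Lemma size_sum_le (I : Type) (r : seq I) (P : pred I) (F : I -> {poly K}) n :
  (forall i, P i -> size (F i) <= n)%N -> (size (\sum_(i <- r | P i) F i)%R <= n)%N.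
Proof.
move=> H; apply: (big_ind (fun p : {poly K} => size p <= n)%N) => //.
  by rewrite size_poly0.
by move=> p q pn qn; apply: leq_trans (size_polyD _ _) _; rewrite geq_max pn.
Qed.

Lemma size_mul_tame (p q : {poly K}) m n a d e :
  (size p <= m.+1 - d)%N -> (size q <= n.+1 - e)%N -> (m + n <= a)%N ->
  (size (p * q)%R <= a.+1 - (d + e))%N.
Proof.
move=> pm qn mna; have [->|p0] := eqVneq p 0; first by rewrite mul0r size_poly0.
have [->|q0] := eqVneq q 0; first by rewrite mulr0 size_poly0.
apply: leq_trans (size_polyMleq _ _) _.
move: p0 q0; rewrite -!size_poly_gt0; lia.
Qed.

Lemma tame0 d : tame d 0.
Proof. by move=> i j; rewrite size_poly0. Qed.
Lemma tame_le d e f : (d <= e)%N -> tame e f -> tame d f.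
Proof. by move=> de te i j; apply: leq_trans (te i j) _; rewrite leq_sub2l. Qed.
Lemma tameD d f g : tame d f -> tame d g -> tame d (f + g).
Proof.
move=> tf tg i j; apply: leq_trans (size_polyD _ _) _.
by rewrite geq_max tf tg.
Qed.
Lemma tameN d f : tame d f -> tame d (- f).
Proof. by move=> tf i j; rewrite coef2N size_polyN. Qed.
Lemma tameB d f g : tame d f -> tame d g -> tame d (f - g).
Proof. by move=> tf tg; apply: tameD => //; exact: tameN. Qed.
Lemma tameM d e f g : tame d f -> tame e g -> tame (d + e) (f * g).
Proof.
move=> tf tg i j; rewrite coef2M; apply: size_sum_le => k _.
apply: size_sum_le => l _; apply: size_mul_tame (tf k l) (tg _ _) _.
have := ltn_ord k; have := ltn_ord l; lia.
Qed.
Lemma tameZ d (c : K) f : tame d f -> tame d (c%:P *: f).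
Proof.
move=> tf i j; rewrite coef2Z mul_polyC.
exact: leq_trans (size_scale_leq _ _) (tf i j).
Qed.
Lemma tame_mono a b : tame (a + b) (mono a b).
Proof.
move=> i j /=; case: eqP => [->|]; case: eqP => [->|] /=; rewrite ?size_poly0//.
by rewrite size_poly1 subSn.
Qed.
Lemma tame_closed d f :
  (forall n, exists2 g, tame d g & ordge n (f - g)) -> tame d f.
Proof.
by move=> H i j; have [g tg fg] := H (i + j).+1; rewrite (ordge_eq fg).
Qed.
Lemma tame_lift (f : fps2 K) : tame 0 (map2 polyC f).
Proof. by move=> i j /=; apply: leq_trans (size_polyC_leq1 _) _; rewrite subn0. Qed.
Lemma tame_yyx : tame 2 yyx.
Proof.
have tx : tame 1 varx by exact: (@tame_mono 1%N 0%N).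
have ty : tame 1 vary by exact: (@tame_mono 0%N 1%N).
by apply: (@tameM 1%N 1%N) => //; exact: tameB.
Qed.
Lemma tame_dy d f : tame d.+1 f -> tame d (dy f).
Proof.
move=> tf i j /=; rewrite -polyC_natr mul_polyC.
apply: leq_trans (size_scale_leq _ _) _; apply: leq_trans (tf _ _) _.
by rewrite addnS subSS.
Qed.
Lemma tame_divyyx f : tame 2 f -> tame 0 (divyyx f).
Proof.
move=> tf i j /=; apply: size_sum_le => k _.
by apply: leq_trans (tf _ _) _; have := ltn_ord k; lia.
Qed.
Lemma tame_integ d f : tame d f -> tame d.+1 (integ f).
Proof.
move=> tf i [|j] /=; first by rewrite size_poly0.
rewrite -polyC_natr polyCV mul_polyC.
by apply: leq_trans (size_scale_leq _ _) _; rewrite addnS subSS; exact: tf.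
Qed.

Variables D w : fps2 K.
Hypothesis D00 : D 0%N 0%N = 0.

Let D' : fps2 {poly K} := 'X *: map2 polyC D.
Let w' : fps2 {poly K} := map2 polyC w.

(** By [D00] the series [z Delta] is tame of index 0. Substituting the family into [x^k y^l]
    therefore changes it by a tame series of index [k + l + 1], and this extra unit survives
    multiplication by the coefficients of [f]. *)
Lemma tame_variation d f : tame d f -> tame d.+1 (variation D' w' f).
Proof.
move=> tf; pose phi := family D' w'.
pose Q m (f g : fps2 {poly K}) := [/\ tame m f, tame m g & tame m.+1 (f - g)].
have QM m p f1 g1 f2 g2 : Q m f1 g1 -> Q p f2 g2 -> Q (m + p)%N (f1 * f2) (g1 * g2).
  move=> [a b c] [k l n]; split; [exact: tameM|exact: tameM|].
  have -> : f1 * f2 - g1 * g2 = f1 * (f2 - g2) + (f1 - g1) * g2 by ring.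
  by apply: tameD; [rewrite -addnS|rewrite -addSn]; exact: tameM.
have QX f1 g1 n : Q 1%N f1 g1 -> Q n (f1 ^+ n) (g1 ^+ n).
  move=> Q1; elim: n => [|n IH]; last by rewrite !exprS -add1n; exact: QM.
  by rewrite !expr0; split; rewrite ?subrr; [exact: (@tame_mono 0 0)|exact: (@tame_mono 0 0)|exact: tame0].
have tx : tame 1 varx by exact: (@tame_mono 1%N 0%N).
have ty : tame 1 vary by exact: (@tame_mono 0%N 1%N).
have tD : tame 0 D'.
  move=> i j; rewrite /D' coef2Z /= mulrC mul_polyC subn0.
  case: (posnP (i + j)) => [/eqP|ij].
    by rewrite addn_eq0 => /andP[/eqP-> /eqP->]; rewrite D00 scale0r size_poly0.
  by apply: leq_trans (size_scale_leq _ _) _; rewrite size_polyX.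
have tw : tame 0 w' by exact: tame_lift.
have mk v e : tame 1 v -> tame 0 e -> Q 1%N (v + yyx * e) v.
  move=> tv te; have t2 : tame 2 (yyx * e) by apply: (@tameM 2 0) => //; exact: tame_yyx.
  by split=> //; [apply: tameD => //; exact: tame_le t2|rewrite addrAC subrr add0r].
have Qkl k l : Q (k + l)%N (phi.1 ^+ k * phi.2 ^+ l) (varx ^+ k * vary ^+ l).
  by apply: QM; apply: QX; exact: mk.
move=> i j; rewrite /variation -[f in _ - f]fcomp_id coef2D coef2N /= -sumrB.
apply: size_sum_le => k _; rewrite -sumrB; apply: size_sum_le => l _.
rewrite -mulrBr; have [_ _ t] := Qkl k l.
have [kl|kl] := leqP (k + l) (i + j).
  have -> : ((i + j).+1 - d.+1 = (i + j).+1 - (d + 1))%N by rewrite addn1.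
  apply: (@size_mul_tame _ _ (k + l) (i + j - (k + l)) (i + j) d 1) => //; last by rewrite subnKC.
  by apply: leq_trans (t i j) _; rewrite !subSS subn0; lia.
have := t i j; rewrite coef2D coef2N; have -> : ((i + j).+1 - (k + l).+1 = 0)%N by lia.
by rewrite leqn0 size_poly_eq0 => /eqP ->; rewrite mulr0 size_poly0.
Qed.

Hypothesis w00 : w 0%N 0%N != 0.

(** A single invariant over [{poly K}] specialises to the invariants for all [z Delta]. It has the
    form [x + z f']; dividing its invariance by [z] and then setting [z = 0] gives the equation of
    the first-order term [e]. *)
Lemma family_invariant : exists f : fps2 {poly K}, [/\ tame 1 f,
  (forall z, let fz := map2 (horner_eval z) f in
     fcomp fz (family (z *: D) w) = fz /\ fcomp fz onx = varx) &
  let e : fps2 K := Fps2 (fun i j => (f i j)`_1) in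
     variation 0 w e = - (yyx * D) /\ fcomp e onx = 0].
Proof.
have nu n : (n.+1%:R : {poly K}) \is a GRing.unit.
  by rewrite -polyC_natr poly_unitE size_polyC coefC /= unitfE pnatr_eq0.
have nuK n : (n.+1%:R : K) \is a GRing.unit by rewrite unitfE pnatr_eq0.
have D'00 : D' 0%N 0%N = 0 by rewrite /D' coef2Z /= D00 mulr0.
have w'00 : w' 0%N 0%N \is a GRing.unit.
  by rewrite /= poly_unitE size_polyC coefC /= unitfE w00.
have [|||f tf [fphi fx]] := invariant_exists nu D'00 w'00 (P := tame 1).
- exact: tame0.
- exact: tame_closed.
- move=> f tf; apply: tameB; first exact: (@tame_mono 1%N 0%N).
  apply: tame_integ; rewrite /= polyCV; apply: tameZ; apply: tame_divyyx.
  apply: tameB; first exact: tame_variation.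
  rewrite -scalerAl; apply: tameZ; apply: (@tameM 2 0); first exact: tame_yyx.
  exact: tame_dy.
have mapD z : map2 (horner_eval z) D' = z *: D.
  by apply: fps2P => i j; rewrite /= /horner_eval hornerM hornerX hornerC.
have mapw z : map2 (horner_eval z) w' = w.
  by apply: fps2P => i j; rewrite /= /horner_eval hornerC.
have fz z : let fz := map2 (horner_eval z) f in
    fcomp fz (family (z *: D) w) = fz /\ fcomp fz onx = varx.
  by rewrite /= -{1}(mapD z) -{1}(mapw z) -map2_family fphi -map2_onx fx map2_varx.
exists f; split=> //.
pose f' : fps2 {poly K} := Fps2 (fun i j => drop_poly 1 (f i j)).
have [f0phi f0x] := fz 0; rewrite scale0r in f0phi.
(* At [z = 0] the map preserves [x], and the normalised invariant is unique. *)
have f0 : map2 (horner_eval 0) f = varx.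
  have c := @invariant_unique _ nuK 0 w erefl _ (map2 (horner_eval 0) f - varx).
  apply/eqP; rewrite -subr_eq0; apply/eqP/c; first by rewrite unitfE.
    rewrite fcompB f0phi fcomp_varx; last exact: family_nct.
    by rewrite /= mulr0 addr0.
  by rewrite fcompB f0x fcomp_varx ?subrr//; exact: nct_onx.
have fE : f = varx + 'X *: f'.
  apply: fps2P => i j; rewrite coef2D coef2Z.
  have := congr1 (fun g : fps2 K => (g i j)%:P) f0; rewrite /= /horner_eval horner_coef0 => e.
  rewrite /= (_ : _%:R = ((f i j)`_0)%:P); last by rewrite e polyC_natr.
  apply/polyP => -[|n]; rewrite coefD coefC coefXM /= ?addr0// add0r coef_drop_poly.
  by rewrite addn1.
have X0 g : 'X *: g = 0 -> g = 0 :> fps2 {poly K}.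
  move=> Xg; apply: fps2P => i j.
  have /eqP := congr1 (fun g : fps2 {poly K} => g i j) Xg.
  by rewrite coef2Z mulf_eq0 polyX_eq0 /= => /eqP.
have mf' : map2 (horner_eval 0) f' = Fps2 (fun i j => (f i j)`_1).
  by apply: fps2P => i j; rewrite /= /horner_eval horner_coef0 coef_drop_poly.
have lV := proj1 (variation_clin D' w').
rewrite -mf'; split.
  have : variation D' w' f = 0 by rewrite /variation fphi subrr.
  rewrite {1}fE (linearD' lV) (linearZ' lV) variation_varx /D' -scalerAr -scalerDr.
  move/X0 => /(congr1 (map2 (horner_eval 0))); rewrite map2D map2M map2_yyx map2_0.
  rewrite /variation map2B map2_family mapD scale0r mapw.
  rewrite (_ : map2 _ (map2 _ D) = D); last first.
    by apply: fps2P => i j; rewrite /= /horner_eval hornerC.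
  by move/eqP; rewrite addrC addr_eq0 => /eqP.
rewrite -map2_onx (X0 (fcomp f' onx)) ?map2_0// -fcompZ.
have := fx; rewrite {1}fE fcompD fcomp_varx /=; last exact: nct_onx.
by move/eqP; rewrite -subr_eq0 addrAC subrr add0r => /eqP.
Qed.

End Tame.

(** * Formal inverses *)

Section Inverse.
Variable K : fieldType.
Implicit Types (f g h b c : fps2 K) (phi psi sigma tau : fps2 K * fps2 K).

Lemma fps2_inv b : b 0%N 0%N != 0 -> exists c, b * c = 1.
Proof.
move=> b0; pose d := b - b 0%N 0%N *: 1.
have od : ordge 1 d by apply/ordge1P; rewrite coef2D coef2N coef2Z mulr1 subrr.
have [//|//|//|n f g _ _ fg|c _ cE] :=
    @fps2_fix1 _ (fun=> True) (fun c => (b 0%N 0%N)^-1 *: (1 - d * c)).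
  rewrite -scalerBr; apply: ordgeZ.
  have -> : 1 - d * f - (1 - d * g) = - (d * (f - g)) by ring.
  by apply: ordgeN; rewrite -add1n; exact: ordgeM.
exists c; have -> : b = d + b 0%N 0%N *: 1 by rewrite subrK.
by rewrite mulrDl -scalerAl mul1r -{2}cE scalerA divff// scale1r addrC subrK.
Qed.

Definition linmap (M : 'M[K]_2) (u v : fps2 K) :=
  (M 0 0 *: u + M 0 1 *: v, M 1 0 *: u + M 1 1 *: v).

Lemma linear_partE phi : [/\ linear_part phi 0 0 = phi.1 1%N 0%N,
  linear_part phi 0 1 = phi.1 0%N 1%N, linear_part phi 1 0 = phi.2 1%N 0%N &
  linear_part phi 1 1 = phi.2 0%N 1%N].
Proof. by rewrite !mxE. Qed.

Lemma mx2_sum (F : 'I_2 -> K) : \sum_s F s = F 0 + F 1.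
Proof. by rewrite !big_ord_recl big_ord0 addr0; congr (_ + F _); exact: val_inj. Qed.

Lemma mx2P (M N : 'M[K]_2) : M 0 0 = N 0 0 -> M 0 1 = N 0 1 -> M 1 0 = N 1 0 ->
  M 1 1 = N 1 1 -> M = N.
Proof.
move=> h00 h01 h10 h11; apply/matrixP.
have c2 (c : 'I_2) : c = 0 \/ c = 1.
  by case: c => [[|[|]]]// h; [left|right]; exact: val_inj.
by move=> r c; case: (c2 r) => ->; case: (c2 c) => ->.
Qed.

Lemma linmapM M N u v : linmap M (linmap N u v).1 (linmap N u v).2 = linmap (M *m N) u v.
Proof.
by rewrite /linmap /= !mxE !mx2_sum !scalerDr !scalerA !scalerDl; congr pair; rewrite addrACA.
Qed.

Lemma linmap1 u v : linmap 1%:M u v = (u, v).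
Proof. by rewrite /linmap !mxE /= !scale1r !scale0r addr0 add0r. Qed.

Lemma nct_linmap M u v : ordge 1 u -> ordge 1 v -> nct (linmap M u v).
Proof. by move=> ou ov; split; apply: ordgeD; apply: ordgeZ. Qed.

Lemma fcomp_linmap M u v phi :
  pcomp (linmap M u v) phi = linmap M (fcomp u phi) (fcomp v phi).
Proof. by rewrite /pcomp /= !fcompD !fcompZ. Qed.

Lemma linear_part_linmap phi : nct phi ->
  ordge 2 (phi.1 - (linmap (linear_part phi) varx vary).1) /\
  ordge 2 (phi.2 - (linmap (linear_part phi) varx vary).2).
Proof.
move=> [p1 p2]; have [e1 e2 e3 e4] := linear_partE phi; rewrite /= e1 e2 e3 e4.
split; apply/ordge2P; rewrite !coef2D !coef2N !coef2D !coef2Z /=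
  !(mulr0, mulr1, addr0, add0r, subrr); split=> //.
- by rewrite subr0; exact: p1.
- by rewrite subr0; exact: p2.
Qed.

Lemma linear_part_order2 M phi : ordge 2 (phi.1 - (linmap M varx vary).1) ->
  ordge 2 (phi.2 - (linmap M varx vary).2) -> linear_part phi = M.
Proof.
move=> p1 p2; have [e1 e2 e3 e4] := linear_partE phi.
by apply: mx2P; rewrite ?e1 ?e2 ?e3 ?e4 ?(ordge_eq p1)// ?(ordge_eq p2)//;
  rewrite /= !(mulr0, mulr1, addr0, add0r).
Qed.

(** Writing [sigma = L + H] with [H] of order 2, the inverse is the fixed point of
    [tau -> L^-1 (id - H(tau))], a contraction by [fcomp_contract]. *)
Lemma right_inverse sigma : nct sigma -> linear_part sigma \in unitmx ->
  exists tau, [/\ nct tau, linear_part tau = invmx (linear_part sigma) &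
    pcomp sigma tau = (varx, vary)].
Proof.
move=> sn Lu; set L := linear_part sigma; set M := invmx L.
have [h1 h2] := linear_part_linmap sn; rewrite -/L in h1 h2.
set H1 := _ - _ in h1; set H2 := _ - _ in h2.
pose F tau := linmap M (varx - fcomp H1 tau) (vary - fcomp H2 tau).
have oH g tau : nct tau -> ordge 2 g -> ordge 2 (fcomp g tau) by exact: fcomp_ordge.
have FN tau : nct tau -> nct (F tau).
  move=> tn; apply: nct_linmap; apply: ordgeB;
    try exact: ordge_varx; try exact: ordge_vary;
    by apply: ordge_le (oH _ _ tn _) => //.
have [|tau H|n tau tau' tn tn' [e1 e2]|tau tn tauE] := @fps2_fix _ (@nct K) F _ FN.
- by split; exact: ordge_zero.
- by split; apply: ordge_closed => n; have [psi [? ?] [? ?]] := H n; [exists psi.1|exists psi.2].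
- case: n e1 e2 => [|n] e1 e2.
    by have [a b] := FN _ tn; have [c d] := FN _ tn'; split; exact: ordgeB.
  have c g : ordge 2 g -> ordge n.+2 (fcomp g tau - fcomp g tau').
    move=> og; have := fcomp_contract (isT : (0 < n.+1)%N) tn tn' e1 e2 og.
    by rewrite addn2 subn1.
  have l x y x' y' : ordge n.+2 (x - x') -> ordge n.+2 (y - y') ->
      eqmod n.+2 (linmap M x y) (linmap M x' y').
    move=> xx yy; split; rewrite /= opprD addrACA -!scalerBr;
    by apply: ordgeD; exact: ordgeZ.
  by apply: l; rewrite opprD addrACA subrr add0r opprK addrC; apply: ordge_sym;
    rewrite ?opprK; exact: c.
exists tau; split=> //.
  have tE : tau = F tau by [].
  have cl g u : ordge 2 g -> u - (u - g) = g by move=> _; rewrite opprB addrC subrK.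
  have key : ordge 2 ((F tau).1 - (linmap M varx vary).1) /\
             ordge 2 ((F tau).2 - (linmap M varx vary).2).
    split; rewrite /F /= opprD addrACA -!scalerBr; apply: ordgeD; apply: ordgeZ;
    by rewrite addrAC subrr add0r; apply: ordgeN; exact: oH.
  by rewrite tE; apply: linear_part_order2; case: key.
have sE : sigma = ((linmap L varx vary).1 + H1, (linmap L varx vary).2 + H2).
  by rewrite /H1 /H2 ![_ + (_ - _)]addrC !subrK -surjective_pairing.
have lt : linmap L tau.1 tau.2 = (varx - fcomp H1 tau, vary - fcomp H2 tau).
  by rewrite -{1 2}tauE linmapM mulmxV// linmap1.
have lc : (fcomp (linmap L varx vary).1 tau, fcomp (linmap L varx vary).2 tau) =
    (varx - fcomp H1 tau, vary - fcomp H2 tau).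
  have := fcomp_linmap L varx vary tau; rewrite /pcomp => ->.
  by rewrite fcomp_varx// fcomp_vary.
have c1 : fcomp (linmap L varx vary).1 tau = varx - fcomp H1 tau by exact: (congr1 (fun p : fps2 K * fps2 K => p.1) lc).
have c2 : fcomp (linmap L varx vary).2 tau = vary - fcomp H2 tau by exact: (congr1 (fun p : fps2 K * fps2 K => p.2) lc).
rewrite {1}sE /pcomp; congr pair.
  transitivity (fcomp ((linmap L varx vary).1 + H1) tau) => //.
  by rewrite fcompD c1 subrK.
transitivity (fcomp ((linmap L varx vary).2 + H2) tau) => //.
by rewrite fcompD c2 subrK.
Qed.

(** A right inverse of the right inverse [tau] must be [sigma] itself, so [tau] is two-sided. *)
Lemma formal_inverse_exists sigma : formal_diffeo sigma ->
  [/\ formal_diffeo (formal_inverse sigma),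
      pcomp sigma (formal_inverse sigma) = (varx, vary) &
      pcomp (formal_inverse sigma) sigma = (varx, vary)].
Proof.
move=> [/= s0 Lu]; rewrite /formal_inverse.
have sn : nct sigma by case: s0 => a b; split; apply/ordge1P.
have [tau [tn tL st]] := right_inverse sn Lu.
have tu : linear_part tau \in unitmx by rewrite tL unitmx_inv.
have [ups [un _ tu1]] := right_inverse tn tu.
have assoc (a b c : fps2 K * fps2 K) : nct b -> nct c -> pcomp (pcomp a b) c = pcomp a (pcomp b c).
  by move=> bn cn; rewrite /pcomp /= !fcompA.
have idr (a : fps2 K * fps2 K) : pcomp a (varx, vary) = a.
  by rewrite /pcomp !fcomp_id -surjective_pairing.
have idl (a : fps2 K * fps2 K) : nct a -> pcomp (varx, vary) a = a.
  by move=> an; rewrite /pcomp /= fcomp_varx// fcomp_vary// -surjective_pairing.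
have us : ups = sigma by rewrite -(idr sigma) -tu1 -assoc// st idl.
apply: (@xgetPex _ (varx, vary) [set tau | [/\ formal_diffeo tau,
    pair_comp sigma tau = (varx, vary) & pair_comp tau sigma = (varx, vary)]]%classic).
exists tau; split.
- by split=> //; case: tn => a b; split; apply/ordge1P.
- exact: st.
- by rewrite -us; exact: tu1.
Qed.

End Inverse.

(** * Logarithms of the members of the family *)

Section FamilyLog.
Variable K : numFieldType.
Implicit Types (f g h : fps2 K).

Section Log.
Variables (D w : fps2 K) (X : fps2 K -> fps2 K).
Hypotheses (D00 : D 0%N 0%N = 0) (logX : is_log (family D w) X).

Lemma family_tangent_id : tangent_id (family D w).
Proof. by split; [exact: family_tangent1|exact: family_tangent2]. Qed.

Lemma family_log : [/\ derivation X, raising X,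
  forall g, fcomp g (family D w) = expvf X g,
  forall g, fcomp (X g) onx = 0 & forall g, fcomp (X g) ond = 0].
Proof.
have [dX rX eX] := log_raising family_tangent_id logX.
split=> //; apply: (flow_restrict dX rX eX).
- exact: nct_onx.
- exact: family_onx.
- exact: nct_ond.
- exact: family_ond.
Qed.

(** [X] vanishes on both fixed curves, hence is divisible by [y (y - x)]. On [x] and [y] it agrees
    with the variation up to terms of order 3, so after division the values at the origin are those
    of [D] and [w]. *)
Lemma family_log_coefs : exists a b, [/\ X varx = yyx * a, X vary = yyx * b,
  a 0%N 0%N = 0 & b 0%N 0%N = w 0%N 0%N].
Proof.
have [dX rX eX x0 xd] := family_log.
have XE g : X g = yyx * divyyx (X g) by apply: divyyxE.
have lead v e : ordge 1 v -> variation D w v = yyx * e ->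
    divyyx (X v) 0%N 0%N = e 0%N 0%N.
  move=> ov; rewrite /variation eX (expvf_rem rX) => vE.
  have Xv : ordge 3 (X v - yyx * e).
    rewrite -vE (_ : X v - _ = - exprem X v); last by ring.
    by apply: ordgeN; exact: exprem_ordge.
  have := divyyx_ordge Xv; rewrite divyyxB divyyxK => H.
  exact: ordge_eq H _.
exists (divyyx (X varx)), (divyyx (X vary)); split; [exact: XE|exact: XE| |].
  by rewrite -D00; apply: lead; [exact: ordge_varx|exact: variation_varx].
by apply: lead; [exact: ordge_vary|exact: variation_vary].
Qed.

Variables (a b : fps2 K).
Hypotheses (Xx : X varx = yyx * a) (Xy : X vary = yyx * b).

(** The cofactor of the equation [y] is [1 + (y - x) w] for the map and [(y - x) b] for [X];
    [cofactor_ond] treats the equation [y - x] in the same way. *)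
Lemma cofactor_onx : fcomp (1 + (vary - varx) * w) onx =
  fcomp expser (fcomp ((vary - varx) * b) onx, 0).
Proof.
have [dX rX eX x0 xd] := family_log.
apply: (flow_cofactor dX rX eX (nct_onx K) x0 (l := vary)).
- exact: vary_inj.
- by apply: ordgeMl; apply: ordgeB; [exact: ordge_vary|exact: ordge_varx].
- by rewrite Xy /yyx mulrA.
- by rewrite fcomp_vary /= /yyx; [ring|exact: family_nct].
Qed.

Lemma cofactor_ond : fcomp (1 + vary * (w - D)) ond =
  fcomp expser (fcomp (vary * (b - a)) ond, 0).
Proof.
have [dX rX eX x0 xd] := family_log.
have pn := family_nct D w.
apply: (flow_cofactor dX rX eX (nct_ond K) xd (l := vary - varx)).
- exact: yx_inj.
- by apply: ordgeMl; exact: ordge_vary.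
- by rewrite (linearB' dX.1.1) Xx Xy /yyx; ring.
- by rewrite fcompB fcomp_vary// fcomp_varx// /= /yyx; ring.
Qed.

End Log.

(** By [flow_exprem] the variation of [e] is [X h] with [h = e + S]. The equation for [h] is solved
    by one integration in [y], and [S], being in the image of [X], is invisible on both fixed
    curves. *)
Lemma first_variation (D w e c b : fps2 K) (X : fps2 K -> fps2 K) :
  is_log (family 0 w) X -> X vary = yyx * b -> b * c = 1 ->
  variation 0 w e = - (yyx * D) -> fcomp e onx = 0 ->
  X varx = 0 /\ fcomp e ond = - fcomp (integ (c * D)) ond.
Proof.
move=> logX Xy bc ve e0.
have [dX rX eX x0 xd] := family_log logX.
have lX : linear X := dX.1.1.
have Xx : X varx = 0.
  apply: (fixed_flow dX rX eX); rewrite fcomp_varx; last exact: family_nct.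
  by rewrite /= mulr0 addr0.
split=> //.
set S := opser X (fun k => invfact K k.+2) (X e).
have SX : S = X (opser X (fun k => invfact K k.+2) e) by rewrite /S (opser_comm lX rX).
pose h := e + S.
have Xh : X h = - (yyx * D) by rewrite -ve /variation (flow_exprem dX rX eX).
have dh : dy h = - (c * D).
  have : yyx * (b * dy h) = yyx * - D.
    by rewrite mulrN -Xh (derivation_vfield dX) /vfield Xx Xy mul0r add0r mulrA.
  by move/yyx_injl => bh; rewrite -[LHS]mul1r -bc [b * c]mulrC -mulrA bh mulrN.
have h0 : fcomp h onx = 0 by rewrite fcompD e0 add0r SX x0.
have nu n : (n.+1%:R : K) \is a GRing.unit by rewrite unitfE pnatr_eq0.
have hE : h = - integ (c * D).
  rewrite -[LHS]subr0 -h0 fcomp_onx -(integ_dy nu) dh.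
  by rewrite -[- (c * D)]sub0r integB integ0 sub0r.
by rewrite -fcompN -hE fcompD SX xd addr0.
Qed.

End FamilyLog.

(** * Formal transport of the field by the conjugacy *)

Section Transport.
Variable K : numFieldType.
Implicit Types (f g h : fps2 K).

Variables (X : fps2 K -> fps2 K) (a b : fps2 K) (w0 : K).
Hypotheses (dX : derivation X) (rX : raising X).
Hypotheses (X0 : forall g, fcomp (X g) onx = 0) (X1 : forall g, fcomp (X g) ond = 0).
Hypotheses (Xx : X varx = yyx * a) (Xy : X vary = yyx * b).
Hypotheses (a00 : a 0%N 0%N = 0) (b00 : b 0%N 0%N = w0) (w0N : w0 != 0).

Variables sigma tau : fps2 K * fps2 K.
Hypotheses (sn : nct sigma) (tn : nct tau).
Hypotheses (st : pcomp sigma tau = (varx, vary)) (ts : pcomp tau sigma = (varx, vary)).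
(* The linear part of [sigma] maps the tangents of the fixed curves [y = 0] and
   [y = x] to the coordinate axes. *)
Hypotheses (s1 : ordge 2 (sigma.1 - (varx - vary))) (s2 : ordge 2 (sigma.2 - vary)).

Variables P Q : fps2 K.
Hypotheses (PE : fcomp P sigma = X sigma.1) (QE : fcomp Q sigma = X sigma.2).

Let V g := a * dx g + b * dy g.

Lemma transport_vfield g : X g = yyx * V g.
Proof. by rewrite (derivation_vfield dX) /vfield Xx Xy /V; ring. Qed.

Lemma transport_inj f g : fcomp f sigma = fcomp g sigma -> f = g.
Proof.
by move/(congr1 (fcomp^~ tau)); rewrite !fcompA// st !fcomp_id.
Qed.

Lemma transport_back f : fcomp (fcomp f tau) sigma = f.
Proof. by rewrite fcompA// ts fcomp_id. Qed.

Let V1 : V sigma.1 0%N 0%N = - w0.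
Proof.
rewrite /V coef2D !coef2M !big_ord1 a00 mul0r add0r b00 /= mul1r.
by rewrite (ordge_eq s1)//= sub0r mulrN1.
Qed.
Let V2 : V sigma.2 0%N 0%N = w0.
Proof.
rewrite /V coef2D !coef2M !big_ord1 a00 mul0r add0r b00 /= mul1r.
by rewrite (ordge_eq s2)//= mulr1.
Qed.

(** Both components of the transported field pull back to multiples of [y (y - x)], and [V sigma.2]
    is a unit, so the slope is the transport of [V sigma.1 / V sigma.2]. *)
Lemma transport_slope : exists2 C, P = Q * C & C 0%N 0%N = - 1.
Proof.
have [W W1] : exists W, V sigma.2 * W = 1 by apply: fps2_inv; rewrite V2.
exists (fcomp (V sigma.1 * W) tau).
  apply: transport_inj; rewrite fcompM// transport_back PE QE !transport_vfield.
  by rewrite -mulrA; congr (_ * _); rewrite mulrCA W1 mulr1.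
rewrite fcomp_const coef2M !big_ord1 V1.
have := congr1 (fun f : fps2 K => f 0%N 0%N) W1.
rewrite coef2M !big_ord1 V2 /= mulNr => W00; congr (- _); exact: W00.
Qed.

(** Under [tau] the equations [y] and [y - x] become [y] and [- x] to first order, and the remaining
    factor is [w0] at the origin. *)
Lemma transport_leading : ordge 3 (Q - (- w0) *: (varx * vary)).
Proof.
have t2 : ordge 2 (tau.2 - vary).
  have : fcomp sigma.2 tau = vary by exact: (congr1 (fun p : fps2 K * fps2 K => p.2) st).
  rewrite -(subrK vary sigma.2) fcompD fcomp_vary// => e.
  rewrite -{1}e opprD addrCA subrr addr0; apply: ordgeN; exact: fcomp_ordge.
have t1 : ordge 2 (tau.1 - (varx + vary)).
  have : fcomp sigma.1 tau = varx by exact: (congr1 (fun p : fps2 K * fps2 K => p.1) st).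
  rewrite -(subrK (varx - vary) sigma.1) fcompD fcompB fcomp_varx// fcomp_vary// => e.
  have -> : tau.1 - (varx + vary) = (tau.2 - vary) - fcomp (sigma.1 - (varx - vary)) tau.
    by rewrite -{1}e; ring.
  by apply: ordgeB => //; exact: fcomp_ordge.
have -> : Q = tau.2 * (tau.2 - tau.1) * fcomp (V sigma.2) tau.
  apply: transport_inj; rewrite QE transport_vfield !fcompM// transport_back fcompB.
  have -> : fcomp tau.1 sigma = varx by exact: (congr1 (fun p : fps2 K * fps2 K => p.1) ts).
  by have -> : fcomp tau.2 sigma = vary by exact: (congr1 (fun p : fps2 K * fps2 K => p.2) ts).
set U := fcomp _ tau.
have U00 : ordge 1 (U - w0 *: 1).
  by apply/ordge1P; rewrite coef2D coef2N coef2Z fcomp_const V2 mulr1 subrr.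
set d2 := tau.2 - vary in t2; set d1 := tau.1 - (varx + vary) in t1.
have -> : tau.2 * (tau.2 - tau.1) * U - (- w0) *: (varx * vary) =
   (d2 * (tau.2 - tau.1) + vary * (d2 - d1)) * U
   - varx * vary * (U - w0 *: 1).
  by rewrite scaleNr -[w0 *: (varx * vary)]mulr_algl /d1 /d2; ring.
have o21 : ordge 1 (tau.2 - tau.1) by case: tn => *; exact: ordgeB.
apply: ordgeB.
  apply: ordgeMl; apply: ordgeD; first by rewrite -[3%N]/(2 + 1)%N; exact: ordgeM.
  by rewrite -[3%N]/(1 + 2)%N; apply: ordgeM; [exact: ordge_vary|exact: ordgeB].
rewrite -[3%N]/(1 + 1 + 1)%N; apply: ordgeM => //.
by apply: ordgeM; [exact: ordge_varx|exact: ordge_vary].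
Qed.

Lemma transport_first_integral C F : P = Q * C -> dy F = - (C * dx F) ->
  X (fcomp F sigma) = 0.
Proof.
move=> PQ FE; rewrite (derivation_comp dX sn) -PE -QE FE PQ fcompN !fcompM//; ring.
Qed.

(** [C dx Q + dy Q] is the cofactor of [Q] for the transported field. Its pullback is the cofactor
    of [y (y - x) U] with [U] a unit; along a fixed curve [X U] vanishes, so [U] contributes
    nothing, and the cofactor of the other curve vanishes there too. *)
Lemma transport_cofactor C : P = Q * C ->
  fcomp (fcomp (C * dx Q + dy Q) sigma) onx = fcomp ((vary - varx) * b) onx /\
  fcomp (fcomp (C * dx Q + dy Q) sigma) ond = fcomp (vary * (b - a)) ond.
Proof.
move=> PQ; set E := C * _ + _; set U := V sigma.2.
have [W W1] : exists W, U * W = 1 by apply: fps2_inv; rewrite V2.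
have QU : fcomp Q sigma = yyx * U by rewrite QE transport_vfield.
have XQ : X (fcomp Q sigma) = fcomp Q sigma * fcomp E sigma.
  rewrite (derivation_comp dX sn) -PE -QE PQ /E fcompD !fcompM//; ring.
have XM := dX.2.
have Xyyx : X yyx = yyx * ((vary - varx) * b + vary * (b - a)).
  by rewrite {1}/yyx XM (linearB' dX.1.1) Xx Xy /yyx; ring.
have UE : U * fcomp E sigma = ((vary - varx) * b + vary * (b - a)) * U + X U.
  by apply: yyx_injl; rewrite mulrA -QU -XQ QU XM Xyyx; ring.
have key rho : nct rho -> (forall g, fcomp (X g) rho = 0) ->
   fcomp (fcomp E sigma) rho = fcomp ((vary - varx) * b + vary * (b - a)) rho.
  move=> rn rX0; have := congr1 (fcomp^~ rho) UE.
  rewrite [X in _ = X -> _]fcompD rX0 addr0 (fcompM rn U) [X in _ = X -> _](fcompM rn _ U) => e.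
  have W1r : fcomp U rho * fcomp W rho = 1 by rewrite -fcompM// W1 fcomp1.
  by rewrite -[LHS]mul1r -W1r mulrAC e -mulrA W1r mulr1.
split.
  have n := nct_onx K; rewrite key// fcompD [X in _ + X]fcompM// fcomp_vary//=.
  by rewrite mul0r addr0.
have n := nct_ond K; rewrite key// fcompD [X in X + _]fcompM// fcompB.
by rewrite fcomp_vary// fcomp_varx//= subrr mul0r add0r.
Qed.

End Transport.

(** * Convergence *)

(** The estimates are needed twice: for complex coefficients with [normc], and for real polynomials
    in the interpolation argument. *)
Record absval (R : realFieldType) (K : fieldType) := AbsVal {
  av :> K -> R;
  av_ge0 : forall x, 0 <= av x;
  av_eq0 : forall x, av x = 0 -> x = 0;
  avD : forall x y, av (x + y) <= av x + av y;
  avM : forall x y, av (x * y) = av x * av y;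
  av_natr : forall n, av n%:R = n%:R }.

Section Absval.
Variables (R : realFieldType) (K : fieldType) (nm : absval R K).

Lemma av0 : nm 0 = 0. Proof. exact: (av_natr nm 0). Qed.
Lemma av1 : nm 1 = 1. Proof. exact: (av_natr nm 1). Qed.
Lemma avN x : nm (- x) = nm x.
Proof.
have n1 : nm (-1) = 1.
  have /eqP : nm (-1) ^+ 2 = 1 by rewrite expr2 -avM mulrNN mulr1 av1.
  rewrite sqrf_eq1 => /orP[/eqP//|/eqP e]; have := av_ge0 nm (-1).
  by rewrite e lerNr oppr0 ler10.
by rewrite -mulN1r avM n1 mul1r.
Qed.
Lemma av_gt0 x : x != 0 -> 0 < nm x.
Proof.
by rewrite lt_def av_ge0 andbT; apply: contra => /eqP/av_eq0 ->.
Qed.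
Lemma avV x : nm x^-1 = (nm x)^-1.
Proof.
have [->|x0] := eqVneq x 0; first by rewrite invr0 av0 invr0.
apply: (mulfI (lt0r_neq0 (av_gt0 x0))).
by rewrite -avM !divff ?av1// lt0r_neq0 ?av_gt0.
Qed.
Lemma av_sum (I : Type) (r : seq I) (P : pred I) (F : I -> K) :
  nm (\sum_(k <- r | P k) F k) <= \sum_(k <- r | P k) nm (F k).
Proof.
elim/big_rec2: _ => [|k y x _ xy]; first by rewrite av0.
by apply: le_trans (avD _ _ _) _; rewrite lerD2l.
Qed.
End Absval.

(** * Partial sums of norms on polydiscs *)

Section BoxNorm.
Variables (R : realFieldType) (K : fieldType) (nm : absval R K).
Implicit Types (f g h : fps2 K) (phi psi : fps2 K * fps2 K) (r s : R).

Definition bnorm r m f : R := \sum_(i < m) \sum_(j < m) nm (f i j) * r ^+ (i + j).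

Section Fixed.
Variable r : R.
Hypothesis r0 : 0 <= r.

Let term_ge0 f i j : 0 <= nm (f i j) * r ^+ (i + j).
Proof. by rewrite mulr_ge0 ?av_ge0 ?exprn_ge0. Qed.

Lemma bnorm_ge0 m f : 0 <= bnorm r m f.
Proof. by apply: sumr_ge0 => i _; apply: sumr_ge0. Qed.

Lemma bnorm_coef m f i j : (i < m)%N -> (j < m)%N ->
  nm (f i j) * r ^+ (i + j) <= bnorm r m f.
Proof.
move=> im jm; rewrite /bnorm (bigD1 (Ordinal im))//= (bigD1 (Ordinal jm))//=.
rewrite -addrA lerDl addr_ge0//; first by apply: sumr_ge0.
by apply: sumr_ge0 => k _; apply: sumr_ge0.
Qed.

Lemma bnorm_le_coef m f g : (forall i j, (i < m)%N -> (j < m)%N ->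
  nm (f i j) <= nm (g i j)) -> bnorm r m f <= bnorm r m g.
Proof.
move=> fg; apply: ler_sum => i _; apply: ler_sum => j _.
by rewrite ler_wpM2r ?exprn_ge0// fg.
Qed.

Lemma eq_bnorm m f g : (forall i j, (i < m)%N -> (j < m)%N -> f i j = g i j) ->
  bnorm r m f = bnorm r m g.
Proof. by move=> fg; apply/eqP; rewrite eq_le !bnorm_le_coef// => i j im jm; rewrite fg. Qed.

Lemma bnorm_eqmod m n f g : ordge n (f - g) -> (m + m <= n)%N ->
  bnorm r m f = bnorm r m g.
Proof. by move=> fg mn; apply: eq_bnorm => i j im jm; rewrite (ordge_eq fg)//; lia. Qed.

Lemma bnorm_mono m n f : (m <= n)%N -> bnorm r m f <= bnorm r n f.
Proof.
move=> mn; rewrite /bnorm.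
rewrite (big_ord_widen n (fun i => \sum_(j < m) nm (f i j) * r ^+ (i + j)) mn).
apply: le_trans (_ : \sum_(i < n) \sum_(j < m) nm (f i j) * r ^+ (i + j) <= _).
  rewrite [leRHS](bigID (fun i : 'I_n => i < m)%N)/= lerDl.
  by apply: sumr_ge0 => i _; apply: sumr_ge0.
apply: ler_sum => i _.
rewrite (big_ord_widen n (fun j => nm (f i j) * r ^+ (i + j)) mn).
by rewrite [leRHS](bigID (fun i : 'I_n => i < m)%N)/= lerDl sumr_ge0.
Qed.

Lemma bnorm0 m : bnorm r m 0 = 0.
Proof. by rewrite /bnorm big1// => i _; rewrite big1// => j _; rewrite av0 mul0r. Qed.
Lemma bnormN m f : bnorm r m (- f) = bnorm r m f.
Proof. by apply: eq_bigr => i _; apply: eq_bigr => j _; rewrite avN. Qed.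
Lemma bnormD m f g : bnorm r m (f + g) <= bnorm r m f + bnorm r m g.
Proof.
rewrite -big_split; apply: ler_sum => i _; rewrite -big_split; apply: ler_sum => j _ /=.
by rewrite -mulrDl ler_wpM2r ?exprn_ge0// avD.
Qed.
Lemma bnormB m f g : bnorm r m (f - g) <= bnorm r m f + bnorm r m g.
Proof. by apply: le_trans (bnormD _ _ _) _; rewrite bnormN. Qed.
Lemma bnormZ m a f : bnorm r m (a *: f) = nm a * bnorm r m f.
Proof.
rewrite /bnorm mulr_sumr; apply: eq_bigr => i _; rewrite mulr_sumr.
by apply: eq_bigr => j _; rewrite coef2Z avM mulrA.
Qed.
Lemma bnorm_sum m (I : Type) (s : seq I) (P : pred I) (F : I -> fps2 K) :
  bnorm r m (\sum_(k <- s | P k) F k) <= \sum_(k <- s | P k) bnorm r m (F k).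
Proof.
elim/big_rec2: _ => [|k y x _ xy]; first by rewrite bnorm0.
by apply: le_trans (bnormD _ _ _) _; rewrite lerD2l.
Qed.
Lemma bnorm1 m : bnorm r m 1 <= 1.
Proof.
case: m => [|m]; first by rewrite /bnorm big_ord0.
rewrite /bnorm (bigD1 ord0)//= [X in _ + X]big1 ?addr0 => [|i]; last first.
  by rewrite -val_eqE /= => /negPf i0; rewrite big1// => j _; rewrite i0 av0 mul0r.
rewrite (bigD1 ord0)//= [X in _ + X]big1 ?addr0 => [|j]; last first.
  by rewrite -val_eqE /= => /negPf ->; rewrite av0 mul0r.
by rewrite av1 expr0 mulr1.
Qed.

Lemma cauchy_sum_le m (a b : nat -> R) : (forall k, 0 <= a k) -> (forall k, 0 <= b k) ->
  \sum_(i < m) \sum_(k < i.+1) a k * b (i - k)%N <=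
  (\sum_(k < m) a k) * (\sum_(l < m) b l).
Proof.
move=> a0 b0; pose c i k := if (k <= i)%N then a k * b (i - k)%N else 0.
have -> : \sum_(i < m) \sum_(k < i.+1) a k * b (i - k)%N = \sum_(i < m) \sum_(k < m) c i k.
  apply: eq_bigr => i _.
  rewrite (big_ord_widen m (fun k => a k * b (i - k)%N) (ltn_ord i)) big_mkcond.
  by apply: eq_bigr => k _; rewrite ltnS.
rewrite exchange_big mulr_suml; apply: ler_sum => k _.
rewrite /c -big_mkcond /=.
have /= <- := big_geq_mkord (idx := 0) (op := +%R) k m xpredT (fun i => a k * b (i - k)%N).
rewrite -{1}[k : nat]add0n big_addn big_mkord.
rewrite mulr_sumr; under eq_bigr do rewrite addnK.
rewrite (big_ord_widen m (fun l => a k * b l) (leq_subr k m)).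
rewrite [leRHS](bigID (fun l : 'I_m => l < m - k)%N)/= lerDl.
by apply: sumr_ge0 => l _; exact: mulr_ge0.
Qed.

End Fixed.
End BoxNorm.

Section Bounded.
Variables (R : realFieldType) (K : fieldType) (nm : absval R K).
Implicit Types (f g h : fps2 K) (phi psi : fps2 K * fps2 K) (r s : R).
Local Notation bnorm := (bnorm nm).

(** Coefficients of a product in the square of side [m] involve only coefficients of the factors in
    that square, so the inequality already holds for partial sums. *)
Lemma bnormM r m f g : 0 <= r -> bnorm r m (f * g) <= bnorm r m f * bnorm r m g.
Proof.
move=> r0; pose F k l := nm (f k l) * r ^+ (k + l); pose G k l := nm (g k l) * r ^+ (k + l).
have F0 k l : 0 <= F k l by rewrite mulr_ge0 ?av_ge0 ?exprn_ge0.
have G0 k l : 0 <= G k l by rewrite mulr_ge0 ?av_ge0 ?exprn_ge0.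
apply: le_trans (_ : \sum_(i < m) \sum_(k < i.+1)
    (\sum_(l < m) F k l) * (\sum_(l < m) G (i - k)%N l) <= _); last first.
  apply: (cauchy_sum_le m (a := fun k => \sum_(l < m) F k l)
    (b := fun k => \sum_(l < m) G k l)) => k; exact: sumr_ge0.
apply: ler_sum => i _.
apply: le_trans (_ : \sum_(k < i.+1) \sum_(j < m) \sum_(l < j.+1)
    F k l * G (i - k)%N (j - l)%N <= _); last first.
  apply: ler_sum => k _; exact: (cauchy_sum_le m (F0 k) (G0 (i - k)%N)).
rewrite exchange_big; apply: ler_sum => j _ /=.
apply: le_trans (ler_wpM2r _ (av_sum _ _ _ _)) _.
  exact: exprn_ge0.
rewrite mulr_suml; apply: ler_sum => k _.
apply: le_trans (ler_wpM2r _ (av_sum _ _ _ _)) _; first exact: exprn_ge0.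
rewrite mulr_suml; apply: ler_sum => l _; rewrite avM /F /G mulrACA -exprD.
rewrite (_ : (i + j = k + l + (i - k + (j - l)))%N)//.
have := ltn_ord k; have := ltn_ord l; lia.
Qed.

Lemma bnormX r m f k : 0 <= r -> bnorm r m (f ^+ k) <= bnorm r m f ^+ k.
Proof.
move=> r0; elim: k => [|k IH]; first by rewrite !expr0; exact: bnorm1.
rewrite !exprS; apply: le_trans (bnormM _ _ _ r0) _.
by apply: ler_wpM2l => //; exact: bnorm_ge0.
Qed.

(** Coefficients in the square of side [m] have degree below [2m]; only the terms of [f] in the
    square of side [m + m] reach them. *)
Lemma bnorm_fcomp r s m f phi : 0 <= r -> nct phi ->
  bnorm r m phi.1 <= s -> bnorm r m phi.2 <= s ->
  bnorm r m (fcomp f phi) <= bnorm s (m + m) f.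
Proof.
move=> r0 pn p1 p2; rewrite (bnorm_eqmod nm r0 (@fcomp_boxsum _ (m + m)%N f _ pn))//.
apply: le_trans (bnorm_sum _ _ _ _ _ _) _ => //; apply: ler_sum => k _.
apply: le_trans (bnorm_sum _ _ _ _ _ _) _ => //; apply: ler_sum => l _.
rewrite bnormZ ler_wpM2l ?av_ge0//; apply: le_trans (bnormM _ _ _ r0) _.
rewrite exprD; apply: ler_pM; rewrite ?bnorm_ge0//.
  by apply: le_trans (bnormX _ _ _ r0) _; rewrite lerXn2r ?nnegrE ?bnorm_ge0// (le_trans _ p1)// bnorm_ge0.
by apply: le_trans (bnormX _ _ _ r0) _; rewrite lerXn2r ?nnegrE ?bnorm_ge0// (le_trans _ p2)// bnorm_ge0.
Qed.

Lemma bnorm_order d r s m f : 0 <= r -> r <= s -> 0 < s -> ordge d f ->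
  bnorm r m f <= (r / s) ^+ d * bnorm s m f.
Proof.
move=> r0 rs s0 df; rewrite /bnorm mulr_sumr; apply: ler_sum => i _.
rewrite mulr_sumr; apply: ler_sum => j _; rewrite mulrCA.
have [ij|ij] := ltnP (i + j) d; first by rewrite df// av0 !mul0r.
apply: ler_wpM2l; first exact: av_ge0.
rewrite -(subnKC ij) exprD [s ^+ _]exprD mulrA -exprMn divfK ?lt0r_neq0//.
by rewrite ler_wpM2l ?exprn_ge0// lerXn2r ?nnegrE// ltW.
Qed.

Lemma bnorm_le_r r s m f : 0 <= r -> r <= s -> 0 < s -> bnorm r m f <= bnorm s m f.
Proof.
by move=> r0 rs s0; have := bnorm_order m r0 rs s0 (ordge0 f); rewrite expr0 mul1r.
Qed.

Definition bd f := exists r C, 0 < r /\ forall m, bnorm r m f <= C.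

(** The order in excess of [d] supplies a factor [r], which beats any constant when the radius
    shrinks. *)
Lemma bd_small d f e : bd f -> ordge d.+1 f -> 0 < e ->
  exists2 s, 0 < s & forall r m, 0 < r -> r <= s -> bnorm r m f <= e * r ^+ d.
Proof.
move=> [s [C [s0 HC]]] df e0.
have C0 : 0 <= C by apply: le_trans (HC 0%N); apply: bnorm_ge0; exact: ltW.
have C1 : 0 < C + 1 by rewrite ltr_wpDl.
have q0 : 0 < e * s ^+ d.+1 / (C + 1) by rewrite divr_gt0// mulr_gt0// exprn_gt0.
exists (Num.min s (e * s ^+ d.+1 / (C + 1))); first by rewrite lt_min s0.
move=> r m r0; rewrite le_min => /andP[rs rq].
apply: le_trans (bnorm_order m (ltW r0) rs s0 df) _.
apply: le_trans (ler_wpM2l _ (HC m)) _; first by rewrite exprn_ge0 ?divr_ge0// ltW.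
have -> : (r / s) ^+ d.+1 * C = r ^+ d * (r * C / s ^+ d.+1).
  by rewrite expr_div_n [r ^+ d.+1]exprS; move: (s ^+ d.+1)^-1 => v; ring.
rewrite [e * _]mulrC ler_wpM2l ?exprn_ge0 ?(ltW r0)// ler_pdivrMr ?exprn_gt0//.
apply: le_trans (_ : r * (C + 1) <= _); first by rewrite ler_wpM2l ?(ltW r0)// lerDl.
by rewrite -ler_pdivlMr.
Qed.

Lemma bd_le f : bd f -> exists C, exists2 s, 0 < s & forall r m, 0 < r -> r <= s -> bnorm r m f <= C.
Proof.
move=> [s [C [s0 HC]]]; exists C, s => // r m r0 rs.
by apply: le_trans (HC m); apply: bnorm_le_r => //; exact: ltW.
Qed.

Lemma bd_common f g : bd f -> bd g -> exists s C D,
  [/\ 0 < s, forall m, bnorm s m f <= C & forall m, bnorm s m g <= D].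
Proof.
move=> /bd_le[C [s s0 fC]] /bd_le[D [t t0 gD]].
exists (Num.min s t), C, D; split; first by rewrite lt_min s0.
  by move=> m; apply: fC; rewrite ?lt_min ?s0// ge_min lexx.
by move=> m; apply: gD; rewrite ?lt_min ?s0// ge_min lexx orbT.
Qed.

Lemma bd0 : bd 0.
Proof. by exists 1, 0; split=> // m; rewrite bnorm0. Qed.
Lemma bd1 : bd 1.
Proof. by exists 1, 1; split=> // m; apply: bnorm1. Qed.
Lemma bdD f g : bd f -> bd g -> bd (f + g).
Proof.
move=> bf bg; have [s [C [D [s0 fC gD]]]] := bd_common bf bg.
exists s, (C + D); split=> // m; apply: le_trans (bnormD _ _ _ _ _) _; first exact: ltW.
exact: lerD.
Qed.
Lemma bdN f : bd f -> bd (- f).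
Proof. by move=> [s [C [s0 H]]]; exists s, C; split=> // m; rewrite bnormN. Qed.
Lemma bdB f g : bd f -> bd g -> bd (f - g).
Proof. by move=> bf bg; apply: bdD => //; exact: bdN. Qed.
Lemma bdZ a f : bd f -> bd (a *: f).
Proof.
move=> [s [C [s0 H]]]; exists s, (nm a * C); split=> // m.
by rewrite bnormZ ler_wpM2l ?av_ge0.
Qed.
Lemma bdM f g : bd f -> bd g -> bd (f * g).
Proof.
move=> bf bg; have [s [C [D [s0 fC gD]]]] := bd_common bf bg.
exists s, (C * D); split=> // m; apply: le_trans (bnormM _ _ _ (ltW s0)) _.
by apply: ler_pM; rewrite ?bnorm_ge0// ltW.
Qed.

Lemma bd_fcomp f phi : bd f -> nct phi -> bd phi.1 -> bd phi.2 -> bd (fcomp f phi).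
Proof.
move=> [s [C [s0 H]]] pn b1 b2.
have [r1 r10 H1] := bd_small (d := 0) b1 pn.1 s0.
have [r2 r20 H2] := bd_small (d := 0) b2 pn.2 s0.
have r0 : 0 < Num.min r1 r2 by rewrite lt_min r10.
exists (Num.min r1 r2), C; split=> // m.
apply: le_trans (H (m + m)%N); apply: bnorm_fcomp => //; first exact: ltW.
  by rewrite -[s]mulr1 -(expr0 (Num.min r1 r2)) H1// ge_min lexx.
by rewrite -[s]mulr1 -(expr0 (Num.min r1 r2)) H2// ge_min lexx orbT.
Qed.

Definition geometric f := exists2 M, 1 <= M & forall i j, nm (f i j) <= M ^+ (i + j).+1.

Lemma geom_half_sum m : \sum_(i < m) (2^-1 : R) ^+ i <= 2.
Proof.
suff H : \sum_(i < m) (2^-1 : R) ^+ i = 2 - 2 * 2^-1 ^+ m.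
  by rewrite H gerBl mulr_ge0// exprn_ge0// invr_ge0.
elim: m => [|m IH]; first by rewrite big_ord0 expr0 mulr1 subrr.
by rewrite big_ord_recr /= IH exprS; field.
Qed.

Lemma geometric_bd f : geometric f -> bd f.
Proof.
move=> [M M1 H]; have M0 : 0 < M by exact: lt_le_trans M1.
exists (2 * M)^-1, (M * (2 * 2)); split; first by rewrite invr_gt0 mulr_gt0.
move=> m; apply: le_trans (_ : \sum_(i < m) \sum_(j < m) M * (2^-1 ^+ i * 2^-1 ^+ j) <= _).
  apply: ler_sum => i _; apply: ler_sum => j _.
  apply: le_trans (ler_wpM2r _ (H i j)) _.
    by rewrite exprn_ge0// invr_ge0 mulr_ge0// ltW.
  rewrite exprS -mulrA ler_wpM2l ?(ltW M0)// -exprMn -exprD invfM mulrCA divff ?mulr1//.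
  exact: lt0r_neq0.
under eq_bigr do rewrite -mulr_sumr; rewrite -mulr_sumr ler_wpM2l ?(ltW M0)//.
under eq_bigr do rewrite -mulr_sumr; rewrite -mulr_suml.
by apply: ler_pM; rewrite ?geom_half_sum//; apply: sumr_ge0 => i _; rewrite exprn_ge0// invr_ge0.
Qed.

Lemma bd_geometric f : bd f -> geometric f.
Proof.
move=> [r [C [r0 H]]]; set M := Num.max 1 (Num.max C r^-1).
have M1 : 1 <= M by rewrite /M le_max lexx.
exists M => // i j.
have := le_trans (bnorm_coef nm (ltW r0) f (ltn_ord (inord i : 'I_(i + j).+1)) (ltn_ord (inord j : 'I_(i + j).+1))) (H _).
rewrite !inordK ?ltnS ?leq_addr ?leq_addl// -ler_pdivlMr ?exprn_gt0// => h.
apply: le_trans h _; rewrite exprS; apply: ler_pM => //.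
- by apply: le_trans (H 0%N); apply: bnorm_ge0; exact: ltW.
- by rewrite invr_ge0 exprn_ge0// ltW.
- by rewrite /M !le_max lexx orbT.
- rewrite -exprVn lerXn2r ?nnegrE ?invr_ge0 ?(ltW r0)//; first exact: le_trans M1.
  by rewrite /M !le_max lexx !orbT.
Qed.

Lemma geometricE C M f : 1 <= M -> (forall i j, nm (f i j) <= C * M ^+ (i + j)) -> geometric f.
Proof.
move=> M1 H; exists (Num.max C M); first by rewrite le_max M1 orbT.
move=> i j; apply: le_trans (H i j) _; rewrite exprS.
have M0 : 0 <= M by exact: le_trans M1.
have m0 : 0 <= Num.max C M by rewrite le_max M0 orbT.
apply: le_trans (_ : Num.max C M * M ^+ (i + j) <= _).
  by rewrite ler_wpM2r ?exprn_ge0// le_max lexx.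
by rewrite ler_wpM2l// lerXn2r ?nnegrE// le_max lexx orbT.
Qed.

End Bounded.

(** * Convergence of inverses and of quotients *)

Section ConvergentMaps.
Variables (R : realFieldType) (K : numFieldType) (nm : absval R K).
Implicit Types (f g h : fps2 K) (phi psi : fps2 K * fps2 K) (r s : R).
Local Notation bnorm := (bnorm nm).
Local Notation bd := (bd nm).

Definition trunc n f : fps2 K := Fps2 (fun i j => if (i + j < n)%N then f i j else 0).

Lemma truncE n f : ordge n (f - trunc n f).
Proof. by move=> i j ij; rewrite coef2D coef2N /= ij subrr. Qed.
Lemma trunc_ordge n d f : ordge d f -> ordge d (trunc n f).
Proof. by move=> df i j ij /=; case: ifP => _ //; exact: df. Qed.
Lemma trunc_eq n f g : ordge n (f - g) -> trunc n f = trunc n g.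
Proof.
by move=> fg; apply: fps2P => i j /=; case: ifP => // ij; rewrite (ordge_eq fg).
Qed.
Lemma truncB n f g : trunc n (f - g) = trunc n f - trunc n g.
Proof.
by apply: fps2P => i j; rewrite coef2D coef2N /=; case: ifP => _; rewrite ?subr0.
Qed.
Lemma bnorm_trunc r m n f : 0 <= r -> bnorm r m (trunc n f) <= bnorm r m f.
Proof.
move=> r0; apply: bnorm_le_coef => // i j _ _ /=.
by case: ifP => _ //; rewrite av0 av_ge0.
Qed.
Lemma bnorm_trunc_ge r m n f : 0 <= r -> (m + m <= n)%N ->
  bnorm r m f = bnorm r m (trunc n f).
Proof. by move=> r0; apply: bnorm_eqmod => //; exact: truncE. Qed.

(** Since [H] has order 2, the part of [H(k)] of degree at most [n + 1] depends only on the part of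
    [k] of degree at most [n]. Choosing [e] so that [H] is at most [e / 2] on the polydisc of radius
    [e], then [r] so that [k + H(k)] is at most [e / 2], the bound [e] propagates from one
    truncation of [k] to the next. *)
Lemma bd_inverse_tangent (H1 H2 : fps2 K) k : ordge 2 H1 -> ordge 2 H2 ->
  bd H1 -> bd H2 -> nct k ->
  bd (k.1 + fcomp H1 k) -> bd (k.2 + fcomp H2 k) -> bd k.1 /\ bd k.2.
Proof.
move=> o1 o2 b1 b2 kn c1 c2.
have half0 : 0 < 2^-1 :> R by rewrite invr_gt0.
have [t1 t10 T1] := bd_small (d := 1) b1 o1 half0.
have [t2 t20 T2] := bd_small (d := 1) b2 o2 half0.
set e := Num.min t1 t2; have e0 : 0 < e by rewrite lt_min t10.
have eh0 : 0 < 2^-1 * e by rewrite mulr_gt0.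
have oq f g : ordge 1 f -> ordge 2 g -> ordge 1 (f + fcomp g k).
  by move=> of1 og; apply: ordgeD => //; apply: fcomp_ordge => //; exact: ordge_le og.
have [r1 r10 R1] := bd_small (d := 0) c1 (oq _ _ kn.1 o1) eh0.
have [r2 r20 R2] := bd_small (d := 0) c2 (oq _ _ kn.2 o2) eh0.
set r := Num.min r1 r2; have r0 : 0 < r by rewrite lt_min r10.
have N n m : bnorm r m (trunc n k.1) <= e /\ bnorm r m (trunc n k.2) <= e.
  elim: n m => [|n IH] m.
    have z f : trunc 0 f = 0 by apply: fps2P.
    by rewrite !z bnorm0 ltW.
  case: n IH => [|n] IH.
    have z f : ordge 1 f -> trunc 1 f = 0.
      by move=> of1; apply: fps2P => i j /=; case: ifP => // ij; rewrite of1.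
    by rewrite !z ?bnorm0 ?(ltW e0)//; case: kn.
  set kt := (trunc n.+1 k.1, trunc n.+1 k.2).
  have ktn : nct kt by split; apply: trunc_ordge; case: kn.
  have step f g : ordge 2 g -> bnorm r m (f + fcomp g k) <= 2^-1 * e ->
      bnorm e (m + m) g <= 2^-1 * e -> bnorm r m (trunc n.+2 f) <= e.
    move=> og Hf Hg.
    have -> : trunc n.+2 f = trunc n.+2 (f + fcomp g k - fcomp g kt).
      apply: trunc_eq.
      have -> : f - (f + fcomp g k - fcomp g kt) = - (fcomp g k - fcomp g kt) by ring.
      apply: ordgeN; have := @fcomp_contract _ n.+1 2%N g k kt isT kn ktn
        (@truncE n.+1 k.1) (@truncE n.+1 k.2) og.
      by rewrite addn2 subn1.
    apply: le_trans (bnorm_trunc _ _ _ (ltW r0)) _.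
    apply: le_trans (bnormB _ (ltW r0) _ _ _) _.
    have -> : e = 2^-1 * e + 2^-1 * e by field.
    apply: lerD => //; apply: le_trans Hg; apply: bnorm_fcomp => //; first exact: ltW.
      by case: (IH m).
    by case: (IH m).
  split; apply: step => //.
  - exact: o1.
  - by rewrite -[_ * e]mulr1 -(expr0 r) R1// ge_min lexx.
  - by apply: le_trans (T1 e _ e0 _) _; rewrite ?ge_min ?lexx ?expr1.
  - exact: o2.
  - by rewrite -[_ * e]mulr1 -(expr0 r) R2// ge_min lexx orbT.
  - by apply: le_trans (T2 e _ e0 _) _; rewrite ?ge_min ?lexx ?orbT ?expr1.
split; exists r, e; split=> // m.
  by rewrite (bnorm_trunc_ge _ (ltW r0) (leqnn _)); case: (N (m + m)%N m).
by rewrite (bnorm_trunc_ge _ (ltW r0) (leqnn _)); case: (N (m + m)%N m).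
Qed.

Lemma bd_linmap M f g : bd f -> bd g -> bd (linmap M f g).1 /\ bd (linmap M f g).2.
Proof. by move=> bf bg; split; apply: bdD; exact: bdZ. Qed.

Lemma bd_varx : bd varx.
Proof.
apply: geometric_bd; apply: (geometricE (C := 1) (M := 1)) => // i j /=.
by rewrite expr1n mulr1; case: (_ && _); rewrite ?av0 ?av1.
Qed.
Lemma bd_vary : bd vary.
Proof.
apply: geometric_bd; apply: (geometricE (C := 1) (M := 1)) => // i j /=.
by rewrite expr1n mulr1; case: (_ && _); rewrite ?av0 ?av1.
Qed.

(** The inverse function theorem, for a formal [k]: dividing by the linear part of [G] reduces it to
    the case tangent to the identity. *)
Lemma bd_inverse G k : nct G -> linear_part G \in unitmx -> bd G.1 -> bd G.2 ->
  nct k -> bd (fcomp G.1 k) -> bd (fcomp G.2 k) -> bd k.1 /\ bd k.2.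
Proof.
move=> Gn Gu b1 b2 kn c1 c2; set L := linear_part G in Gu; set M := invmx L.
have [h1 h2] := linear_part_linmap Gn; rewrite -/L in h1 h2.
set h := (G.1 - (linmap L varx vary).1, G.2 - (linmap L varx vary).2).
pose H := linmap M h.1 h.2.
have HE : ((linmap M G.1 G.2).1 = varx + H.1) /\ ((linmap M G.1 G.2).2 = vary + H.2).
  have e : linmap M (linmap L varx vary).1 (linmap L varx vary).2 = (varx, vary).
    by rewrite linmapM mulVmx// linmap1.
  have e1 : (linmap M (linmap L varx vary).1 (linmap L varx vary).2).1 = varx by rewrite e.
  have e2 : (linmap M (linmap L varx vary).1 (linmap L varx vary).2).2 = vary by rewrite e.
  by split; [rewrite -{1}e1|rewrite -{1}e2]; rewrite /H /linmap /= !scalerBr; ring.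
have [x1 x2] := bd_linmap M b1 b2; rewrite HE.1 in x1; rewrite HE.2 in x2.
have [y1 y2] := bd_linmap M c1 c2.
have cM := fcomp_linmap M G.1 G.2 k.
apply: (@bd_inverse_tangent H.1 H.2) => //.
- by apply: ordgeD; exact: ordgeZ.
- by apply: ordgeD; exact: ordgeZ.
- by rewrite -[H.1](addKr varx) addrC; apply: bdB => //; exact: bd_varx.
- by rewrite -[H.2](addKr vary) addrC; apply: bdB => //; exact: bd_vary.
- rewrite -{1}(fcomp_varx kn) -fcompD -HE.1.
  by have -> : fcomp (linmap M G.1 G.2).1 k = (linmap M (fcomp G.1 k) (fcomp G.2 k)).1
    by exact: (congr1 (fun p : fps2 K * fps2 K => p.1) cM).
- rewrite -{1}(fcomp_vary kn) -fcompD -HE.2.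
  by have -> : fcomp (linmap M G.1 G.2).2 k = (linmap M (fcomp G.1 k) (fcomp G.2 k)).2
    by exact: (congr1 (fun p : fps2 K * fps2 K => p.2) cM).
Qed.

Lemma mx2_unit (M : 'M[K]_2) : M 0 0 * M 1 1 != M 0 1 * M 1 0 -> M \in unitmx.
Proof.
move=> d; rewrite unitmxE unitfE.
have o (i : 'I_1) : lift 0 i = 1 :> 'I_2 by apply: val_inj; case: i => [[]].
have l1 (i : 'I_1) : lift 1 i = 0 :> 'I_2 by apply: val_inj; case: i => [[]].
rewrite (expand_det_row _ 0) mx2_sum /cofactor !det_mx11 !mxE !o !l1 /=.
by rewrite expr0 mul1r expr1 mulN1r mulrN subr_eq0.
Qed.

Lemma bd_inverse1 v k : bd v -> v 0%N 0%N = 0 -> v 1%N 0%N != 0 -> ordge 1 k ->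
  bd (fcomp v (k, 0)) -> bd k.
Proof.
move=> bv v0 v1 ok bc; have kn : nct (k, 0) by split=> //; exact: ordge_zero.
have [] := @bd_inverse (v, vary) (k, 0) => //.
- by split; [exact/ordge1P|exact: ordge_vary].
- have [e1 e2 e3 e4] := linear_partE (v, vary).
  by apply: mx2_unit; rewrite e1 e2 e3 e4 /= mulr1 mulr0.
- exact: bd_vary.
- by rewrite fcomp_vary//; exact: bd0.
Qed.

Lemma coef_mulxy f i j :
  (varx * vary * f) i j = if (0 < i)%N && (0 < j)%N then f i.-1 j.-1 else 0.
Proof. by rewrite varxE varyE monoM coef2_monoM !subn1. Qed.

Lemma coef_trunc n f i j : trunc n f i j = if (i + j < n)%N then f i j else 0.
Proof. by []. Qed.

Lemma trunc_mulxy n f : trunc n.+2 (varx * vary * f) = varx * vary * trunc n f.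
Proof.
apply: fps2P => i j; rewrite coef_trunc !coef_mulxy coef_trunc.
by case: i j => [|i] [|j]; rewrite ?if_same//= addnS.
Qed.

Lemma bnorm_mulxy r m f : bnorm r m.+1 (varx * vary * f) = r ^+ 2 * bnorm r m f.
Proof.
rewrite /bnorm big_ord_recl big1 ?add0r => [|j _]; last first.
  by rewrite coef_mulxy av0 mul0r.
rewrite mulr_sumr; apply: eq_bigr => i _.
rewrite big_ord_recl coef_mulxy andbF av0 mul0r add0r mulr_sumr.
apply: eq_bigr => j _; rewrite coef_mulxy !lift0 /= mulrCA -exprD.
by congr (_ * r ^+ _); lia.
Qed.

Lemma bnorm_trunc_stable r m n f : (n <= m)%N ->
  bnorm r m.+1 (trunc n f) = bnorm r m (trunc n f).
Proof.
move=> nm'; rewrite /bnorm big_ord_recr /= [X in _ + X]big1 ?addr0 => [|j _]; last first.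
  by rewrite (_ : (m + j < n)%N = false) ?av0 ?mul0r//; lia.
apply: eq_bigr => i _; rewrite big_ord_recr /=.
by rewrite (_ : (i + m < n)%N = false) ?av0 ?mul0r ?addr0//; lia.
Qed.

(** With [H] the part of [Q] of order 3, [c x y C = P - H C]. At small radius [r] the norm of [H] is
    at most half of [|c| r^2], so the term [H C] is absorbed by the left-hand side. *)
Lemma bd_div (P Q C : fps2 K) c : P = Q * C -> c != 0 ->
  ordge 3 (Q - c *: (varx * vary)) -> bd P -> bd Q -> bd C.
Proof.
move=> PQ c0 Q3 bP bQ; set H := Q - _ in Q3.
have bH : bd H by apply: bdB => //; apply: bdZ; apply: bdM; [exact: bd_varx|exact: bd_vary].
have nc0 := av_gt0 nm c0.
have h0 : 0 < nm c / 2 by rewrite divr_gt0.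
have [s s0 S] := bd_small (d := 2) bH Q3 h0.
have [CP [t t0 T]] := bd_le bP.
set r := Num.min s t; have r0 : 0 < r by rewrite lt_min s0.
have rs : r <= s by rewrite ge_min lexx.
have rt : r <= t by rewrite ge_min lexx orbT.
exists r, (2 * CP / (nm c * r ^+ 2)); split=> // m.
rewrite (bnorm_trunc_ge _ (ltW r0) (leqnn _)); set n := (m + m)%N.
apply: le_trans (bnorm_mono _ (ltW r0) _ (leq_addr n m)) _; set M := (m + n)%N.
(* Truncating [C] equalises its norms over the squares of sides [M] and [M + 1], so one finite [B]
   occurs on both sides of the estimate. *)
set B := bnorm r M (trunc n C).
have Bxy : bnorm r M.+1 (varx * vary * trunc n C) = r ^+ 2 * B by exact: bnorm_mulxy.
have BM : bnorm r M.+1 (trunc n C) = B by apply: bnorm_trunc_stable; exact: leq_addl.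
have eq : trunc n.+2 (c *: (varx * vary * C)) = trunc n.+2 P - trunc n.+2 (H * trunc n C).
  rewrite -truncB; apply: trunc_eq.
  have -> : c *: (varx * vary * C) - (P - H * trunc n C) = - (H * (C - trunc n C)).
    by rewrite PQ /H (scalerAl c (varx * vary) C); ring.
  by apply: ordgeN; apply: (@ordge_le _ _ (3 + n)) => //; apply: ordgeM => //; exact: truncE.
have key : nm c * (r ^+ 2 * B) <= CP + nm c / 2 * r ^+ 2 * B.
  rewrite -Bxy -trunc_mulxy -bnormZ.
  have -> : c *: trunc n.+2 (varx * vary * C) = trunc n.+2 (c *: (varx * vary * C)).
    by apply: fps2P => i j; rewrite coef2Z /=; case: ifP => // _; rewrite mulr0.
  rewrite eq; apply: le_trans (bnormB _ (ltW r0) _ _ _) _; apply: lerD.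
    by apply: le_trans (bnorm_trunc _ _ _ (ltW r0)) _; exact: T.
  apply: le_trans (bnorm_trunc _ _ _ (ltW r0)) _.
  apply: le_trans (bnormM _ _ _ _ (ltW r0)) _; rewrite BM ler_wpM2r ?bnorm_ge0 ?(ltW r0)//.
  exact: S.
rewrite ler_pdivlMr; last by rewrite mulr_gt0// exprn_gt0.
have -> : B * (nm c * r ^+ 2) = 2 * (nm c * (r ^+ 2 * B) - nm c / 2 * r ^+ 2 * B) by field.
by rewrite ler_wpM2l// lerBlDr.
Qed.

End ConvergentMaps.

(** * Formal curves inside a convergent node *)

Section ConvergentCurves.
Variables (R : realFieldType) (K : numFieldType) (nm : absval R K).
Implicit Types (f g h : fps2 K) (phi psi : fps2 K * fps2 K) (r s : R).
Local Notation bd := (bd nm).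

Lemma natr_le_expr2 n : n%:R <= 2 ^+ n :> R.
Proof. by rewrite -natrX ler_nat ltnW// ltn_expl. Qed.

Lemma bd_coef_le f g c : bd f -> 1 <= c ->
  (forall i j, exists i' j', [/\ (i' + j' <= (i + j).+1)%N &
     nm (g i j) <= c ^+ (i + j).+1 * nm (f i' j')]) -> bd g.
Proof.
move=> /bd_geometric[M M1 H] c1 gf; apply: geometric_bd.
exists (c * M ^+ 2); first by rewrite mulr_ege1// exprn_ege1.
move=> i j; have [i' [j' [ij gle]]] := gf i j; apply: le_trans gle _.
rewrite exprMn -exprM ler_wpM2l ?exprn_ge0 ?(le_trans _ c1)//.
by apply: le_trans (H i' j') _; rewrite ler_weXn2l//; lia.
Qed.

Lemma bd_dx f : bd f -> bd (dx f).
Proof.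
move=> bf; apply: (bd_coef_le (c := 2) bf); first by rewrite ler1n.
move=> i j; exists i.+1, j; rewrite addSn; split=> //=.
rewrite avM av_natr ler_wpM2r ?av_ge0//.
by apply: le_trans (natr_le_expr2 _) _; rewrite ler_weXn2l ?ler1n//; lia.
Qed.
Lemma bd_dy f : bd f -> bd (dy f).
Proof.
move=> bf; apply: (bd_coef_le (c := 2) bf); first by rewrite ler1n.
move=> i j; exists i, j.+1; rewrite addnS; split=> //=.
rewrite avM av_natr ler_wpM2r ?av_ge0//.
by apply: le_trans (natr_le_expr2 _) _; rewrite ler_weXn2l ?ler1n//; lia.
Qed.
Lemma bd_shx f : bd f -> bd (shx f).
Proof.
move=> bf; apply: (bd_coef_le (c := 1) bf) => // i j; exists i.+1, j.
by rewrite addSn expr1n mul1r.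
Qed.
Lemma bd_expser : bd expser.
Proof.
apply: geometric_bd; apply: (geometricE (C := 1) (M := 1)) => // i j /=.
rewrite expr1n mulr1; case: ifP => _; rewrite ?av0// /invfact avV av_natr.
by rewrite invf_le1 ?ltr0n ?fact_gt0// ler1n fact_gt0.
Qed.

Definition blowup : fps2 K * fps2 K := (varx, varx * vary).

Lemma nct_blowup : nct blowup.
Proof. by split; [exact: ordge_varx|apply: ordgeMl; exact: ordge_varx]. Qed.

Lemma fcomp_blowup f i j :
  fcomp f blowup i j = if (j <= i)%N then f (i - j)%N j else 0.
Proof.
pose L f : fps2 K := Fps2 (fun i j => if (j <= i)%N then f (i - j)%N j else 0).
suff : fcomp f blowup = L f by move=> ->.
move: f; apply: clin_ext => [||a b]; first exact: fcomp_clin nct_blowup.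
  split=> [a f g|]; first by apply: fps2P => k l; rewrite coef2D coef2Z /=; case: ifP => _; rewrite ?mulr0 ?addr0.
  by exists 0%N => n f nf k l kl /=; case: ifP => // lk; rewrite nf//; lia.
rewrite fcomp_mono; last exact: nct_blowup.
rewrite /= exprMn mulrA -exprD -monoE; apply: fps2P => k l /=.
rewrite (_ : _ && _ = (l <= k)%N && ((k - l == a)%N && (l == b))); last by lia.
by case: ifP.
Qed.

(** In the chart [(x, x y)] one has [Q = x^2 q], and [q] has the nonzero coefficient [c] in [y].
    Hence [(E, q)] is a local diffeomorphism upstairs; it sends the lifted curve to [(E(phi), 0)],
    which converges, so the lift converges as well. *)
Lemma bd_axis_curve (Q E : fps2 K) c phi : c != 0 ->
  ordge 3 (Q - c *: (varx * vary)) -> E 0%N 0%N = 0 -> E 1%N 0%N != 0 ->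
  bd Q -> bd E -> xonly phi.1 -> xonly phi.2 ->
  ordge 2 (phi.1 - varx) -> ordge 2 phi.2 ->
  fcomp Q phi = 0 -> bd (fcomp E phi) -> bd phi.1 /\ bd phi.2.
Proof.
move=> c0 Q3 E0 E1 bQ bE x1 x2 o1 o2 Qphi Ephi.
have Qc i j : (i + j < 3)%N -> Q i j = c * ((i == 1%N) && (j == 1%N))%:R.
  by move=> ij; rewrite (ordge_eq Q3 ij) coef2Z varxE varyE monoM.
have sx v : xonly v -> v 0%N 0%N = 0 -> v = varx * shx v.
  move=> xv v0; apply: fps2P => i j; rewrite coef_varxM /=.
  by case: i j => [|i] [|j] //=; rewrite xv.
set h1 := shx phi.1; set h2 := shx phi.2.
have p1 : phi.1 = varx * h1 by apply: sx => //; rewrite (ordge_eq o1).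
have p2 : phi.2 = varx * h2 by apply: sx => //; exact: o2.
have h10 : h1 0%N 0%N = 1 by rewrite /= (ordge_eq o1).
have oh2 : ordge 1 h2 by move=> i j ij /=; apply: o2; rewrite addSn.
have [V hV] : exists V, h1 * V = 1 by apply: fps2_inv; rewrite h10 oner_eq0.
(* [u = phi.2 / phi.1] is the second coordinate of the lifted curve; [phi.1] is [x] times a unit. *)
pose u := h2 * V; pose k := (phi.1, u).
have ou : ordge 1 u by exact: ordgeMl.
have kn : nct k.
  by split=> //=; rewrite p1; apply: ordgeMl; exact: ordge_varx.
have pk : phi = pcomp blowup k.
  rewrite /pcomp /= fcompM// fcomp_varx// fcomp_vary//= [LHS]surjective_pairing.
  congr pair; rewrite p2 p1 /u.
  have -> : varx * h1 * (h2 * V) = varx * h2 * (h1 * V) by ring.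
  by rewrite hV mulr1.
have bn := nct_blowup.
pose q := shx (shx (fcomp Q blowup)).
have qE : fcomp Q blowup = varx * (varx * q).
  apply: fps2P => i j; rewrite !coef_varxM.
  case: i => [|[|i]]//; rewrite fcomp_blowup /=.
    by case: j => [|j] //; rewrite Qc//= mulr0.
  by case: j => [|[|j]] //; rewrite Qc//= mulr0.
have qk : fcomp q k = 0.
  have : fcomp (fcomp Q blowup) k = 0 by rewrite fcompA// -pk.
  rewrite qE !fcompM// fcomp_varx//= p1 -!mulrA => /varx_inj e.
  have : varx * fcomp q k = 0.
    have -> : varx * fcomp q k = (h1 * V) ^+ 2 * (varx * fcomp q k).
      by rewrite hV expr1n mul1r.
    by rewrite -[RHS](mulr0 (V ^+ 2)) -e; ring.
  exact: varx_inj.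
have bb : bd blowup.1 /\ bd blowup.2.
  by split; [exact: bd_varx|apply: bdM; [exact: bd_varx|exact: bd_vary]].
set Eb := fcomp E blowup.
have q00 : q 0%N 0%N = 0.
  rewrite -[LHS]/(fcomp Q blowup 2%N 0%N) fcomp_blowup.
  by rewrite Qc//= mulr0.
have q01 : q 0%N 1%N = c.
  rewrite -[LHS]/(fcomp Q blowup 2%N 1%N) fcomp_blowup.
  by rewrite Qc//= mulr1.
have Eb00 : Eb 0%N 0%N = 0 by rewrite /Eb fcomp_blowup.
have Eb10 : Eb 1%N 0%N = E 1%N 0%N by rewrite /Eb fcomp_blowup.
have Eb01 : Eb 0%N 1%N = 0 by rewrite /Eb fcomp_blowup.
have bEb : bd Eb by apply: bd_fcomp => //; case: bb.
have bq : bd q by do 2!apply: bd_shx; apply: bd_fcomp => //; case: bb.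
have Ek : bd (fcomp Eb k) by rewrite /Eb (fcompA E bn kn) -pk.
have bqk : bd (fcomp q k) by rewrite qk; exact: bd0.
clearbody q Eb.
have Gn : nct (Eb, q) by split; apply/ordge1P.
have Gu : linear_part (Eb, q) \in unitmx.
  have [e1 e2 e3 e4] := linear_partE (Eb, q).
  by apply: mx2_unit; rewrite e1 e2 e3 e4 /= Eb10 Eb01 q01 mul0r mulf_neq0.
have [b1 b2] := bd_inverse Gn Gu bEb bq kn Ek bqk.
split=> //; rewrite pk /pcomp [snd _]/= fcompM// fcomp_varx// fcomp_vary//.
exact: bdM.
Qed.

End ConvergentCurves.

(** * First integral of a convergent slope field *)

Section FirstIntegral.
Variables (R : realFieldType) (K : numFieldType) (nm : absval R K).
Implicit Types (f g h : fps2 K) (phi psi : fps2 K * fps2 K) (r s : R).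
Local Notation bnorm := (bnorm nm).
Local Notation bd := (bd nm).

Variable C : fps2 K.

(** Picard operator of the equation [F = x + picard F]. The derivative in [x] may undo the gain of
    the integration in total order, since [C] may be a unit; only the order in [y] is sure to
    increase, so the iteration converges [y]-adically. *)
Let picard f := - integ (C * dx f).

Lemma picard_yorder k f : (forall i j, (j < k)%N -> f i j = 0) ->
  forall i j, (j < k.+1)%N -> picard f i j = 0.
Proof.
move=> kf i [|j] jk; rewrite /picard coef2N /= ?oppr0//.
rewrite big1 ?mulr0 ?oppr0// => a _; rewrite big1// => l _.
by rewrite /= kf ?mulr0//; lia.
Qed.

Lemma first_integral_exists :
  exists2 F, dy F = - (C * dx F) & forall i, F i 0%N = (i == 1%N)%:R.
Proof.
pose F : fps2 K := Fps2 (fun i j => \sum_(k < j.+1) iter k picard varx i j).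
have yo k i j : (j < k)%N -> iter k picard varx i j = 0.
  elim: k i j => // k IH i j jk; exact: (picard_yorder IH).
have FE M i j : (j < M)%N -> F i j = \sum_(k < M) iter k picard varx i j.
  move=> jM; rewrite /= (big_ord_widen M (fun k => iter k picard varx i j) jM).
  rewrite [RHS](bigID (fun k : 'I_M => k < j.+1)%N)/= [X in _ + X]big1 ?addr0// => k.
  by rewrite -leqNgt => jk; exact: yo.
exists F; last by move=> i; rewrite /= big_ord1 /= andbT.
apply: fps2P => i j; rewrite coef2N coef2M.
have -> : dy F i j = j.+1%:R * F i j.+1 by [].
have nj : j.+1%:R != 0 :> K by rewrite pnatr_eq0.
have -> : F i j.+1 = \sum_(k < j.+1) picard (iter k picard varx) i j.+1.
  by rewrite /= big_ord_recl /= andbF add0r.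
transitivity (- \sum_(k < j.+1) (C * dx (iter k picard varx)) i j).
  rewrite mulr_sumr -sumrN; apply: eq_bigr => k _.
  by rewrite /picard coef2N mulrN [integ _ _ _]/= mulrA divff// mul1r.
congr (- _); under eq_bigr do rewrite coef2M.
rewrite exchange_big; apply: eq_bigr => a _; rewrite exchange_big; apply: eq_bigr => l _.
have -> : dx F (i - a)%N (j - l)%N = (i - a).+1%:R * F (i - a).+1 (j - l)%N by [].
rewrite (FE j.+1) ?ltnS ?leq_subr// -mulr_sumr; congr (_ * _).
by rewrite -mulr_sumr.
Qed.

Lemma bin_le_expn2 n k : ('C(n, k) <= 2 ^ n)%N.
Proof.
elim: n k => [[|k]//|n IH] [|k]; first by rewrite bin0 expn_gt0.
by rewrite binS expnS mul2n -addnn leq_add.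
Qed.

Lemma rect_le_bnorm r f i j : 0 <= r ->
  \sum_(k < i.+1) \sum_(l < j.+1) nm (f k l) * r ^+ (k + l) <= bnorm r (i + j).+1 f.
Proof.
move=> r0; have t0 a b : 0 <= nm (f a b) * r ^+ (a + b) by rewrite mulr_ge0 ?av_ge0 ?exprn_ge0.
have ij : (i.+1 <= (i + j).+1)%N by lia.
have ji : (j.+1 <= (i + j).+1)%N by lia.
rewrite (big_ord_widen _ (fun k => \sum_(l < j.+1) nm (f k l) * r ^+ (k + l)) ij).
apply: le_trans (_ : \sum_(k < (i + j).+1) \sum_(l < j.+1) nm (f k l) * r ^+ (k + l) <= _).
  rewrite [leRHS](bigID (fun k : 'I__ => k < i.+1)%N)/= lerDl.
  by apply: sumr_ge0 => k _; apply: sumr_ge0.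
apply: ler_sum => k _; rewrite (big_ord_widen _ (fun l => nm (f k l) * r ^+ (k + l)) ji).
by rewrite [leRHS](bigID (fun l : 'I__ => l < j.+1)%N)/= lerDl sumr_ge0.
Qed.

(* Cauchy-Kovalevskaya: after rescaling, [binomial(i+j, j)] is a majorant,
   since [(p+1) binomial(p+1+q, q) = (q+1) binomial(p+1+q, q+1)]. *)
Lemma bd_first_integral F : bd C -> dy F = - (C * dx F) ->
  (forall i, F i 0%N = (i == 1%N)%:R) -> bd F.
Proof.
move=> /bd_le[K0 [s s0 HC]] FE F0.
set r := Num.min s 1; have r0 : 0 < r by rewrite lt_min s0 ltr01.
have r1 : r <= 1 by rewrite ge_min lexx orbT.
have rs : r <= s by rewrite ge_min lexx.
set Kp := Num.max K0 1; have Kp1 : 1 <= Kp by rewrite le_max lexx orbT.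
have Kp0 : 0 < Kp by exact: lt_le_trans Kp1.
(* In the recursion a derivative in [x] costs [1 / r] and an integration in [y] gains [t]; the ratio
   [t / r = 1 / Kp] absorbs the norm of [C]. *)
set t := r / Kp; have t0 : 0 < t by rewrite divr_gt0.
have tr : t <= r by rewrite ler_pdivrMr// ler_peMr// ltW.
have main j i : nm (F i j) * (r ^+ i * t ^+ j) <= 'C(i + j, j)%:R.
  elim/ltn_ind: j i => -[|j] IH i.
    rewrite F0 addn0 bin0 expr0 mulr1; case: (i == 1%N); last by rewrite av0 mul0r.
    by rewrite av1 mul1r exprn_ile1// ltW.
  have nj : 0 < j.+1%:R :> R by rewrite ltr0n.
  rewrite -(ler_pM2l nj).
  have Fj : j.+1%:R * nm (F i j.+1) = nm ((C * dx F) i j).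
    by rewrite -(av_natr nm) -avM -[_ * _]/(dy F i j) FE coef2N avN.
  rewrite mulrA Fj coef2M; apply: le_trans (ler_wpM2r _ (av_sum _ _ _ _)) _.
    by rewrite mulr_ge0// exprn_ge0 ?ltW.
  apply: le_trans (_ : \sum_(k < i.+1) \sum_(l < j.+1)
      (nm (C k l) * r ^+ (k + l)) * (Kp^-1 * (j.+1%:R * 'C(i + j.+1, j.+1)%:R)) <= _); last first.
    set Z := _ * 'C(_, _)%:R; have Z0 : 0 <= Z by rewrite mulr_ge0.
    under eq_bigr do rewrite -mulr_suml.
    rewrite -mulr_suml mulrA -[leRHS]mul1r ler_wpM2r//.
    rewrite ler_pdivrMr// mul1r; apply: le_trans (rect_le_bnorm _ _ _ (ltW r0)) _.
    by apply: le_trans (HC r _ r0 rs) _; rewrite le_max lexx.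
  rewrite mulr_suml; apply: ler_sum => k _.
  apply: le_trans (ler_wpM2r _ (av_sum _ _ _ _)) _.
    by rewrite mulr_ge0// exprn_ge0 ?ltW.
  rewrite mulr_suml; apply: ler_sum => l _.
  have ki : (k <= i)%N by rewrite -ltnS.
  have lj : (l <= j)%N by rewrite -ltnS.
  have -> : dx F (i - k)%N (j - l)%N = (i - k).+1%:R * F (i - k).+1 (j - l)%N by [].
  rewrite !avM av_natr; set p := (i - k)%N; set q := (j - l)%N.
  have iE : i = (k + p)%N by rewrite subnKC.
  have jE : j = (l + q)%N by rewrite subnKC.
  have IHq := IH q (_ : (q < j.+1)%N) p.+1; rewrite ltnS leq_subr in IHq.
  have {}IHq := IHq isT.
  have -> : nm (C k l) * (p.+1%:R * nm (F p.+1 q)) * (r ^+ i * t ^+ j.+1) =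
      (nm (C k l) * (r ^+ k * t ^+ l)) * (t / r) *
      (p.+1%:R * (nm (F p.+1 q) * (r ^+ p.+1 * t ^+ q))).
    have -> : r ^+ i = r ^+ k * r ^+ p by rewrite -exprD -iE.
    have -> : t ^+ j.+1 = t ^+ l * t ^+ q * t by rewrite exprSr -exprD -jE.
    rewrite [r ^+ p.+1]exprS; have := lt0r_neq0 r0.
    by move: (r) (t) => r' t' r'0; field.
  have tr' : t / r = Kp^-1 by rewrite /t mulrAC divff ?mul1r// lt0r_neq0.
  rewrite tr' -mulrA; apply: ler_pM.
  - by rewrite mulr_ge0 ?av_ge0// mulr_ge0 ?exprn_ge0 ?ltW.
  - rewrite mulr_ge0 ?invr_ge0 ?(ltW Kp0)// mulr_ge0// mulr_ge0 ?av_ge0//.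
    by rewrite mulr_ge0 ?exprn_ge0 ?ltW.
  - rewrite ler_wpM2l ?av_ge0// exprD ler_wpM2l ?exprn_ge0 ?(ltW r0)//.
    by rewrite lerXn2r ?nnegrE ?(ltW t0) ?(ltW r0).
  rewrite ler_wpM2l ?invr_ge0 ?(ltW Kp0)//.
  apply: le_trans (ler_wpM2l _ IHq) _ => //; rewrite -!natrM ler_nat.
  have -> : (p.+1 * 'C(p.+1 + q, q) = q.+1 * 'C(p.+1 + q, q.+1))%N.
    by rewrite mul_bin_left addnK.
  apply: leq_mul; first by rewrite ltnS leq_subr.
  apply: (@leq_trans 'C(i + q.+1, q.+1)).
    by rewrite addSnnS leq_bin2l// leq_add2r leq_subr.
  rewrite -[X in (X <= _)%N]bin_sub ?leq_addl// -[X in (_ <= X)%N]bin_sub ?leq_addl//.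
  by rewrite !addnK leq_bin2l// leq_add2l ltnS leq_subr.
apply: geometric_bd; apply: (geometricE (C := 1) (M := 2 / t)).
  rewrite ler_pdivlMr// mul1r; apply: le_trans tr _; apply: le_trans r1 _.
  by rewrite ler1n.
move=> i j; rewrite mul1r expr_div_n ler_pdivlMr ?exprn_gt0//.
apply: le_trans (_ : nm (F i j) * (r ^+ i * t ^+ j) <= _).
  rewrite ler_wpM2l ?av_ge0// exprD ler_wpM2r ?exprn_ge0 ?(ltW t0)//.
  by rewrite lerXn2r ?nnegrE ?(ltW t0) ?(ltW r0).
by apply: le_trans (main j i) _; rewrite -natrX ler_nat bin_le_expn2.
Qed.

End FirstIntegral.

(** * Convergence of the transported first integral on the fixed curves *)

Section TransportConvergent.
Variables (R : realFieldType) (K : numFieldType) (nm : absval R K).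
Implicit Types (f g h : fps2 K) (phi psi : fps2 K * fps2 K) (r s : R).
Local Notation bd := (bd nm).

Variables (X : fps2 K -> fps2 K) (a b : fps2 K) (w0 : K).
Hypotheses (dX : derivation X).
Hypotheses (X0 : forall g, fcomp (X g) onx = 0) (X1 : forall g, fcomp (X g) ond = 0).
Hypotheses (Xx : X varx = yyx * a) (Xy : X vary = yyx * b).
Hypotheses (a00 : a 0%N 0%N = 0) (b00 : b 0%N 0%N = w0) (w0N : w0 != 0).
Variables sigma tau : fps2 K * fps2 K.
Hypotheses (sn : nct sigma) (tn : nct tau).
Hypotheses (st : pcomp sigma tau = (varx, vary)) (ts : pcomp tau sigma = (varx, vary)).
Hypotheses (s1 : ordge 2 (sigma.1 - (varx - vary))) (s2 : ordge 2 (sigma.2 - vary)).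
Variables P Q : fps2 K.
Hypotheses (PE : fcomp P sigma = X sigma.1) (QE : fcomp Q sigma = X sigma.2).
Hypotheses (bP : bd P) (bQ : bd Q).
Hypotheses (b0 : bd (fcomp ((vary - varx) * b) onx)) (b1 : bd (fcomp (vary * (b - a)) ond)).

Lemma xonly_fcomp_onx f : xonly (fcomp f onx).
Proof. by rewrite fcomp_onx; exact: xonly_res0. Qed.
Lemma xonly_fcomp_ond f : xonly (fcomp f ond).
Proof. by rewrite fcomp_ond; exact: xonly_diag. Qed.

Lemma transport_convergent : exists g, [/\ X g = 0, g 0%N 0%N = 0,
  g 1%N 0%N != 0, bd (fcomp g onx) & bd (fcomp g ond)].
Proof.
have [C PQ C00] := transport_slope dX Xx Xy a00 b00 w0N sn tn st ts s1 s2 PE QE.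
have Q3 := transport_leading dX Xx Xy a00 b00 sn tn st ts s1 s2 QE.
have w0N' : - w0 != 0 by rewrite oppr_eq0.
have bC := bd_div PQ w0N' Q3 bP bQ.
have [F FE F0] := first_integral_exists C.
have bF := bd_first_integral bC FE F0.
pose E := C * dx Q + dy Q.
have bE : bd E by apply: bdD; [apply: bdM => //; exact: bd_dx|exact: bd_dy].
have Qc i j : (i + j < 3)%N -> Q i j = - w0 * ((i == 1%N) && (j == 1%N))%:R.
  by move=> ij; rewrite (ordge_eq Q3 ij) coef2Z varxE varyE monoM.
have oQx : ordge 1 (dx Q).
  by apply/ordge1P; rewrite /= Qc// mulr0 mulr0.
(* Thus [E = w0 (y - x) + ...] has a nonzero linear term along either axis. *)
have [E00 E10 E01] : [/\ E 0%N 0%N = 0, E 1%N 0%N = - w0 & E 0%N 1%N = w0].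
  rewrite /E !coef2D !coef2M !big_ord_recl !big_ord0 /=.
  rewrite /bump /= !(Qc 0%N 1%N, Qc 1%N 0%N, Qc 2%N 0%N, Qc 1%N 1%N, Qc 0%N 2%N)//=.
  by rewrite C00 !(mulr0, mulr1, addr0, add0r, mul1r); split=> //; rewrite mulN1r opprK.
have [c0 c1] := transport_cofactor dX X0 X1 Xx Xy a00 b00 w0N sn s2 PE QE PQ.
have bE0 : bd (fcomp (fcomp E sigma) onx) by rewrite c0.
have bE1 : bd (fcomp (fcomp E sigma) ond) by rewrite c1.
clear c0 c1; clearbody E.
have n0 := nct_onx K; have n1 := nct_ond K.
exists (fcomp F sigma); split.
- exact: (transport_first_integral dX sn PE QE PQ FE).
- by rewrite fcomp_const F0.
- rewrite fcomp_coef10// F0 mul1r (ordge_eq s1)// (ordge_eq s2)//=.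
  by rewrite subr0 mulr0 addr0 oner_eq0.
- have E10' : E 1%N 0%N != 0 by rewrite E10.
  have o1 : ordge 2 (fcomp sigma.1 onx - varx).
    have : ordge 2 (fcomp (sigma.1 - (varx - vary)) onx) by exact: fcomp_ordge.
    by rewrite !fcompB fcomp_varx// fcomp_vary//= subr0.
  have o2 : ordge 2 (fcomp sigma.2 onx).
    have : ordge 2 (fcomp (sigma.2 - vary) onx) by exact: fcomp_ordge.
    by rewrite fcompB fcomp_vary//= subr0.
  have Q0 : fcomp Q (pcomp sigma onx) = 0 by rewrite -(fcompA Q sn n0) QE X0.
  have Eb : bd (fcomp E (pcomp sigma onx)) by rewrite -(fcompA E sn n0).
  have [p1 p2] := @bd_axis_curve _ _ nm Q E (- w0) (pcomp sigma onx) w0N' Q3 E00 E10'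
    bQ bE (@xonly_fcomp_onx sigma.1) (@xonly_fcomp_onx sigma.2) o1 o2 Q0 Eb.
  by rewrite (fcompA F sn n0); apply: bd_fcomp => //; exact: nct_pcomp.
(* The image of [y = x] is tangent to the [y]-axis; exchanging the coordinates of the target reduces
   it to the case of the [x]-axis. *)
- pose swap f : fps2 K := fcomp f (vary, varx).
  have sw : nct (vary, varx : fps2 K) by split; [exact: ordge_vary|exact: ordge_varx].
  have swc f phi : nct phi -> fcomp (swap f) phi = fcomp f (phi.2, phi.1).
    move=> pn; rewrite /swap (fcompA f sw pn) /pcomp; congr (fcomp f _).
    by congr pair; [exact: fcomp_vary|exact: fcomp_varx].
  have bsw f : bd f -> bd (swap f).
    by move=> bf; apply: bd_fcomp => //; [exact: bd_vary|exact: bd_varx].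
  have sig1 : nct (pcomp sigma ond) by exact: nct_pcomp.
  pose rho := ((pcomp sigma ond).2, (pcomp sigma ond).1).
  have rn : nct rho by case: sig1.
  have Q3' : ordge 3 (swap Q - - w0 *: (varx * vary)).
    have : ordge 3 (swap (Q - - w0 *: (varx * vary))) by exact: fcomp_ordge.
    by rewrite /swap fcompB fcompZ fcompM// fcomp_varx// fcomp_vary//= [vary * varx]mulrC.
  have E00' : swap E 0%N 0%N = 0 by rewrite /swap fcomp_const.
  have E10' : swap E 1%N 0%N != 0.
    by rewrite /swap fcomp_coef10//= E01 E10 mulr0 add0r mulr1.
  have o1 : ordge 2 (fcomp sigma.2 ond - varx).
    have : ordge 2 (fcomp (sigma.2 - vary) ond) by exact: fcomp_ordge.
    by rewrite fcompB fcomp_vary.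
  have o2 : ordge 2 (fcomp sigma.1 ond).
    have : ordge 2 (fcomp (sigma.1 - (varx - vary)) ond) by exact: fcomp_ordge.
    by rewrite !fcompB fcomp_varx// fcomp_vary//= subrr subr0.
  have Q0 : fcomp (swap Q) rho = 0.
    by rewrite (swc _ _ rn) -[(_, _)]/(pcomp sigma ond) -(fcompA Q sn n1) QE X1.
  have Eb : bd (fcomp (swap E) rho).
    by rewrite (swc _ _ rn) -[(_, _)]/(pcomp sigma ond) -(fcompA E sn n1).
  have [p1 p2] := @bd_axis_curve _ _ nm (swap Q) (swap E) (- w0) rho w0N' Q3' E00' E10'
    (bsw _ bQ) (bsw _ bE) (@xonly_fcomp_ond sigma.2) (@xonly_fcomp_ond sigma.1) o1 o2 Q0 Eb.
  by rewrite (fcompA F sn n1); apply: bd_fcomp.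
Qed.

End TransportConvergent.

(** * Families of polynomials *)

Section Newton.
Variable K : numFieldType.
Implicit Types (f : nat -> K) (p : {poly K}).

Definition fdiff j f := iter j (fun h n => h n.+1 - h n) f.

Lemma fdiff_shift j f n : fdiff j (fun k => f k.+1) n = fdiff j f n.+1.
Proof.
elim: j n => // j IH n; by rewrite /fdiff !iterS -/(fdiff j _) -/(fdiff j f) !IH.
Qed.
Lemma fdiffS j f n : fdiff j.+1 f n = fdiff j f n.+1 - fdiff j f n.
Proof. by []. Qed.

Lemma newton_nat f k N : (k <= N)%N ->
  f k = \sum_(j < N.+1) fdiff j f 0%N * 'C(k, j)%:R.
Proof.
elim: k f N => [|k IH] f N kN.
  rewrite big_ord_recl big1 ?addr0 /= ?mulr1// => j _.
  by rewrite bin_small// mulr0.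
case: N kN => // N kN; have {}kN : (k <= N)%N by [].
rewrite (IH (fun k => f k.+1) N kN).
under eq_bigr => j _ do rewrite fdiff_shift -[fdiff j f 1](subrK (fdiff j f 0%N)) -fdiffS mulrDl.
rewrite big_split /= [RHS]big_ord_recl /=.
under [X in _ = _ + X]eq_bigr => j _ do rewrite binS natrD mulrDr.
rewrite big_split /= [X in _ = _ + X]addrC addrCA; congr (_ + _).
rewrite big_ord_recl /= !bin0; congr (_ + _).
by rewrite [RHS]big_ord_recr /= bin_small ?mulr0 ?addr0// ltnS.
Qed.

Variables a h : K.
Hypothesis h0 : h != 0.

(** The polynomial [binomial((X - a) / h, j)]. *)
Definition newton_basis j : {poly K} :=
  (invfact K j * h ^- j) *: \prod_(i < j) ('X - (a + h * i%:R)%:P).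

Lemma size_newton_basis j : (size (newton_basis j) <= j.+1)%N.
Proof.
apply: leq_trans (size_scale_leq _ _) _; rewrite -big_enum.
by rewrite size_prod_XsubC size_enum_ord.
Qed.

Lemma horner_newton_basis j x : (newton_basis j).[x] =
  invfact K j * h ^- j * \prod_(i < j) (x - (a + h * i%:R)).
Proof.
rewrite hornerZ horner_prod; congr (_ * _); apply: eq_bigr => i _.
by rewrite hornerXsubC.
Qed.

Lemma newton_basis_node j k : (newton_basis j).[a + h * k%:R] = 'C(k, j)%:R.
Proof.
have jf : j`!%:R != 0 :> K by rewrite pnatr_eq0 -lt0n fact_gt0.
rewrite horner_newton_basis.
have -> : \prod_(i < j) (a + h * k%:R - (a + h * i%:R)) =
    h ^+ j * \prod_(i < j) (k%:R - i%:R).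
  rewrite -[X in h ^+ X](card_ord j) -prodr_const -big_split.
  by apply: eq_bigr => i _ /=; ring.
rewrite -mulrA mulKf ?expf_neq0// /invfact; apply: (mulfI jf); rewrite mulrA divff// mul1r.
rewrite -natrM mulnC bin_ffact ffact_prod natr_prod.
have [kj|jk] := ltnP k j.
  rewrite (bigD1 (Ordinal kj))//= subrr mul0r.
  by rewrite [RHS](bigD1 (Ordinal kj))//= subnn mul0r.
by apply: eq_bigr => i _; rewrite natrB// ltnW// (leq_trans (ltn_ord i)).
Qed.

Lemma newton_poly p n : (size p <= n.+1)%N ->
  p = \sum_(j < n.+1) fdiff j (fun k => p.[a + h * k%:R]) 0%N *: newton_basis j.
Proof.
move=> pn; apply/eqP; rewrite -subr_eq0; set q := _ - _; apply/eqP.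
have sq : (size q <= n.+1)%N.
  apply: leq_trans (size_polyD _ _) _; rewrite geq_max pn size_polyN.
  apply: size_sum_le => j _; apply: leq_trans (size_scale_leq _ _) _.
  exact: leq_trans (size_newton_basis j) _.
apply: (@roots_geq_poly_eq0 _ q [seq a + h * i%:R | i <- iota 0 n.+1]).
- apply/allP => x /mapP[k]; rewrite mem_iota add0n => /andP[_ kn] ->.
  rewrite rootE /q hornerD hornerN horner_sum subr_eq0; apply/eqP.
  rewrite [LHS](newton_nat (fun k => p.[a + h * k%:R]) (_ : (k <= n)%N))//.
  by apply: eq_bigr => j _; rewrite hornerZ newton_basis_node.
- rewrite map_inj_in_uniq ?iota_uniq// => b c _ _ /addrI/(mulfI h0)/eqP.
  by rewrite eqr_nat => /eqP.
- by rewrite size_map size_iota.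
Qed.

End Newton.

Section PolyBound.
Variables (R : realFieldType) (K : numFieldType) (nm : absval R K).

Lemma fdiff_le f B j m : (forall i, (i <= m + j)%N -> nm (f i) <= B) ->
  nm (fdiff j f m) <= 2 ^+ j * B.
Proof.
elim: j m => [|j IH] m fB; first by rewrite expr0 mul1r; apply: fB; rewrite addn0.
rewrite fdiffS exprS -mulrA mulr_natl mulr2n.
apply: le_trans (avD _ _ _) _; rewrite avN; apply: lerD; apply: IH => i ij; apply: fB; lia.
Qed.

(** [n^j] is at most the falling factorial of [n + j], that is [j! binomial(n + j, j)]. This
    controls the factor [h^-j / j!] of the Newton basis when [h = L / n]. *)
Lemma expn_le_fact n j : (j <= n)%N -> (n ^ j <= j`! * 4 ^ n)%N.
Proof.
move=> jn; apply: (@leq_trans ((n + j) ^_ j)).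
  rewrite ffact_prod -[X in (n ^ X)%N](card_ord j) -prod_nat_const.
  by apply: leq_prod => i _; have := ltn_ord i; lia.
rewrite -bin_ffact mulnC leq_mul2l; apply/orP; right.
apply: leq_trans (bin_le_expn2 _ _) _; rewrite -[4%N]/(2 ^ 2)%N -expnM leq_exp2l//; lia.
Qed.

Lemma coef_prod_linear_le (c : R) (s : nat -> K) j k : 0 <= c ->
  (forall i, (i < j)%N -> nm (s i) + 1 <= c) ->
  nm (\prod_(i < j) ('X - (s i)%:P))`_k <= c ^+ j.
Proof.
move=> c0; elim: j k => [|j IH] k sc.
  by rewrite big_ord0 expr0 coef1; case: (k == 0%N); rewrite ?av0 ?av1.
rewrite big_ord_recr /= mulrBr coefB coefMC coefMX.
have IH' i : nm (\prod_(i < j) ('X - (s i)%:P))`_i <= c ^+ j.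
  by apply: IH => l lj; apply: sc; rewrite ltnS ltnW.
apply: le_trans (avD _ _ _) _; rewrite avN avM exprSr.
apply: le_trans (_ : c ^+ j * 1 + c ^+ j * nm (s j) <= _); last first.
  by rewrite -mulrDr ler_wpM2l ?exprn_ge0// addrC sc.
apply: lerD; last by rewrite ler_wpM2r ?av_ge0.
by rewrite mulr1; case: (k == 0%N); rewrite ?av0 ?exprn_ge0.
Qed.

End PolyBound.

(** * Uniform bounds for families of polynomials *)

Section Baire.

Lemma norm_absval_eq0 (R : realFieldType) (x : R) : `|x| = 0 -> x = 0.
Proof. by move/eqP; rewrite normr_eq0 => /eqP. Qed.

Definition norm_absval (R : realFieldType) : absval R R :=
  @AbsVal R R (fun x => `|x|) (@normr_ge0 R R) (@norm_absval_eq0 R)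
    (@ler_normD R R) (@normrM R) (@normr_nat R).

(** Newton interpolation at [n + 1] equidistant points. A difference of order [j] costs [2^j], the
    factor [h^-j / j!] costs [4^(n+1) L^-j], the coefficients of the nodal product are at most
    [c^j], and there are at most [2^(n+1)] terms; hence [8 g], with [g] dominating [2 c / L]. *)
Lemma poly_coef_interval (R : realFieldType) (a L : R) : 0 < L ->
  exists2 G, 1 <= G & forall (p : {poly R}) n (B : R), (size p <= n.+1)%N -> 0 <= B ->
    (forall x, a <= x <= a + L -> `|p.[x]| <= B) ->
    forall k, `|p`_k| <= B * G ^+ n.+1.
Proof.
move=> L0; pose c : R := `|a| + L + 1; pose g : R := Num.max 1 (2 * c / L).
have c0 : 0 <= c by rewrite addr_ge0// addr_ge0// ltW.
have g1 : 1 <= g by rewrite le_max lexx.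
have g0 : 0 <= g by exact: le_trans g1.
exists (8 * g); first by rewrite mulr_ege1// ler1n.
move=> p n B sp B0 pB k.
pose h := L / n.+1%:R.
have n0 : 0 < n.+1%:R :> R by rewrite ltr0n.
have h0 : 0 < h by rewrite divr_gt0.
have hi i : (i <= n)%N -> 0 <= h * i%:R <= L.
  move=> iN; rewrite mulr_ge0 ?(ltW h0)//= /h mulrAC ler_pdivrMr// ler_wpM2l ?(ltW L0)//.
  by rewrite ler_nat ltnW// ltnS.
pose nm := norm_absval R.
rewrite [in X in `|X`_k|](newton_poly a (lt0r_neq0 h0) sp) coef_sum.
apply: le_trans (ler_norm_sum _ _ _) _.
have term j : (j < n.+1)%N ->
    `|(fdiff j (fun i => p.[a + h * i%:R]) 0%N *: newton_basis a h j)`_k| <=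
    B * (4 * g) ^+ n.+1.
  move=> jn; rewrite coefZ normrM.
  have d : `|fdiff j (fun i => p.[a + h * i%:R]) 0%N| <= 2 ^+ j * B.
    apply: (fdiff_le (nm := nm)) => i; rewrite add0n => ij.
    have /andP[h1 h2] := hi i (leq_trans ij jn).
    by apply: pB; rewrite lerDl h1 lerD2l.
  have bc : `|(newton_basis a h j)`_k| <= 4 ^+ n.+1 * (L ^- j * c ^+ j).
    rewrite coefZ normrM; apply: (@le_trans _ _ (4 ^+ n.+1 * L ^- j * c ^+ j)); last by rewrite mulrA.
    apply: ler_pM => //.
      rewrite ger0_norm; last by rewrite mulr_ge0 ?invr_ge0 ?exprn_ge0 ?ler0n ?(ltW h0).
      rewrite /h expr_div_n invf_div mulrA ler_wpM2r ?invr_ge0 ?exprn_ge0 ?(ltW L0)//.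
      rewrite /invfact mulrC ler_pdivrMr ?ltr0n ?fact_gt0//.
      by rewrite -!natrX -natrM ler_nat mulnC expn_le_fact// ltnW.
    apply: (@coef_prod_linear_le _ _ nm c (fun i => a + h * i%:R) j k c0) => i ij /=.
    have /andP[h1 h2] := hi i (leq_trans (ltnW ij) jn).
    rewrite /c lerD2r; apply: le_trans (ler_normD _ _) _.
    by rewrite lerD2l ger0_norm.
  apply: (@le_trans _ _ (2 ^+ j * B * (4 ^+ n.+1 * (L ^- j * c ^+ j)))).
    exact: ler_pM.
  have -> : 2 ^+ j * B * (4 ^+ n.+1 * (L ^- j * c ^+ j)) = B * (4 ^+ n.+1 * (2 * c / L) ^+ j).
    by rewrite !exprMn exprVn; ring.
  rewrite [(4 * g) ^+ _]exprMn ler_wpM2l// ler_wpM2l ?exprn_ge0//.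
  have q0 : 0 <= 2 * c / L by rewrite divr_ge0 ?mulr_ge0 ?(ltW L0).
  apply: (@le_trans _ _ (g ^+ j)); first by rewrite lerXn2r ?nnegrE// le_max lexx orbT.
  by rewrite ler_weXn2l// ltnW.
apply: (@le_trans _ _ (\sum_(j < n.+1) B * (4 * g) ^+ n.+1)).
  by apply: ler_sum => j _; exact: term.
rewrite sumr_const card_ord -[_ *+ n.+1]mulr_natl.
have -> : 8 * g = 2 * (4 * g) by ring.
rewrite [X in _ <= _ * X]exprMn mulrCA ler_wpM2l// ler_wpM2r ?exprn_ge0 ?mulr_ge0//.
exact: natr_le_expr2.
Qed.

Import numFieldTopology.Exports numFieldNormedType.Exports.
Local Open Scope classical_set_scope.

(* By the Baire category theorem some bound holds uniformly on an interval. *)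
Lemma poly_family_bound (R : realType) (P : nat -> {poly R}) :
  (forall n, size (P n) <= n.+1)%N ->
  (forall x, exists M, forall n, `|(P n).[x]| <= M ^+ n.+1) ->
  exists2 M, 1 <= M & forall n k, `|(P n)`_k| <= M ^+ n.+1.
Proof.
(* [O M] is the open set where the bound with base [M] fails for some [n]. Were all of them dense,
   some point would lie in every one, against [HP]; so one bound holds throughout some interval. *)
move=> sP HP; pose O (M : nat) : set R := \bigcup_n [set x | M%:R ^+ n.+1 < `|(P n).[x]|].
have oO M : open (O M).
  apply: bigcup_open => n _; apply: (@open_comp _ _ (fun x => `|(P n).[x]|) [set y | M%:R ^+ n.+1 < y]).
    move=> x _; apply: (@continuous_comp _ _ _ (horner (P n)) (fun y : R => `|y|)).
      exact: continuous_horner.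
    exact: norm_continuous.
  exact: open_gt.
have [M nd] : exists M, ~ dense (O M).
  apply: contrapT => /forallNP H.
  have dO M : dense (O M) by apply: contrapT; exact: H.
  have /(_ setT) := Baire (fun i => conj (oO i) (dO i)).
  case; [by exists 0|exact: openT|] => x [_ Ox].
  have [M HM] := HP x.
  have [m Mm] : exists m : nat, `|M| <= m%:R.
    by exists (Num.truncn `|M|).+1; apply/ltW/truncnS_gt.
  have [n _] := Ox m I; rewrite /= ltNge => /negP; apply.
  apply: le_trans (HM n) _; apply: le_trans (ler_norm _) _; rewrite normrX.
  by rewrite lerXn2r ?nnegrE.
have [D [D0 oD DO]] : exists D : set R, [/\ D !=set0, open D & D `&` O M = set0].
  apply: contrapT => H; apply: nd => D D0 oD; apply/set0P/negP => /eqP e.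
  by apply: H; exists D.
have [x Dx] := D0.
have /nbhs_ballP[e /= e0 eD] : nbhs x D by exact: open_nbhs_nbhs.
have e20 : 0 < e / 2 by rewrite divr_gt0.
have [G G1 HG] := poly_coef_interval x e20.
have M0 : 0 <= M%:R :> R by [].
exists (Num.max 1 (M%:R * G)); first by rewrite le_max lexx.
move=> n k; apply: (@le_trans _ _ (M%:R ^+ n.+1 * G ^+ n.+1)).
  apply: (HG (P n) n (M%:R ^+ n.+1) (sP n) (exprn_ge0 _ M0)).
  move=> y /andP[xy yx]; rewrite leNgt; apply/negP => lt.
  have : (D `&` O M) y.
    split; last by exists n.
    apply: eD; rewrite /ball/= distrC ger0_norm ?subr_ge0// ltrBlDl.
    apply: le_lt_trans yx _; rewrite ltrD2l ltr_pdivrMr// ltr_pMr// ltr1n//.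
  by rewrite DO.
rewrite -exprMn lerXn2r ?nnegrE ?le_max ?ler01 ?lexx ?orbT//.
by rewrite mulr_ge0// (le_trans _ G1).
Qed.

End Baire.

Section Complex.
Import ComplexField.
Local Open Scope classical_set_scope.
Variable R : realType.
Implicit Types (f g : fps2 R[i]).

Definition normc_absval : absval R R[i].
Proof.
refine (@AbsVal R R[i] (@Normc.normc R) _ (@Normc.eq0_normc R) (@le_normcD R) (@Normc.normcM R) _).
- by case=> x y; exact: sqrtr_ge0.
- by move=> n; rewrite normcMn Normc.normc1.
Defined.

Local Notation bd := (bd normc_absval).

(** Summability bounds every weighted coefficient, which gives geometric growth; conversely every
    finite set of indices lies in a square. *)
Lemma convergent_bd f : convergent f <-> bd f.
Proof.
split=> [[r r0 Hs]|[r [C [r0 HC]]]].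
  apply: geometric_bd; have [C HC] : exists C, forall i j, normc_absval (f i j) * r ^+ (i + j) <= C.
    move: Hs; rewrite /summable; set S := esum _ _ => Sfin.
    have S0 : (0 <= S)%E by apply: esum_ge0 => k _; rewrite abse_ge0.
    exists (fine S) => i j; rewrite -lee_fin fineK ?ge0_fin_numE//.
    apply: esum_ge; exists [set (i, j)].
      by split; [exact: finite_set1|].
    by rewrite fsbig_set1 /= lee_fin ler_norm.
  have C0 : 0 <= C by apply: le_trans (HC 0%N 0%N); rewrite mulr_ge0 ?av_ge0.
  apply: (@geometricE _ _ _ C (Num.max 1 r^-1)); first by rewrite le_max lexx.
  move=> i j; apply: (@le_trans _ _ (C * r^-1 ^+ (i + j))).
    by rewrite exprVn ler_pdivlMr ?exprn_gt0.
  rewrite ler_wpM2l// lerXn2r ?nnegrE ?invr_ge0 ?(ltW r0)//.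
    by rewrite le_max ler01.
  by rewrite le_max lexx orbT.
exists r => //; rewrite /summable; apply: (@le_lt_trans _ _ C%:E); last exact: ltry.
apply: ge_ereal_sup => _ [A [fA _] <-].
have [m Am] : exists m, A `<=` `I_m `*` `I_m.
  have /finite_seqP[s As] := fA.
  exists (\sum_(k <- s) (k.1 + k.2).+1)%N => k; rewrite As /= => ks.
  have h : (k.1 + k.2 < \sum_(k <- s) (k.1 + k.2).+1)%N.
    by rewrite (big_rem k)//= addSn ltnS leq_addr.
  by split=> /=; apply: leq_ltn_trans h; rewrite ?leq_addr ?leq_addl.
apply: le_trans (_ : (bnorm normc_absval r m f)%:E <= _)%E; last by rewrite lee_fin.
have fB : finite_set (`I_m `*` `I_m) by apply: finite_setX; exact: finite_II.
apply: le_trans (lee_fsum_nneg_subset fA fB _ _) _.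
- by move=> k /set_mem/Am/mem_set.
- by move=> k _; exact: abse_ge0.
rewrite /bnorm (fsbig_ord _ m (fun i => \sum_(j < m) normc_absval (f i j) * r ^+ (i + j))).
under eq_fsbigr => i _ do rewrite (fsbig_ord _ m (fun j => normc_absval (f i j) * r ^+ (i + j))).
rewrite pair_fsbig//= -fsumEFin//; rewrite le_eqVlt; apply/orP; left; apply/eqP.
apply: eq_fsbigr => k _; congr (_%:E); apply: ger0_norm.
by rewrite mulr_ge0 ?exprn_ge0 ?(ltW r0) ?(av_ge0 normc_absval).
Qed.

Lemma normc_Re (z : R[i]) : `|complex.Re z| <= normc_absval z.
Proof.
case: z => x y /=; rewrite -sqrtr_sqr ler_wsqrtr// lerDl; exact: sqr_ge0.
Qed.
Lemma normc_Im (z : R[i]) : `|complex.Im z| <= normc_absval z.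
Proof.
case: z => x y /=; rewrite -sqrtr_sqr ler_wsqrtr// lerDr; exact: sqr_ge0.
Qed.
Lemma normc_le (z : R[i]) : normc_absval z <= `|complex.Re z| + `|complex.Im z|.
Proof.
case: z => x y /=; rewrite -[X in _ <= X]ger0_norm ?addr_ge0// -sqrtr_sqr ler_wsqrtr//.
by rewrite sqrrD !real_normK ?num_real// addrAC lerDl mulrn_wge0// mulr_ge0.
Qed.

(* Only real values of the argument are needed, so that the Baire argument
   applies to the real and the imaginary part separately. *)
Lemma complex_poly_family_bound (P : nat -> {poly R[i]}) :
  (forall n, size (P n) <= n.+1)%N ->
  (forall x : R, exists M, forall n, normc_absval (P n).[x%:C%C] <= M ^+ n.+1) ->
  exists2 M, 1 <= M & forall n k, normc_absval (P n)`_k <= M ^+ n.+1.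
Proof.
move=> sP HP.
have part (u : {additive R[i] -> R}) : (forall x z, u (x%:C%C * z) = x * u z) ->
    (forall z, `|u z| <= normc_absval z) ->
    exists2 M, 1 <= M & forall n k, `|u (P n)`_k| <= M ^+ n.+1.
  move=> uM uN; pose Q n := \poly_(k < n.+1) u (P n)`_k.
  have [|x|M M1 HM] := @poly_family_bound R Q; first by move=> n; exact: size_poly.
    have [M HM] := HP x; exists M => n; apply: le_trans (HM n).
    have -> : (Q n).[x] = u (P n).[x%:C%C].
      rewrite /Q horner_poly (horner_coef_wide _ (sP n)) raddf_sum.
      apply: eq_bigr => k _; rewrite -rmorphXn mulrC -uM mulrC; congr (u (_ * _)).
    exact: uN.
  exists M => // n k; have := HM n k; rewrite coef_poly; case: ltnP => // nk _.
  by rewrite nth_default ?raddf0 ?normr0 ?exprn_ge0 ?(le_trans _ M1)// (leq_trans (sP n)).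
have reM x (z : R[i]) : complex.Re (x%:C%C * z) = x * complex.Re z.
  by case: z => a b /=; rewrite mul0r subr0.
have imM x (z : R[i]) : complex.Im (x%:C%C * z) = x * complex.Im z.
  by case: z => a b /=; rewrite mul0r addr0.
have [M M1 HM] := part (@complex.Re R) reM normc_Re.
have [N N1 HN] := part (@complex.Im R) imM normc_Im.
exists (M + N) => [|n k]; first by rewrite -[1]addr0 lerD// (le_trans _ N1).
apply: le_trans (normc_le _) _; apply: le_trans (lerD (HM n k) (HN n k)) _.
have M0 : 0 <= M by exact: le_trans M1.
have N0 : 0 <= N by exact: le_trans N1.
rewrite !exprS mulrDl; apply: lerD; apply: ler_wpM2l => //;
  by rewrite lerXn2r ?nnegrE ?addr_ge0// ?lerDl ?lerDr.
Qed.

End Complex.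

(** * Moments *)

Section Moments.
Variables (R : realFieldType) (K : numFieldType) (nm : absval R K).
Local Notation geometric := (geometric nm).

(** The modulus of the nodal product at a pole with its own factor removed; it relates the residue
    to the value of the numerator. *)
Lemma prod_dist_fact d k : (k <= d)%N ->
  (\prod_(l < d.+1 | l != k :> nat) `|l - k| = k`! * (d - k)`!)%N.
Proof.
move=> kd; rewrite -(big_mkord (fun l => l != k) (fun l => `|l - k|%N)).
rewrite (big_cat_nat (leq0n k) (leqW kd)) /=; congr muln.
  rewrite big_nat_rev /= add0n fact_prod big_add1 /= big_nat_cond [RHS]big_nat_cond.
  rewrite [RHS](eq_bigl (fun l => (0 <= l < k)%N && (k - l.+1 != k)%N)); last first.
    by move=> l /=; case: (ltnP l k) => //= lk; lia.
  by apply: eq_bigr => l /andP[/andP[_ lk] _]; lia.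
rewrite big_ltn_cond ?ltnS// eqxx /= -{1}(add0n k.+1) big_addn fact_prod big_add1.
rewrite subSS big_nat_cond [RHS]big_nat_cond.
rewrite [RHS](eq_bigl (fun l => (0 <= l < d - k)%N && (l + k.+1 != k)%N)); last first.
  by move=> l /=; case: (ltnP l (d - k)) => //= lk; lia.
by apply: eq_bigr => l /andP[/andP[_ lk] _]; lia.
Qed.

Lemma prod_succ_bin a j : (\prod_(i < j) (i + a).+1 = 'C(a + j, j) * j`!)%N.
Proof.
elim: j => [|j IH]; first by rewrite big_ord0 addn0 bin0.
rewrite big_ord_recr /= IH factS addnS [RHS]mulnA [X in _ = (X * _)%N]mulnC -mul_bin_diag.
by rewrite mulnC mulnA [(j + a)%N]addnC.
Qed.

Lemma av_prod (I : Type) (r : seq I) (P : pred I) (F : I -> K) :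
  nm (\prod_(k <- r | P k) F k) = \prod_(k <- r | P k) nm (F k).
Proof. exact: (big_morph nm (avM nm) (av1 nm)). Qed.

(* The moments are the values at the points [m.+1] of a rational function with
   simple poles at the points [- k.+1]; its numerator has degree at most [d], is
   recovered from its first values by Newton interpolation, and its value at
   [- k.+1] gives back the residue [c (d - k) k]. *)
Lemma moments_geometric (c : fps2 K) M : 1 <= M ->
  (forall m d, nm (\sum_(k < d.+1) c (d - k)%N k / (k + m).+2%:R) <= M ^+ (m.+1 + d).+1) ->
  geometric c.
Proof.
move=> M1 H; have M0 : 0 <= M by exact: le_trans M1.
have p2 n : 0 <= 2 ^+ n :> R by exact: exprn_ge0.
(* The powers of 2 are [d + 1] for the number of terms, [d] for the differences, [2d + 2] for the
   product at a node, and [2d + 1] each for the Newton basis and for the ratio of factorials: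
   [8d + 5] in all, below [8(d + 1)]. *)
pose G := 2 ^+ 8 * M ^+ 2.
have G1 : 1 <= G by rewrite mulr_ege1 ?exprn_ege1// ler1n.
exists G => // i k; set d := (i + k)%N; have kd : (k <= d)%N by exact: leq_addl.
have -> : i = (d - k)%N by rewrite addnK.
pose u l := c (d - l)%N l; rewrite -[c _ _]/(u k).
(* The variable is shifted by one: the nodes are [m = 0, ..., d], the poles are at [-(l + 2)], and
   [q] is the numerator over the common denominator. *)
pose s (l : nat) : K := - l.+2%:R.
pose q : {poly K} := \sum_(l < d.+1) u l *: \prod_(h < d.+1 | h != l) ('X - (s h)%:P).
have sq : (size q <= d.+1)%N.
  apply: size_sum_le => l _; apply: leq_trans (size_scale_leq _ _) _.
  rewrite -big_filter size_prod_XsubC -sum1_size big_filter ltnS.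
  by rewrite (sum1_card (predC1 l)) cardC1 card_ord.
have qm m : (m <= d)%N -> nm q.[m%:R] <= M ^+ (d + d).+2 * (2 ^+ (d + d).+2 * d.+1`!%:R).
  move=> md; have -> : q.[m%:R] = (\sum_(l < d.+1) u l / (l + m).+2%:R) *
      (\prod_(h < d.+1) (h + m.+1).+1)%:R.
    rewrite horner_sum mulr_suml; apply: eq_bigr => l _.
    rewrite hornerZ horner_prod -mulrA; congr (_ * _).
    rewrite [in RHS](bigD1 l)//= natrM addnS mulKf ?pnatr_eq0// natr_prod; apply: eq_bigr => h _.
    by rewrite hornerXsubC opprK -natrD addnS addnC !addnS.
  rewrite avM av_natr prod_succ_bin natrM.
  apply: ler_pM; rewrite ?av_ge0 ?mulr_ge0//.
    apply: le_trans (H m d) _; rewrite ler_weXn2l// ltnS addSn ltnS leq_add2r//.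
  rewrite ler_wpM2r// -natrX ler_nat; apply: leq_trans (bin_le_expn2 _ _) _.
  by rewrite leq_exp2l// addSn addnS !ltnS leq_add2r.
have qk : nm q.[s k] = nm (u k) * (k`! * (d - k)`!)%:R.
  rewrite horner_sum (bigD1 (Ordinal (kd : (k < d.+1)%N)))//= [X in _ + X]big1 ?addr0 => [|l lk].
    rewrite hornerZ avM; congr (_ * _); rewrite horner_prod av_prod -prod_dist_fact// natr_prod.
    apply: eq_big => [h|h _]; first by rewrite -val_eqE.
    rewrite hornerXsubC -(av_natr nm); have [hk|/ltnW hk] := leqP k h.
      have -> : (`|h - k| = h - k)%N by lia.
      by rewrite natrB//; congr (nm _); rewrite /s -!natr1; ring.
    have -> : (`|h - k| = k - h)%N by lia.
    by rewrite -[LHS]avN natrB//; congr (nm _); rewrite /s -!natr1; ring.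
  rewrite hornerZ horner_prod (bigD1 (Ordinal (kd : (k < d.+1)%N)))/=; last by rewrite eq_sym.
  by rewrite hornerXsubC subrr mul0r mulr0.
have bk j : (j <= d)%N -> nm (newton_basis (0 : K) 1 j).[s k] <= 2 ^+ (d + d).+1.
  move=> jd; rewrite horner_newton_basis expr1n invr1 mulr1 avM av_prod.
  under eq_bigr => l _.
    have -> : s k - (0 + 1 * l%:R) = - (l + k.+1).+1%:R by rewrite /s -!natr1 natrD -!natr1; ring.
    rewrite avN av_natr; over.
  rewrite -natr_prod prod_succ_bin /invfact avV av_natr natrM mulrCA mulVf ?pnatr_eq0 -?lt0n ?fact_gt0//.
  rewrite mulr1 -natrX ler_nat; apply: leq_trans (bin_le_expn2 _ _) _.
  by rewrite leq_exp2l// addSn ltnS leq_add.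
have uk : nm (u k) * (k`! * (d - k)`!)%:R <= 2 ^+ d.+1 * (2 ^+ d *
    (M ^+ (d + d).+2 * (2 ^+ (d + d).+2 * d.+1`!%:R)) * 2 ^+ (d + d).+1).
  rewrite -qk [X in X.[_]](newton_poly 0 (oner_neq0 K) sq) horner_sum.
  apply: le_trans (av_sum _ _ _ _) _; set B := M ^+ _ * _.
  have B0 : 0 <= B by apply: mulr_ge0; [exact: exprn_ge0|exact: mulr_ge0].
  apply: (@le_trans _ _ (\sum_(j < d.+1) 2 ^+ d * B * 2 ^+ (d + d).+1)).
    apply: ler_sum => j _; have jd : (j <= d)%N by rewrite -ltnS.
    rewrite hornerZ avM; apply: ler_pM; rewrite ?av_ge0 ?bk//.
    apply: (@le_trans _ _ (2 ^+ j * B)).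
      apply: fdiff_le => l; rewrite add0n add0r mul1r => lj; apply: qm; exact: leq_trans jd.
    by rewrite ler_wpM2r// ler_weXn2l// ler1n.
  rewrite sumr_const card_ord -[_ *+ _]mulr_natl ler_wpM2r ?natr_le_expr2//.
  by apply: mulr_ge0 => //; exact: mulr_ge0.
have f0 : 0 < (k`! * (d - k)`!)%:R :> R by rewrite ltr0n muln_gt0 !fact_gt0.
have fk : d.+1`!%:R <= 2 ^+ (d + d).+1 * (k`! * (d - k)`!)%:R :> R.
  rewrite factS -(bin_fact kd) mulnA natrM ler_wpM2r// -natrX ler_nat.
  rewrite -addSn expnD leq_mul ?bin_le_expn2//.
  by apply: ltnW; exact: ltn_expl.
rewrite -(ler_pM2r f0); apply: le_trans uk _.
rewrite /G exprMn -!exprM; set f := _%:R in f0 fk *.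
have -> : (2 * d.+1)%N = (d + d).+2 by lia.
have -> : (8 * d.+1 = d.+1 + (d + ((d + d).+2 + (d + d).+1 + (d + d).+1)) + 3)%N by lia.
clear -p2 M0 f0 fk; clearbody d; set A := (d + d).+2 in fk *; set A1 := (d + d).+1 in fk *.
rewrite !exprD.
apply: (@le_trans _ _ (2 ^+ d.+1 * (2 ^+ d * (M ^+ A * (2 ^+ A * (2 ^+ A1 * f))) * 2 ^+ A1))).
  rewrite ler_wpM2l// ler_wpM2r// ler_wpM2l// ler_wpM2l ?exprn_ge0// ler_wpM2l//.
have -> : 2 ^+ d.+1 * (2 ^+ d * (2 ^+ A * 2 ^+ A1 * 2 ^+ A1)) * 2 ^+ 3 * M ^+ A * f =
  2 ^+ d.+1 * (2 ^+ d * (M ^+ A * (2 ^+ A * (2 ^+ A1 * f))) * 2 ^+ A1) * 2 ^+ 3 by ring.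
rewrite ler_peMr ?exprn_ege1 ?ler1n//.
have f0' := ltW f0; have MA : 0 <= M ^+ A by exact: exprn_ge0.
by do ![apply: mulr_ge0 => //].
Qed.

End Moments.

(** * Embeddable members of the family *)

Section Embeddable.
Variables (R : realFieldType) (K : numFieldType) (nm : absval R K).
Implicit Types (f g h : fps2 K).
Local Notation bd := (bd nm).

Lemma bd_onx f : bd f -> bd (fcomp f onx).
Proof. by move=> bf; apply: bd_fcomp => //; [exact: nct_onx|exact: bd_varx|exact: bd0]. Qed.
Lemma bd_ond f : bd f -> bd (fcomp f ond).
Proof. by move=> bf; apply: bd_fcomp => //; [exact: nct_ond|exact: bd_varx|exact: bd_varx]. Qed.

(** A one-variable logarithm: [exp - 1] has a simple zero, so it is locally invertible. *)
Lemma bd_exp_inverse u : ordge 1 u -> bd (fcomp expser (u, 0)) -> bd u.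
Proof.
move=> ou bu; have un : nct (u, 0) by split=> //; exact: ordge_zero.
apply: (@bd_inverse1 _ _ nm (expser - 1)) => //.
- by apply: bdB; [exact: bd_expser|exact: bd1].
- by rewrite coef2D coef2N /= invfact0 subrr.
- by rewrite coef2D coef2N /= invfact1 subr0 oner_neq0.
- by rewrite (fcompB (u, 0) expser 1) (fcomp1 un); exact: (bdB bu (bd1 nm)).
Qed.

(** Multiplication by [x y] puts the inverse in the form treated by [bd_div]: [b] is the quotient of
    [x y] by [x y c]. *)
Lemma bd_inverse_unit (b c : fps2 K) : b * c = 1 -> bd c -> bd b.
Proof.
move=> bc bdc; have c00 : c 0%N 0%N != 0.
  apply/eqP => c0; have := congr1 (fun f : fps2 K => f 0%N 0%N) bc.
  by rewrite coef2M !big_ord1 c0 mulr0 => /esym/eqP; apply/negP; exact: oner_neq0.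
have bxy : bd (varx * vary) by apply: bdM; [exact: bd_varx|exact: bd_vary].
apply: (@bd_div _ _ nm (varx * vary) (varx * vary * c) b (c 0%N 0%N)) => //.
- by rewrite -[RHS]mulrA (mulrC c b) bc mulr1.
- have -> : varx * vary * c - c 0%N 0%N *: (varx * vary) =
    varx * vary * (c - c 0%N 0%N *: 1).
    by rewrite mulrBr -scalerAr mulr1.
  rewrite -[3%N]/(1 + 1 + 1)%N; apply: ordgeM.
    by apply: ordgeM; [exact: ordge_varx|exact: ordge_vary].
  by apply/ordge1P; rewrite coef2D coef2N coef2Z mulr1 subrr.
- exact: bdM.
Qed.

Section Normalise.
Variables (X : fps2 K -> fps2 K) (sigma tau : fps2 K * fps2 K).
Hypotheses (lX : linear X) (sn : nct sigma) (su : linear_part sigma \in unitmx) (tn : nct tau).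
Hypotheses (st : pcomp sigma tau = (varx, vary)) (ts : pcomp tau sigma = (varx, vary)).
Hypotheses (bP : bd (fcomp (X sigma.1) tau)) (bQ : bd (fcomp (X sigma.2) tau)).

Lemma normalise_conjugacy : exists sigma' tau' P Q,
  [/\ [/\ nct sigma', nct tau', pcomp sigma' tau' = (varx, vary) & pcomp tau' sigma' = (varx, vary)],
   ordge 2 (sigma'.1 - (varx - vary)), ordge 2 (sigma'.2 - vary),
   fcomp P sigma' = X sigma'.1 /\ fcomp Q sigma' = X sigma'.2 & bd P /\ bd Q].
Proof.
pose L := linear_part sigma; have Lu : L \in unitmx := su.
(* The linear map [(x - y, y)], which sends [y = 0] to the [x]-axis and [y = x] to the [y]-axis.
   Composing with the linear [T] gives the conjugacy this linear part and preserves convergence of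
   the transported field. *)
pose N : 'M[K]_2 := \matrix_(i < 2, j < 2) (if i == j then 1 else if i == 0 then -1 else 0).
have [N00 N01 N10 N11] : [/\ N 0 0 = 1, N 0 1 = -1, N 1 0 = 0 & N 1 1 = 1] by split; rewrite mxE.
have Nu : N \in unitmx by apply: mx2_unit; rewrite N00 N01 N10 N11 mulr1 mulr0 oner_neq0.
pose T := N *m invmx L; pose Ti := L *m invmx N.
have TTi : T *m Ti = 1%:M by rewrite /T /Ti mulmxA mulmxKV// mulmxV.
have TiT : Ti *m T = 1%:M by rewrite /T /Ti mulmxA mulmxKV// mulmxV.
have TL : T *m L = N by rewrite /T mulmxKV.
pose rho := linmap Ti (varx : fps2 K) vary.
have rn : nct rho by apply: nct_linmap; [exact: ordge_varx|exact: ordge_vary].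
pose s' := linmap T sigma.1 sigma.2.
have s'n : nct s' by case: sn => *; exact: nct_linmap.
have rs : pcomp rho s' = sigma.
  by rewrite fcomp_linmap fcomp_varx// fcomp_vary// linmapM TiT linmap1 -surjective_pairing.
have s't : pcomp s' tau = linmap T varx vary.
  rewrite fcomp_linmap.
  have -> : fcomp sigma.1 tau = varx by exact: (congr1 (fun p : fps2 K * fps2 K => p.1) st).
  by have -> : fcomp sigma.2 tau = vary by exact: (congr1 (fun p : fps2 K * fps2 K => p.2) st).
have assoc (a b c : fps2 K * fps2 K) : nct b -> nct c -> pcomp (pcomp a b) c = pcomp a (pcomp b c).
  by move=> bn cn; rewrite /pcomp /= !fcompA.
have XL f g : X (linmap T f g).1 = (linmap T (X f) (X g)).1 /\ X (linmap T f g).2 = (linmap T (X f) (X g)).2.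
  by rewrite /= !(linearD' lX) !(linearZ' lX).
pose PQ := linmap T (fcomp (X sigma.1) tau) (fcomp (X sigma.2) tau).
have PQs : pcomp PQ sigma = linmap T (X sigma.1) (X sigma.2).
  by rewrite fcomp_linmap !fcompA// ts !fcomp_id.
have PQE : pcomp (pcomp PQ rho) s' = linmap T (X sigma.1) (X sigma.2) by rewrite assoc// rs.
have [h1 h2] := linear_part_linmap sn; rewrite -/L in h1 h2; set l := linmap L _ _ in h1 h2.
have lN : varx - vary = (linmap T l.1 l.2).1 /\ vary = (linmap T l.1 l.2).2.
  by rewrite /l linmapM TL /= N00 N01 N10 N11 !scale1r scaleN1r scale0r add0r.
clearbody l.
have o : ordge 2 (linmap T (sigma.1 - l.1) (sigma.2 - l.2)).1 /\
    ordge 2 (linmap T (sigma.1 - l.1) (sigma.2 - l.2)).2.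
  by split; apply: ordgeD; exact: ordgeZ.
exists s', (pcomp tau rho), (fcomp PQ.1 rho), (fcomp PQ.2 rho); split.
- split; [exact: s'n|exact: nct_pcomp| |].
    by rewrite -(assoc s' tau rho tn rn) s't fcomp_linmap fcomp_varx// fcomp_vary// linmapM TTi linmap1.
  by rewrite (assoc tau rho s' rn s'n) rs.
- by have := o.1; rewrite lN.1 /= !scalerBr addrACA -opprD.
- by have := o.2; rewrite lN.2 /= !scalerBr addrACA -opprD.
- have [e1 e2] := XL sigma.1 sigma.2; split.
    by rewrite e1 -PQE.
  by rewrite e2 -PQE.
- have [b1 b2] := bd_linmap T bP bQ.
  have [r1 r2] := bd_linmap Ti (bd_varx nm) (bd_vary nm).
  by split; apply: bd_fcomp.
Qed.
End Normalise.

(** Transport yields an invariant [g] that converges on both curves. Being a function [v] of the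
    normalised invariant [f], it satisfies [g(x,x) = v(f(x,x))] with [v = g(x,0)] convergent and
    invertible, and [f(x,x)] converges by inverting [v]. *)
Lemma embeddable_invariant (D w f : fps2 K) (X : fps2 K -> fps2 K) sigma :
  D 0%N 0%N = 0 -> w 0%N 0%N != 0 -> bd D -> bd w -> is_log (family D w) X ->
  formal_diffeo sigma ->
  bd (Defs.pushforward sigma X varx) -> bd (Defs.pushforward sigma X vary) ->
  fcomp f (family D w) = f -> fcomp f onx = varx -> bd (fcomp f ond).
Proof.
move=> D00 w00 bD bw logX sd bx cy fphi fx.
have [tn st ts] := formal_inverse_exists sd; have [sn su] := sd.
move/nctP in sn; have {}tn := (nctP _).1 tn.1; set tau := formal_inverse sigma in tn st ts.
have [dX rX eX X0 X1] := family_log logX.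
have [a [b [Xx Xy a00 b00]]] := family_log_coefs D00 logX.
have bP : bd (fcomp (X sigma.1) tau) by move: bx; rewrite /Defs.pushforward !fps2_compE fcomp_varx.
have bQ : bd (fcomp (X sigma.2) tau) by move: cy; rewrite /Defs.pushforward !fps2_compE fcomp_vary.
have [s' [t' [P [Q [[s'n t'n s't t's] o1 o2 [PE QE] [bP' bQ']]]]]] :=
  normalise_conjugacy dX.1.1 sn su tn st ts bP bQ.
have bdx : bd (vary - varx) by apply: bdB; [exact: bd_vary|exact: bd_varx].
have b0 : bd (fcomp ((vary - varx) * b) onx).
  apply: bd_exp_inverse.
    apply: fcomp_ordge; first exact: nct_onx.
    by apply: ordgeMl; apply: ordgeB; [exact: ordge_vary|exact: ordge_varx].
  rewrite -(cofactor_onx logX Xy); apply: bd_onx; apply: bdD; first exact: bd1.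
  exact: bdM.
have b1 : bd (fcomp (vary * (b - a)) ond).
  apply: bd_exp_inverse.
    by apply: fcomp_ordge; [exact: nct_ond|apply: ordgeMl; exact: ordge_vary].
  rewrite -(cofactor_ond logX Xx Xy); apply: bd_ond; apply: bdD; first exact: bd1.
  by apply: bdM; [exact: bd_vary|exact: bdB].
have [g [Xg g00 g10 bg0 bg1]] := transport_convergent dX X0 X1 Xx Xy a00 b00 w00 s'n t'n s't t's
  o1 o2 PE QE bP' bQ' b0 b1.
have gphi := flow_fixed dX rX eX Xg.
have of1 : ordge 1 f.
  by apply/ordge1P; rewrite -(fcomp_const f onx) fx.
have fn : nct (f, 0) by split=> //; exact: ordge_zero.
have [v [vE vx v00 v10]] : exists v, [/\ fcomp g onx = v, xonly v, v 0%N 0%N = 0 & v 1%N 0%N != 0].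
  by exists (res0 g); split; [exact: fcomp_onx|exact: xonly_res0|exact: g00|exact: g10].
rewrite vE in bg0.
have comp phi : nct phi -> fcomp (fcomp v (f, 0)) phi = fcomp v (fcomp f phi, 0).
  move=> pn; rewrite (fcompA v fn pn); exact: (fcomp_xonly vx).
(* Both terms are invariant and equal [v] on [y = 0]; uniqueness gives [g = v(f)]. *)
pose h := g - fcomp v (f, 0).
have h0 : h = 0.
  have wu : w 0%N 0%N \is a GRing.unit by rewrite unitfE.
  have nu n : (n.+1%:R : K) \is a GRing.unit by rewrite unitfE pnatr_eq0.
  have h1 : fcomp h (family D w) = h.
    by rewrite (fcompB _ g (fcomp v (f, 0))) gphi (comp _ (family_nct D w)) fphi.
  apply: (invariant_unique nu D00 wu h1).
  rewrite (fcompB _ g (fcomp v (f, 0))) (comp _ (nct_onx K)) fx vE.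
  have -> : fcomp v (varx, 0) = v by exact: (@xonly_id _ v (varx, 0) vx erefl).
  exact: subrr.
have gE : fcomp g ond = fcomp v (fcomp f ond, 0).
  by rewrite -(comp _ (nct_ond K)); move/eqP: h0; rewrite subr_eq0 => /eqP <-.
have ok : ordge 1 (fcomp f ond) by apply: fcomp_ordge; [exact: nct_ond|exact: of1].
by apply: (bd_inverse1 bg0 v00 v10 ok); rewrite -gE.
Qed.

End Embeddable.

(** * Consequences of embeddability of the whole family *)

Section Main.
Variable R : realType.
Implicit Types (D w : fps2 R[i]).
Let nm := normc_absval R.
Local Notation bd := (bd nm).

Lemma phi_family_unipotent D w : convergent D -> convergent w ->
  unipotent_germ (phi_family D w).
Proof.
move=> /convergent_bd bD /convergent_bd bw.
have byyx : bd yyx.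
  apply: bdM; first exact: bd_vary.
  by apply: bdB; [exact: bd_vary|exact: bd_varx].
have L : linear_part (family D w) = 1%:M.
  by apply: linear_part_order2; rewrite linmap1; [exact: family_tangent1|exact: family_tangent2].
split.
- split; first split.
  + by apply/nctP; exact: family_nct.
  + by rewrite -[linear_part _]/(linear_part (family D w)) L unitmx1.
  + move=> a; rewrite -[linear_part _]/(linear_part (family D w)) L; split.
      move=> /eigenvalueP[v]; rewrite mulmx1 => va v0; apply/eqP; rewrite -subr_eq0.
      have : (a - 1) *: v == 0 by rewrite scalerBl scale1r -va subrr.
      by rewrite scaler_eq0 (negPf v0) orbF.
    move=> ->; apply/eigenvalueP; exists (const_mx 1); first by rewrite mulmx1 scale1r.
    apply/eqP => /matrixP/(_ 0 0); rewrite !mxE => /eqP; apply/negP; exact: oner_neq0.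
- by apply/convergent_bd; apply: bdD; [exact: bd_varx|exact: (bdM byyx bD)].
- by apply/convergent_bd; apply: bdD; [exact: bd_vary|exact: (bdM byyx bw)].
Qed.

Lemma embeddable_first_order D w : bd D -> D 0%N 0%N = 0 -> bd w -> w 0%N 0%N != 0 ->
  (forall x : R, embeddable_class (phi_family (x%:C%C *: D) w)) ->
  exists e, [/\ variation 0 w e = - (yyx * D), fcomp e onx = 0 & bd (fcomp e ond)].
Proof.
move=> bD D00 bw w00 emb.
have [f [tf fz [ve e0]]] := family_invariant D00 w00.
set e := Fps2 _ in ve e0; exists e; split=> //.
(* A polynomial in [z] of degree at most [n], whose coefficient of [z] is the coefficient of [x^n]
   in [e(x,x)]. *)
pose P n := diag_antidiag f n 0%N.
have sP n : (size (P n) <= n.+1)%N.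
  apply: size_sum_le => k _; apply: leq_trans (tf _ _) _.
  by rewrite subnK ?subn1// -ltnS.
have PE x n : (P n).[x] = diag_antidiag (map2 (horner_eval x) f) n 0%N.
  by rewrite /P /= horner_sum.
have [x|M M1 HM] := complex_poly_family_bound sP.
  have [_ [sigma sd [cx cy]]] := emb x.
  have [fphi fx] := fz x%:C%C.
  have z00 : (x%:C%C *: D) 0%N 0%N = 0 by rewrite coef2Z D00 mulr0.
  have tid : tangent_id (family (x%:C%C *: D) w) by exact: family_tangent_id.
  have lg := flog_is_log tid.
  have bf := embeddable_invariant z00 w00 (bdZ _ bD) bw lg sd
    ((convergent_bd _).1 cx) ((convergent_bd _).1 cy) fphi fx.
  have [M _ HM] := bd_geometric bf.
  by exists M => n; rewrite PE -fcomp_ond -[in M ^+ _](addn0 n).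
apply: geometric_bd; exists M => // n k; rewrite fcomp_ond.
case: k => [|k].
  have := HM n 1%N; rewrite addn0 /P /= coef_sum; exact.
have -> : diag_antidiag e n k.+1 = 0 by [].
by rewrite av0 exprn_ge0// (le_trans _ M1).
Qed.

Lemma triangle_exchange (V : nmodType) (F : nat -> nat -> V) n :
  \sum_(a < n.+1) \sum_(h < a.+1) F a h =
  \sum_(h < n.+1) \sum_(k < (n - h).+1) F (h + k)%N h.
Proof.
elim: n => [|n IH]; first by rewrite !big_ord1.
rewrite big_ord_recr IH [in RHS]big_ord_recr /= subnn big_ord1 addn0.
rewrite [X in _ + X]big_ord_recr /= addrA -big_split; congr (_ + _).
apply: eq_bigr => h _ /=; have hn : (h <= n)%N by rewrite -ltnS.
by rewrite subSn// [in RHS]big_ord_recr /= addnS subnKC.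
Qed.

(** The geometric series starts at [j = 1], so that it vanishes at the origin as [Delta] must. *)
Definition geom_y (mu : R[i]) : fps2 R[i] :=
  Fps2 (fun i j => if (i == 0%N) && (0 < j)%N then mu ^+ j else 0).

Lemma bd_geom_y mu : bd (geom_y mu).
Proof.
apply: geometric_bd; apply: (@geometricE _ _ _ 1 (Num.max 1 (nm mu))).
  by rewrite le_max lexx.
move=> i j; rewrite mul1r /geom_y; cbn [coef2].
have m1 : 1 <= Num.max 1 (nm mu) by rewrite le_max lexx.
case: ifP => [/andP[/eqP -> _]|_]; last by rewrite av0 exprn_ge0// (le_trans _ m1).
have -> : nm (mu ^+ j) = nm mu ^+ j.
  by elim: j => [|j IH]; rewrite ?expr0 ?av1// !exprS avM IH.
rewrite add0n; apply: lerXn2r; rewrite ?nnegrE ?av_ge0//; first exact: le_trans m1.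
by rewrite le_max lexx orbT.
Qed.

(** The coefficient of [x^(n+1)] in the integral of [c Delta] from 0 to [x], as a polynomial in
    [mu]. Its constant term is 0 because [geom_y] starts at [y], so the denominators start at
    [k + 2]. *)
Definition moment_poly (c : fps2 R[i]) n : {poly R[i]} :=
  \poly_(h < n.+1) (if h is m.+1
    then \sum_(k < (n - m.+1).+1) c (n - m.+1 - k)%N k / (k + m).+2%:R else 0).

Lemma moment_polyE (c : fps2 R[i]) mu n :
  (moment_poly c n).[mu] = fcomp (integ (c * geom_y mu)) ond n.+1 0%N.
Proof.
rewrite fcomp_ond horner_poly.
transitivity (\sum_(a < n.+1) a.+1%:R^-1 * (c * geom_y mu) (n - a)%N a); last first.
  by move: (c * _) => u; rewrite [RHS]big_ord_recl /= add0r.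
pose F a h := a.+1%:R^-1 * (c (n - a)%N (a - h)%N * geom_y mu 0%N h).
transitivity (\sum_(a < n.+1) \sum_(h < a.+1) F a h); last first.
  apply: eq_bigr => a _; rewrite -mulr_sumr; congr (_ * _).
  rewrite coef2M [RHS]big_ord_recr /= [X in _ = X + _]big1 ?add0r; last first.
    move=> k _; rewrite big1// => l _.
    rewrite (_ : (n - a - k == 0)%N = false) ?mulr0//; have := ltn_ord k; lia.
  rewrite subnn [RHS](reindex_inj rev_ord_inj) /=; apply: eq_bigr => l _.
  have la : (l <= a)%N by rewrite -ltnS.
  by rewrite subSS subKn.
rewrite triangle_exchange; apply: eq_bigr => h _.
case: h => [[|m] hn] /=.
  by rewrite mul0r big1// => k _; rewrite /F /= !mulr0.
rewrite mulr_suml; apply: eq_bigr => k _; rewrite /F /=.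
rewrite subnDA addKn addSn addnC [RHS]mulrCA mulrA; congr (_ * _).
Qed.

Lemma family_obstruction w : convergent w -> w 0%N 0%N != 0 ->
  ~ convergent_vf (flog (phi_family 0 w)) ->
  exists D, [/\ convergent D, D 0%N 0%N = 0 & non_embeddable_class (phi_family D w)].
Proof.
move=> cw w00 ndiv; have bw := (convergent_bd w).1 cw.
apply: contrapT => none.
have emb D : bd D -> D 0%N 0%N = 0 -> embeddable_class (phi_family D w).
  move=> /convergent_bd cD D00; apply: contrapT => nemb; apply: none.
  by exists D; split=> //; split=> //; exact: phi_family_unipotent.
apply: ndiv.
have logX : is_log (family 0 w) (flog (phi_family 0 w)).
  by apply: flog_is_log; apply: family_tangent_id.
set X := flog _ in logX *.
have [a [b [_ Xy _ b00]]] := family_log_coefs (erefl : (0 : fps2 R[i]) 0%N 0%N = 0) logX.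
have [c bc] : exists c, b * c = 1 by apply: fps2_inv; rewrite b00.
have first_order mu : X varx = 0 /\ bd (fcomp (integ (c * geom_y mu)) ond).
  have g00 : geom_y mu 0%N 0%N = 0 by [].
  have bg := bd_geom_y mu.
  have [|e [ve e0 be]] := embeddable_first_order bg g00 bw w00.
    by move=> x; apply: emb; [exact: bdZ|rewrite coef2Z g00 mulr0].
  have [Xx eE] := first_variation logX Xy bc ve e0.
  by split; [exact: Xx|move: (bdN be); rewrite eE opprK; exact].
have Xx := (first_order 0).1.
have bc' : bd c.
  have [n|x|M M1 HM] := @complex_poly_family_bound R (moment_poly c).
  - exact: size_poly.
  - have [M M1 HM] := bd_geometric (first_order x%:C%C).2.
    (* The coefficient of index [n + 1] is bounded by [M^(n+2)], and [n + 2] is at most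
       [2(n + 1)]. *)
    exists (M ^+ 2) => n; rewrite moment_polyE -exprM.
    apply: le_trans (HM _ _) _; apply: ler_weXn2l => //; lia.
  (* The coefficient of [mu^(m+1)] in the polynomial of index [m + 1 + d] is a moment of the
     homogeneous part of degree [d] of [c]. *)
  apply: geometric_bd; apply: (@moments_geometric _ _ _ c M M1) => m d.
  have := HM (m.+1 + d)%N m.+1; rewrite coef_poly ltnS leq_addr.
  by rewrite addKn.
have bb : bd b by exact: bd_inverse_unit bc bc'.
split; apply/convergent_bd.
  rewrite -[(vf_coefs X).1]/(X varx) Xx; exact: bd0.
rewrite -[(vf_coefs X).2]/(X vary) Xy; apply: bdM => //.
by apply: bdM; [exact: bd_vary|apply: bdB; [exact: bd_vary|exact: bd_varx]].
Qed.

End Main.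

Theorem proposition7p1 (R : realType) (w : fps2 R[i])
    (w_convergent : convergent w) (w00 : w 0%N 0%N != 0)
    (log_divergent : ~ convergent_vf (flog (phi_family 0 w))) :
  exists Delta : fps2 R[i],
    [/\ convergent Delta, Delta 0%N 0%N = 0 &
        non_embeddable_class (phi_family Delta w)].
Proof. exact: family_obstruction. Qed.
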